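(* Let $k$ be a field and let $f: X \to Y$ be a local weak equivalence between presheaves of Kan complexes on the finite étale site $fet\vert_k$ of $k$, such that $X$ and $Y$ are sectionwise $n$-types (for some $n$). Then the induced map of simplicial sets $$f_{\ast}: \varinjlim_{L/k}\ \mathbf{hom}(EG \times_{G} \operatorname{Sp}(L),X) \to \varinjlim_{L/k}\ \mathbf{hom}(EG \times_{G} \operatorname{Sp}(L),Y)$$ is a weak equivalence, where $L/k$ varies over the finite Galois extensions of $k$ inside a fixed algebraic closure and $G = G(L/k)$ is the Galois group of $L/k$.
   Context: The finite étale site $fet\vert_k$ has as objects the finite disjoint unions $\operatorname{Sp}(L_1) \sqcup \dots \sqcup \operatorname{Sp}(L_n)$ of spectra of finite separable extensions $L_i/k$, with $k$-scheme morphisms; coverings are the (jointly) surjective families. Write $X(L) = X(\operatorname{Sp}(L))$. A presheaf of Kan complexes is a presheaf of simplicial sets (simplicial presheaf) $X$ with every $X(U)$ a Kan complex. A map $X \to Y$ of simplicial presheaves is a local weak equivalence if $\varinjlim_{L/k} X(L) \to \varinjlim_{L/k} Y(L)$ is a weak equivalence of simplicial sets, where $L/k$ varies over finite Galois extensions in the fixed algebraic closure. For a finite Galois extension $L/k$ with group $G$, $G$ acts on the representable sheaf $\operatorname{Sp}(L)$, and $EG \times_G \operatorname{Sp}(L)$ is the Borel construction: the simplicial presheaf whose sections at $U$ are the nerve of the translation groupoid of $G$ acting on $\hom(U,\operatorname{Sp}(L))$; its $n$-simplices are $\bigsqcup_{G^{\times n}} \operatorname{Sp}(L)$. Inclusions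 $L \subset L'$ induce maps $EG(L'/k) \times_{G(L'/k)} \operatorname{Sp}(L') \to EG(L/k) \times_{G(L/k)} \operatorname{Sp}(L)$, and the colimits are over the resulting filtered diagrams. $\mathbf{hom}(U,X)$ is the simplicial set whose $n$-simplices are the simplicial presheaf maps $U \times \Delta^n \to X$. $X$ is a sectionwise $n$-type if the canonical map $X \to \mathbf{P}_nX$ to its $n$th Moore-Postnikov section (formed sectionwise) is a weak equivalence in each section; equivalently $\pi_s(X(U),x)$ is trivial for all $U$, all vertices $x \in X(U)$ and all $s>n$. *)

(* Defs.v *)
From HB Require Import structures.
From mathcomp Require Import all_boot all_order all_algebra all_fingroup all_field.
From mathcomp Require Import boolp.
From Stdlib Require Import Relation_Operators.

Set Implicit Arguments.
Unset Strict Implicit.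
Unset Printing Implicit Defensive.

Import GRing.Theory.

Local Open Scope ring_scope.

Section FiniteSubextensions.
Variables (k K : fieldType) (iota : {rmorphism k -> K}).

(* Finite subextensions of K/k, as subsets of K.  The elements of such a
   subextension are made into a fieldExtType over k, by choice of a basis. *)
Record finsub := FinSub {
  fs_mem : {pred K};
  fs_closed : divring_closed fs_mem;
  fs_base : forall c, iota c \in fs_mem;
  fs_fin : exists n (b : 'I_n -> K), (forall i, b i \in fs_mem) /\
    {in fs_mem, forall x, exists c : 'I_n -> k, x = \sum_i iota (c i) * b i} }.

Record fs_elt (L : finsub) :=
  FsElt { fs_val : K; fs_valP : fs_val \in fs_mem L }.

HB.instance Definition _ (L : finsub) := [isSub for @fs_val L].
HB.instance Definition _ (L : finsub) := [Choice of fs_elt L by <:].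
HB.instance Definition _ (L : finsub) :=
  GRing.isDivringClosed.Build K (fs_mem L) (fs_closed L).
HB.instance Definition _ (L : finsub) :=
  [SubChoice_isSubIntegralDomain of fs_elt L by <:].
HB.instance Definition _ (L : finsub) :=
  [SubIntegralDomain_isSubField of fs_elt L by <:].

Section FsAlgebra.
Variable L : finsub.
Implicit Types x y : fs_elt L.

Definition fs_scale (c : k) x : fs_elt L :=
  FsElt (rpredM (fs_base L c) (fs_valP x)).

Fact fs_scalerA a b x : fs_scale a (fs_scale b x) = fs_scale (a * b) x.
Proof. by apply: val_inj; rewrite /= rmorphM mulrA. Qed.
Fact fs_scale1r : left_id 1 fs_scale.
Proof. by move=> x; apply: val_inj; rewrite /= rmorph1 mul1r. Qed.
Fact fs_scalerDr : right_distributive fs_scale +%R.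
Proof. by move=> a x y; apply: val_inj; rewrite /= mulrDr. Qed.
Fact fs_scalerDl x : {morph fs_scale^~ x : a b / a + b}.
Proof. by move=> a b; apply: val_inj; rewrite /= !rmorphD mulrDl. Qed.
HB.instance Definition _ := GRing.Zmodule_isLmodule.Build k (fs_elt L)
  fs_scalerA fs_scale1r fs_scalerDr fs_scalerDl.

Fact fs_scalerAl a x y : a *: (x * y) = (a *: x) * y.
Proof. by apply: val_inj; rewrite /= mulrA. Qed.
HB.instance Definition _ := GRing.Lmodule_isLalgebra.Build k (fs_elt L)
  fs_scalerAl.

Fact fs_scalerAr a x y : a *: (x * y) = x * (a *: y).
Proof. by apply: val_inj; rewrite /= mulrCA. Qed.
HB.instance Definition _ := GRing.Lalgebra_isAlgebra.Build k (fs_elt L)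
  fs_scalerAr.

Fact fs_hasFinDim : Lmodule_hasFinDim k (fs_elt L).
Proof.
pose spans n := exists b : 'I_n -> fs_elt L,
  forall x, exists c : 'I_n -> k, x = \sum_i c i *: b i.
have exS : exists n, `[< spans n >].
  have [n [b [bL sp]]] := fs_fin L; exists n; apply/asboolP.
  exists (fun i => FsElt (bL i)) => x.
  have [c xE] := sp _ (fs_valP x); exists c; apply: val_inj.
  by rewrite [val x]xE raddf_sum.
case: (ex_minnP exS) => n /asboolP/cid[b sp] nmin.
have free c : \sum_i c i *: b i = 0 -> forall i, c i = 0.
  move=> c0 i; apply/eqP/negPn/negP => ci0.
  case: n b sp nmin c c0 i ci0 => [|n] b sp nmin c c0 i ci0; first by case: i ci0.
  have /nmin : `[< spans n >]; last by rewrite ltnn.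
  have bi : b i = \sum_j (- (c i)^-1 * c (lift i j)) *: b (lift i j).
    move: c0; rewrite (bigD1_ord i) //= => /eqP; rewrite addr_eq0 => /eqP e.
    transitivity ((c i)^-1 *: (c i *: b i)).
      by rewrite scalerA mulVf // scale1r.
    rewrite e scalerN scaler_sumr -sumrN; apply: eq_bigr => j _.
    by rewrite scalerA mulNr scaleNr.
  apply/asboolP; exists (b \o lift i) => x; have [d ->] := sp x.
  exists (fun j => d i * (- (c i)^-1 * c (lift i j)) + d (lift i j)).
  rewrite (bigD1_ord i) //= [in LHS]bi scaler_sumr -big_split /=.
  by apply: eq_bigr => j _; rewrite scalerA scalerDl.
pose r2v (r : 'rV[k]_n) := \sum_i r 0 i *: b i.
have r2v_lin : linear r2v.
  move=> a u v; rewrite /r2v scaler_sumr -big_split /=.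
  by apply: eq_bigr => i _; rewrite !mxE scalerDl scalerA.
pose r2vL : {linear _ -> _} :=
  HB.pack r2v (GRing.isLinear.Build _ _ _ _ r2v r2v_lin).
have v2rP x : {r : 'rV[k]_n | x = r2vL r}.
  apply: cid; have [c ->] := sp x; exists (\row_i c i).
  by apply: eq_bigr => i _; rewrite mxE.
pose v2r x := sval (v2rP x).
have v2rK : cancel v2r r2vL by move=> x; rewrite /v2r; case: (v2rP x).
have r2v_inj : injective r2vL.
  move=> u v /eqP; rewrite -subr_eq0 -raddfB => /eqP /free uv.
  by apply/rowP => i; apply/eqP; rewrite -subr_eq0; have := uv i; rewrite !mxE => ->.
have r2vK : cancel r2vL v2r by move=> r; apply: r2v_inj; exact: v2rK.
by exists n, v2r; [apply: can2_linear v2rK | exists r2v].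
Qed.
HB.instance Definition _ := fs_hasFinDim.
End FsAlgebra.

(* The library's Galois theory lives in a splittingFieldType, so normality is
   recorded first, and galois is then stated in the resulting structure. *)
Record finsplit := FinSplit {
  fsp_sub :> finsub;
  fsp_split : SplittingField.axiom (fs_elt fsp_sub) }.

Definition gal_elt (L : finsplit) : Type := fs_elt L.
HB.instance Definition _ (L : finsplit) := GRing.SubField.on (gal_elt L).
HB.instance Definition _ (L : finsplit) := FieldExt.on (gal_elt L).
HB.instance Definition _ (L : finsplit) :=
  FieldExt_isSplittingField.Build k (gal_elt L) (fsp_split L).

Record galsub := GalSub {
  gs_split :> finsplit;
  gs_galois : galois 1 {: gal_elt gs_split} }.

Definition gs_sub (L L' : galsub) : Prop := {subset fs_mem L <= fs_mem L'}.

Lemma gs_separable (L : galsub) : separable 1 {: gal_elt L}.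
Proof. by case/and3P: (gs_galois L). Qed.

Section Inclusion.
Variables (L L' : galsub) (sLL' : gs_sub L L').

Definition gs_incl_fun (x : gal_elt L) : gal_elt L' := FsElt (sLL' (fs_valP x)).

Fact gs_incl_linear : linear gs_incl_fun.
Proof. by move=> c x y; apply: val_inj. Qed.
HB.instance Definition _ :=
  GRing.isLinear.Build k (gal_elt L) (gal_elt L') _ gs_incl_fun gs_incl_linear.
Fact gs_incl_monoid_morphism : monoid_morphism gs_incl_fun.
Proof. by split=> [|x y]; apply: val_inj. Qed.
HB.instance Definition _ :=
  GRing.isMonoidMorphism.Build (gal_elt L) (gal_elt L') gs_incl_fun
    gs_incl_monoid_morphism.

Definition gs_incl : 'AHom(gal_elt L, gal_elt L') := linfun_ahom gs_incl_fun.

Lemma gs_inclE x : fs_val (gs_incl x) = fs_val x. Proof. by rewrite lfunE. Qed.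

(* gal_of {: L} is the group of all automorphisms of L over k, with the law
   (s * t) x = t (s x).  By normality an automorphism of L' restricts to L. *)
Lemma gal_stable (s : gal_of {: gal_elt L'}) x :
  fs_val (s (gs_incl x)) \in fs_mem L.
Proof.
have nE : normalField 1 (gs_incl @: {: gal_elt L})%AS.
  apply/splitting_normalField; first exact: sub1v.
  have [p /polyOver1P[q ->] [rs Dp defL]] := fsp_split L.
  exists (map_poly (in_alg (gal_elt L')) q).
    by apply/polyOver1P; exists q.
  exists (map gs_incl rs); last first.
    by rewrite /= -[in RHS]defL aimg_adjoin_seq aimg1.
  have -> : map_poly (in_alg (gal_elt L')) q
          = map_poly gs_incl (map_poly (in_alg (gal_elt L)) q).
    by rewrite -map_poly_comp; apply: eq_map_poly => c /=; rewrite rmorph_alg.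
  rewrite big_map -(eqp_map gs_incl) in Dp *.
  apply: (eqp_trans Dp); rewrite rmorph_prod /=.
  by under eq_bigr do rewrite rmorphB /= map_polyX map_polyC /=; exact: eqpxx.
have /eqP sE : (s @: (gs_incl @: {: gal_elt L}) == gs_incl @: {: gal_elt L})%VS.
  by apply: (forall_inP nE); rewrite inE kAutfE; apply: k1AHom.
have : s (gs_incl x) \in (gs_incl @: {: gal_elt L})%VS.
  by rewrite -sE; apply/memv_img/memv_img/memvf.
by case/memv_imgP => y _ ->; rewrite gs_inclE; apply: fs_valP.
Qed.

Section Res.
Variable s : gal_of {: gal_elt L'}.

Definition res_fun (x : gal_elt L) : gal_elt L := FsElt (gal_stable s x).

Fact res_linear : linear res_fun.
Proof.
by move=> c x y; apply: val_inj; rewrite /= linearP linearP.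
Qed.
HB.instance Definition _ :=
  GRing.isLinear.Build k (gal_elt L) (gal_elt L) _ res_fun res_linear.
Fact res_monoid_morphism : monoid_morphism res_fun.
Proof. by split=> [|x y]; apply: val_inj; rewrite /= ?rmorph1 // !rmorphM. Qed.
HB.instance Definition _ :=
  GRing.isMonoidMorphism.Build (gal_elt L) (gal_elt L) res_fun
    res_monoid_morphism.

Definition gal_res : gal_of {: gal_elt L} :=
  gal {: gal_elt L} (linfun_ahom res_fun).

Lemma gal_resE x : gs_incl (gal_res x) = s (gs_incl x).
Proof.
rewrite /gal_res galK ?subvf ?memvf //; apply: val_inj.
by rewrite [LHS]gs_inclE lfunE.
Qed.
End Res.
End Inclusion.
End FiniteSubextensions.

Section Quotient.
Variables (T : Type) (R : T -> T -> Prop).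

(* Quotient by the equivalence relation generated by R.  The generic quotients
   of the library need a choiceType, whose universe is too small for colimits
   indexed by field extensions. *)
Definition quot : Type :=
  {A : T -> Prop | exists x, A = clos_refl_sym_trans T R x}.

Definition quot_pi (x : T) : quot := exist _ (clos_refl_sym_trans T R x)
  (ex_intro _ x erefl).

Definition quot_repr (q : quot) : T := sval (cid (svalP q)).

Lemma quot_reprK q : quot_pi (quot_repr q) = q.
Proof.
by rewrite /quot_repr; case: cid => x; case: q => A Ax /= e; apply: eq_exist.
Qed.

Lemma quot_piP x y : quot_pi x = quot_pi y <-> clos_refl_sym_trans T R x y.
Proof.
split=> [[e]|xy]; first by rewrite e; apply: rst_refl.
apply: eq_exist; apply: funext => z; apply/propext; split=> h.
  by apply: rst_trans h; apply: rst_sym.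
exact: rst_trans h.
Qed.
End Quotient.

Section QuotientMap.
Variables (T T' : Type) (R : T -> T -> Prop) (R' : T' -> T' -> Prop).
Variables (f : T -> T') (fR : forall x y, R x y -> R' (f x) (f y)).

Definition quot_map (q : quot R) : quot R' := quot_pi R' (f (quot_repr q)).

Lemma quot_mapE x : quot_map (quot_pi R x) = quot_pi R' (f x).
Proof.
have fRc y z : clos_refl_sym_trans T R y z ->
    clos_refl_sym_trans T' R' (f y) (f z).
  elim=> {y z} [y z /fR|y|y z _|y z t _ yz _ zt].
  - exact: rst_step.
  - exact: rst_refl.
  - exact: rst_sym.
  - exact: rst_trans yz zt.
by apply/quot_piP/fRc/quot_piP; rewrite quot_reprK.
Qed.
End QuotientMap.

#[local] Obligation Tactic := idtac.

Section SimplexCategory.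

Record mono (m n : nat) := Mono {
  mono_fun :> 'I_m.+1 -> 'I_n.+1;
  monoP : {homo mono_fun : i j / (i <= j)%N} }.

Lemma mono_eq m n (a b : mono m n) : a =1 b -> a = b.
Proof.
case: a b => [a aP] [b bP] /= /funext ab; case: _ / ab in bP *.
by congr Mono; apply: Prop_irrelevance.
Qed.

Definition mono_id n : mono n n := @Mono n n id (fun _ _ => id).
Definition mono_comp l m n (b : mono m n) (a : mono l m) : mono l n :=
  Mono (fun i j ij => monoP b (monoP a ij)).
Definition mono_const m n (i : 'I_n.+1) : mono m n :=
  @Mono m n (fun=> i) (fun _ _ _ => leqnn i).
End SimplexCategory.

Record sset := SSet {
  simp :> nat -> Type;
  sact : forall m n, mono m n -> simp n -> simp m;
  sact_id : forall n (x : simp n), sact (mono_id n) x = x;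
  sact_comp : forall l m n (b : mono m n) (a : mono l m) (x : simp n),
    sact (mono_comp b a) x = sact a (sact b x) }.

Record smap (X Y : sset) := SMap {
  smap_fun :> forall n, X n -> Y n;
  smap_nat : forall m n (a : mono m n) (x : X n),
    smap_fun (sact a x) = sact a (smap_fun x) }.

Lemma smap_eq X Y (f g : smap X Y) : (forall n x, f n x = g n x) -> f = g.
Proof.
case: f g => [f fN] [g gN] /= fg.
have {}fg : f = g.
  by apply: functional_extensionality_dep => n; apply: funext => x; apply: fg.
by case: _ / fg in gN *; congr SMap; apply: Prop_irrelevance.
Qed.

Definition smap_id X : smap X X := @SMap X X (fun _ x => x) (fun _ _ _ _ => erefl).

Program Definition smap_comp X Y Z (g : smap Y Z) (f : smap X Y) : smap X Z :=
  @SMap X Z (fun n x => g n (f n x)) _.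
Next Obligation. by move=> *; rewrite /= !smap_nat. Qed.

Program Definition simplex (n : nat) : sset :=
  @SSet (fun m => mono m n) (fun l m a x => mono_comp x a) _ _.
Next Obligation. by move=> *; apply: mono_eq. Qed.
Next Obligation. by move=> *; apply: mono_eq. Qed.

Program Definition simplex_map m n (b : mono m n) : smap (simplex m) (simplex n) :=
  @SMap (simplex m) (simplex n) (fun _ x => mono_comp b x) _.
Next Obligation. by move=> *; apply: mono_eq. Qed.

Program Definition sprod (X Y : sset) : sset :=
  @SSet (fun n => X n * Y n)%type (fun m n a x => (sact a x.1, sact a x.2)) _ _.
Next Obligation. by move=> X Y n [x y]; rewrite /= !sact_id. Qed.
Next Obligation. by move=> *; rewrite /= !sact_comp. Qed.

Program Definition sprod_map X X' Y Y' (f : smap X X') (g : smap Y Y') :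
    smap (sprod X Y) (sprod X' Y') :=
  @SMap (sprod X Y) (sprod X' Y') (fun n x => (f n x.1, g n x.2)) _.
Next Obligation. by move=> *; rewrite /= !smap_nat. Qed.

Program Definition horn (n : nat) (i : 'I_n.+1) : sset :=
  @SSet (fun m => {x : mono m n | exists2 j, j != i & forall l, x l != j})
    (fun l m a x => exist _ (mono_comp (sval x) a) _) _ _.
Next Obligation.
by move=> n i l m a [x [j ji xj]]; exists j => // t; apply: xj.
Qed.
Next Obligation. by move=> n i m [x p]; apply: eq_exist; apply: mono_eq. Qed.
Next Obligation. by move=> *; apply: eq_exist; apply: mono_eq. Qed.

Program Definition horn_incl n (i : 'I_n.+1) : smap (horn i) (simplex n) :=
  @SMap (horn i) (simplex n) (fun m x => sval x) _.
Next Obligation. by []. Qed.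

Definition kan (X : sset) : Prop :=
  forall n (i : 'I_n.+2) (h : smap (horn i) X),
    exists s : smap (simplex n.+1) X, smap_comp s (horn_incl i) = h.

Definition elem_homotopic (X Y : sset) (f g : smap X Y) : Prop :=
  exists H : smap (sprod X (simplex 1)) Y,
    (forall n x, H n (x, mono_const n ord0) = f n x) /\
    (forall n x, H n (x, mono_const n ord_max) = g n x).

Definition homotopic (X Y : sset) : smap X Y -> smap X Y -> Prop :=
  clos_refl_sym_trans (smap X Y) (@elem_homotopic X Y).

(* Weak equivalences of arbitrary simplicial sets: f induces a bijection
   [Y, K] -> [X, K] on (unpointed, simplicial) homotopy classes of maps, for
   every Kan complex K. *)
Definition weak_equiv (X Y : sset) (f : smap X Y) : Prop :=
  forall K : sset, kan K ->
    (forall u : smap X K, exists v : smap Y K, homotopic (smap_comp v f) u) /\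
    (forall v w : smap Y K,
       homotopic (smap_comp v f) (smap_comp w f) -> homotopic v w).

(* The Moore-Postnikov section P_n X: two q-simplices Delta^q -> X are
   identified when they agree on the n-skeleton of Delta^q. *)
Section MoorePostnikov.
Variables (n : nat) (X : sset).

Definition mp_rel q (x y : X q) : Prop :=
  forall m (a : mono m q), (m <= n)%N -> sact a x = sact a y.

Fact mp_rel_act p q (b : mono p q) (x y : X q) :
  mp_rel x y -> mp_rel (sact b x) (sact b y).
Proof. by move=> xy m a mn; rewrite -!sact_comp; apply: xy. Qed.

Program Definition postnikov : sset :=
  @SSet (fun q => quot (@mp_rel q))
    (fun p q b => quot_map (@mp_rel p) (sact b)) _ _.
Next Obligation.
by move=> q x; rewrite -[x]quot_reprK (quot_mapE (@mp_rel_act _ _ _)) sact_id.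
Qed.
Next Obligation.
move=> l p q b a x; rewrite -[x]quot_reprK !(quot_mapE (@mp_rel_act _ _ _)).
by rewrite sact_comp.
Qed.

Program Definition postnikov_map : smap X postnikov :=
  @SMap X postnikov (fun q => quot_pi (@mp_rel q)) _.
Next Obligation.
by move=> p q b x /=; rewrite (quot_mapE (@mp_rel_act _ _ _)).
Qed.
End MoorePostnikov.

Record cat := Cat {
  ob :> Type;
  mor : ob -> ob -> Type;
  idm : forall x, mor x x;
  compm : forall x y z, mor y z -> mor x y -> mor x z;
  compm1 : forall x y (f : mor x y), compm f (idm x) = f;
  comp1m : forall x y (f : mor x y), compm (idm y) f = f;
  compmA : forall x y z t (h : mor z t) (g : mor y z) (f : mor x y),
    compm h (compm g f) = compm (compm h g) f }.

Definition opcat (C : cat) : cat :=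
  @Cat C (fun x y => mor y x) (@idm C) (fun x y z g f => compm f g)
    (fun x y f => comp1m f) (fun x y f => compm1 f)
    (fun x y z t h g f => esym (compmA f g h)).

(* Diagrams of simplicial sets; simplicial presheaves on C are the diagrams
   indexed by opcat C. *)
Record sdiag (C : cat) := SDiag {
  sd_ob :> C -> sset;
  sd_map : forall x y : C, mor x y -> smap (sd_ob x) (sd_ob y);
  sd_id : forall (x : C) n (s : sd_ob x n), sd_map (idm x) n s = s;
  sd_comp : forall (x y z : C) (g : mor y z) (f : mor x y) n (s : sd_ob x n),
    sd_map (compm g f) n s = sd_map g n (sd_map f n s) }.

Record sdmap C (D E : sdiag C) := SDMap {
  sdm_fun :> forall c : C, smap (D c) (E c);
  sdm_nat : forall (x y : C) (f : mor x y) n (s : D x n),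
    sdm_fun y n (sd_map D f n s) = sd_map E f n (sdm_fun x n s) }.

Lemma sdmap_eq C (D E : sdiag C) (f g : sdmap D E) :
  (forall c n x, f c n x = g c n x) -> f = g.
Proof.
case: f g => [f fN] [g gN] /= fg.
have {}fg : f = g.
  by apply: functional_extensionality_dep => c; apply: smap_eq => n x; apply: fg.
by case: _ / fg in gN *; congr SDMap; apply: Prop_irrelevance.
Qed.

Program Definition sdmap_comp C (D E F : sdiag C)
    (g : sdmap E F) (f : sdmap D E) : sdmap D F :=
  @SDMap C D F (fun c => smap_comp (g c) (f c)) _.
Next Obligation. by move=> *; rewrite /= !sdm_nat. Qed.

Section Colimit.
Variables (C : cat) (D : sdiag C).

Definition colim_step n (p q : {c : C & D c n}) : Prop :=
  exists f : mor (tag p) (tag q), sd_map D f n (tagged p) = tagged q.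

Definition colim_act m n (a : mono m n) (p : {c : C & D c n}) :
  {c : C & D c m} := Tagged (fun c : C => D c m) (sact a (tagged p)).

Fact colim_actP m n (a : mono m n) p q :
  colim_step p q -> colim_step (colim_act a p) (colim_act a q).
Proof. by case=> f pq; exists f; rewrite smap_nat pq. Qed.

Program Definition colim : sset :=
  @SSet (fun n => quot (@colim_step n))
    (fun m n a => quot_map (@colim_step m) (colim_act a)) _ _.
Next Obligation.
move=> n x; rewrite -[x]quot_reprK (quot_mapE (@colim_actP _ _ _)).
by case: (quot_repr x) => c s; rewrite /colim_act /= sact_id.
Qed.
Next Obligation.
move=> l m n b a x; rewrite -[x]quot_reprK !(quot_mapE (@colim_actP _ _ _)).
by rewrite /colim_act /= sact_comp.
Qed.
End Colimit.

Section ColimitMap.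
Variables (C : cat) (D E : sdiag C) (f : sdmap D E).

Definition colim_fun n (p : {c : C & D c n}) : {c : C & E c n} :=
  Tagged (fun c : C => E c n) (f (tag p) n (tagged p)).

Fact colim_funP n (p q : {c : C & D c n}) :
  colim_step p q -> colim_step (colim_fun p) (colim_fun q).
Proof. by case=> h pq; exists h; rewrite /= -pq sdm_nat. Qed.

Program Definition colim_map : smap (colim D) (colim E) :=
  @SMap (colim D) (colim E) (fun n => quot_map (@colim_step C E n) (@colim_fun n)) _.
Next Obligation.
move=> m n a x /=; rewrite -[x]quot_reprK.
rewrite (quot_mapE (@colim_actP _ _ _ _ _)) !(quot_mapE (@colim_funP _)).
rewrite (quot_mapE (@colim_actP _ _ _ _ _)).
by rewrite /colim_act /colim_fun /= smap_nat.
Qed.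
End ColimitMap.

Program Definition sd_prod C (D : sdiag C) (K : sset) : sdiag C :=
  @SDiag C (fun c => sprod (D c) K)
    (fun x y f => sprod_map (sd_map D f) (smap_id K)) _ _.
Next Obligation. by move=> C D K c n [x y]; rewrite /= sd_id. Qed.
Next Obligation. by move=> *; rewrite /= sd_comp. Qed.

Program Definition sd_prod_map C (D E : sdiag C) (K L : sset)
    (f : sdmap D E) (u : smap K L) : sdmap (sd_prod D K) (sd_prod E L) :=
  @SDMap C (sd_prod D K) (sd_prod E L) (fun c => sprod_map (f c) u) _.
Next Obligation. by move=> *; rewrite /= sdm_nat. Qed.

Program Definition sdmap_id C (D : sdiag C) : sdmap D D :=
  @SDMap C D D (fun c => smap_id (D c)) _.
Next Obligation. by []. Qed.

(* Function complex: n-simplices are the maps U x Delta^n -> X. *)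
Program Definition hom_sset C (U X : sdiag C) : sset :=
  @SSet (fun n => sdmap (sd_prod U (simplex n)) X)
    (fun m n a x => sdmap_comp x (sd_prod_map (sdmap_id U) (simplex_map a))) _ _.
Next Obligation.
move=> C U X n x; apply: sdmap_eq => c m [u b] /=.
by congr (x c m (_, _)); exact: mono_eq.
Qed.
Next Obligation.
move=> C U X l m n b a x; apply: sdmap_eq => c r [u d] /=.
by congr (x c r (_, _)); exact: mono_eq.
Qed.

Program Definition hom_sset_post C (U X Y : sdiag C) (f : sdmap X Y) :
    smap (hom_sset U X) (hom_sset U Y) :=
  @SMap (hom_sset U X) (hom_sset U Y) (fun n x => sdmap_comp f x) _.
Next Obligation. by move=> *; apply: sdmap_eq. Qed.

Program Definition hom_sset_pre C (U V X : sdiag C) (g : sdmap U V) :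
    smap (hom_sset V X) (hom_sset U X) :=
  @SMap (hom_sset V X) (hom_sset U X)
    (fun n x => sdmap_comp x (sd_prod_map g (smap_id (simplex n)))) _.
Next Obligation. by move=> *; apply: sdmap_eq. Qed.

(* Nerve of the translation groupoid of G acting on S, whose morphisms x -> y
   are the g with act g x = y: an n-simplex is a functor from the ordinal [n],
   determined by its source x_0 and n elements of G. *)
Section TranslationNerve.
Variables (G : groupType) (S : Type) (act : G -> S -> S).

Record tsimp (n : nat) := TSimp {
  ts_ob : 'I_n.+1 -> S;
  ts_mor : forall i j : 'I_n.+1, (i <= j)%N -> G;
  ts_morP : forall (i j : 'I_n.+1) (ij : (i <= j)%N),
    act (ts_mor ij) (ts_ob i) = ts_ob j;
  ts_id : forall (i : 'I_n.+1) (ii : (i <= i)%N), ts_mor ii = 1%g;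
  ts_comp : forall (i j l : 'I_n.+1)
      (ij : (i <= j)%N) (jl : (j <= l)%N) (il : (i <= l)%N),
    ts_mor il = (ts_mor jl * ts_mor ij)%g }.

Lemma tsimp_eq n (x y : tsimp n) :
  ts_ob x =1 ts_ob y ->
  (forall (i j : 'I_n.+1) (ij : (i <= j)%N), ts_mor x ij = ts_mor y ij) ->
  x = y.
Proof.
case: x y => [x g p1 p2 p3] [y h q1 q2 q3] /= /funext xy gh.
have {}gh : g = h.
  apply: functional_extensionality_dep => i.
  by apply: functional_extensionality_dep => j; apply: funext => ij.
case: _ / xy in q1 *; case: _ / gh in q1 q2 q3 *.
by congr TSimp; apply: Prop_irrelevance.
Qed.

Program Definition tnerve : sset :=
  @SSet tsimp
    (fun m n a x => @TSimp m (fun i => ts_ob x (a i))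
       (fun i j ij => ts_mor x (monoP a ij)) _ _ _) _ _.
Next Obligation. by move=> m n a x i j ij; rewrite ts_morP. Qed.
Next Obligation. by move=> *; apply: ts_id. Qed.
Next Obligation. by move=> *; apply: ts_comp. Qed.
Next Obligation.
by move=> *; apply: tsimp_eq => //= i j ij; congr ts_mor; apply: Prop_irrelevance.
Qed.
Next Obligation.
by move=> *; apply: tsimp_eq => //= i j ij; congr ts_mor; apply: Prop_irrelevance.
Qed.
End TranslationNerve.

Program Definition tnerve_map (G G' : groupType) (S S' : Type)
    (act : G -> S -> S) (act' : G' -> S' -> S') (r : G -> G') (f : S -> S')
    (r1 : r 1%g = 1%g) (rM : {morph r : x y / (x * y)%g})
    (rf : forall g s, f (act g s) = act' (r g) (f s)) :
    smap (tnerve act) (tnerve act') :=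
  @SMap (tnerve act) (tnerve act')
    (fun n x => @TSimp _ _ act' n (fun i => f (ts_ob x i))
       (fun i j ij => r (ts_mor x ij)) _ _ _) _.
Next Obligation.
by move=> G G' S S' act act' r f _ _ rf n x i j ij; rewrite -rf ts_morP.
Qed.
Next Obligation. by move=> *; rewrite /= ts_id. Qed.
Next Obligation.
by move=> G G' S S' act act' r f _ rM _ n x i j l ij jl il; rewrite -rM -ts_comp.
Qed.
Next Obligation. by move=> *; apply: tsimp_eq. Qed.

Section FiniteEtaleSite.
Variable k : fieldType.

(* Each Sp(L_i) is a one-point scheme, so a morphism of k-schemes between finite
   disjoint unions of such is a map on points together with a k-algebra morphism
   for each point of the source, in the opposite direction. *)
Record fet_ob := FetOb {
  fet_size : nat;
  fet_field : 'I_fet_size -> fieldExtType k;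
  fet_sep : forall i, separable 1 {: fet_field i} }.

Record fet_hom (U V : fet_ob) := FetHom {
  fet_pt : 'I_(fet_size U) -> 'I_(fet_size V);
  fet_pb : forall i, 'AHom(fet_field (fet_pt i), fet_field i) }.

Lemma fet_hom_eq U V (p : 'I_(fet_size U) -> 'I_(fet_size V))
    (b c : forall i, 'AHom(fet_field (p i), fet_field i)) :
  (forall i, b i =1 c i) -> FetHom b = FetHom c.
Proof.
move=> bc; congr FetHom; apply: functional_extensionality_dep => i.
by apply: val_inj; apply/lfunP => x; apply: bc.
Qed.

Definition fet_id (U : fet_ob) : fet_hom U U :=
  @FetHom U U id (fun i => \1%AF).

Definition fet_comp (U V W : fet_ob) (g : fet_hom V W) (f : fet_hom U V) :
    fet_hom U W :=
  @FetHom U W (fet_pt g \o fet_pt f)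
    (fun i => (fet_pb f i \o fet_pb g (fet_pt f i))%AF).

Program Definition fet : cat := @Cat fet_ob fet_hom fet_id fet_comp _ _ _.
Next Obligation.
move=> U V [p b]; rewrite /fet_comp /=.
by apply: fet_hom_eq => i x /=; rewrite comp_lfunE id_lfunE.
Qed.
Next Obligation.
move=> U V [p b]; rewrite /fet_comp /=.
by apply: fet_hom_eq => i x /=; rewrite comp_lfunE id_lfunE.
Qed.
Next Obligation.
by move=> *; apply: fet_hom_eq => i x /=; rewrite !comp_lfunE.
Qed.
End FiniteEtaleSite.

Definition spsh (k : fieldType) : Type := sdiag (opcat (fet k)).

Definition sectionwise_kan (k : fieldType) (X : spsh k) : Prop :=
  forall U : fet k, kan (X U).

Definition sectionwise_type (k : fieldType) (n : nat) (X : spsh k) : Prop :=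
  forall U : fet k, weak_equiv (postnikov_map n (X U)).

Section GaloisColimits.
Variables (k K : fieldType) (iota : {rmorphism k -> K}).
Implicit Types L : galsub iota.

Program Definition galcat : cat :=
  @Cat (galsub iota) (fun L L' => gs_sub L L') (fun L x Lx => Lx)
    (fun L L' L'' b a x Lx => b x (a x Lx)) _ _ _.
Next Obligation. by []. Qed.
Next Obligation. by []. Qed.
Next Obligation. by []. Qed.

Definition Sp L : fet k := @FetOb k 1 (fun=> gal_elt L) (fun=> gs_separable L).

Definition Sp_map L L' (h : gs_sub L L') : mor (Sp L') (Sp L) :=
  @FetHom k (Sp L') (Sp L) id (fun=> gs_incl h).

Definition Sp_gal L (s : gal_of {: gal_elt L}) : mor (Sp L) (Sp L) :=
  @FetHom k (Sp L) (Sp L) id (fun=> s).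

(* As the law of gal_of is reversed composition, Sp_gal is a left action. *)
Lemma Sp_gal1 L : Sp_gal 1%g = idm (Sp L).
Proof. by apply: fet_hom_eq => i x; rewrite gal_id id_lfunE. Qed.

Lemma Sp_galM L (s t : gal_of {: gal_elt L}) :
  Sp_gal (s * t)%g = compm (Sp_gal s) (Sp_gal t).
Proof. by apply: fet_hom_eq => i x /=; rewrite galM ?memvf // comp_lfunE. Qed.

Lemma Sp_map_id L (h : gs_sub L L) : Sp_map h = idm (Sp L).
Proof.
by apply: fet_hom_eq => i x; apply: val_inj; rewrite [LHS]gs_inclE id_lfunE.
Qed.

Lemma Sp_map_comp L L' L'' (h : gs_sub L L') (h' : gs_sub L' L'')
    (h'' : gs_sub L L'') : Sp_map h'' = compm (Sp_map h) (Sp_map h').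
Proof.
apply: fet_hom_eq => i x; apply: val_inj.
by rewrite /= comp_lfunE [LHS]gs_inclE !gs_inclE.
Qed.

Lemma Sp_map_gal L L' (h : gs_sub L L') (s : gal_of {: gal_elt L'}) :
  compm (Sp_map h) (Sp_gal s) = compm (Sp_gal (gal_res h s)) (Sp_map h).
Proof. by apply: fet_hom_eq => i x /=; rewrite !comp_lfunE -gal_resE. Qed.

Lemma gal_res_uniq L L' (h : gs_sub L L')
    (s : gal_of {: gal_elt L'}) (t : gal_of {: gal_elt L}) :
  (forall x, gs_incl h (t x) = s (gs_incl h x)) -> gal_res h s = t.
Proof.
move=> ht; apply/eqP/gal_eqP => x _; apply: (fmorph_inj (gs_incl h)).
exact: etrans (gal_resE h s x) (esym (ht x)).
Qed.

Lemma gal_res1 L L' (h : gs_sub L L') : gal_res h 1%g = 1%g.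
Proof. by apply: gal_res_uniq => x; rewrite !gal_id. Qed.

Lemma gal_resM L L' (h : gs_sub L L') : {morph gal_res h : s t / (s * t)%g}.
Proof.
by move=> s t; apply: gal_res_uniq => x; rewrite !galM ?memvf // !gal_resE.
Qed.

Lemma gal_res_id L (h : gs_sub L L) s : gal_res h s = s.
Proof.
have hE x : gs_incl h x = x by apply: val_inj; apply: gs_inclE.
by apply: gal_res_uniq => x; rewrite !hE.
Qed.

Lemma gal_res_comp L L' L'' (h : gs_sub L L') (h' : gs_sub L' L'')
    (h'' : gs_sub L L'') s : gal_res h'' s = gal_res h (gal_res h' s).
Proof.
have hE x : gs_incl h'' x = gs_incl h' (gs_incl h x).
  by apply: val_inj; rewrite [LHS]gs_inclE [RHS]gs_inclE [RHS]gs_inclE.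
by apply: gal_res_uniq => x; rewrite !hE -gal_resE -gal_resE.
Qed.

Section Sections.
Variable X : spsh k.

Program Definition sections : sdiag galcat :=
  @SDiag galcat (fun L => X (Sp L)) (fun L L' h => sd_map X (Sp_map h)) _ _.
Next Obligation. by move=> L n x; rewrite /= Sp_map_id; apply: sd_id. Qed.
Next Obligation.
move=> L L' L'' h' h n x.
by rewrite /= (Sp_map_comp h h'); apply: sd_comp.
Qed.
End Sections.

Program Definition sections_map (X Y : spsh k) (f : sdmap X Y) :
    sdmap (sections X) (sections Y) :=
  @SDMap galcat (sections X) (sections Y) (fun L => f (Sp L)) _.
Next Obligation.
by move=> X Y f L L' h n x; apply: (@sdm_nat _ _ _ f (Sp L) (Sp L') (Sp_map h)).
Qed.

Definition local_weak_equiv (X Y : spsh k) (f : sdmap X Y) : Prop :=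
  weak_equiv (colim_map (sections_map f)).

Definition borel_act L (U : fet k) (s : gal_of {: gal_elt L})
  (p : mor U (Sp L)) : mor U (Sp L) := compm (Sp_gal s) p.

Program Definition borel L : spsh k :=
  @SDiag (opcat (fet k)) (fun U => tnerve (@borel_act L U))
    (fun (U V : fet k) (p : mor V U) =>
       @tnerve_map _ _ _ _ (@borel_act L U) (@borel_act L V)
         id (fun q => compm q p) erefl (fun _ _ => erefl)
         (fun s q => esym (compmA (Sp_gal s) q p))) _ _.
Next Obligation.
by move=> L U n x; apply: tsimp_eq => //= i; apply: (@compm1 (fet k)).
Qed.
Next Obligation.
move=> L U V W p q n x; apply: tsimp_eq => //= i.
exact: (@compmA (fet k)).
Qed.

Fact borel_map_subproof L L' (h : gs_sub L L') (U : fet k) s (p : mor U (Sp L')) :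
  compm (Sp_map h) (borel_act s p) = borel_act (gal_res h s) (compm (Sp_map h) p).
Proof. by rewrite /borel_act !compmA Sp_map_gal. Qed.

Program Definition borel_map L L' (h : gs_sub L L') : sdmap (borel L') (borel L) :=
  @SDMap (opcat (fet k)) (borel L') (borel L)
    (fun U => tnerve_map (gal_res1 h) (gal_resM h)
                (@borel_map_subproof L L' h U)) _.
Next Obligation.
by move=> L L' h U V p n x; apply: tsimp_eq => //= i; apply: (@compmA (fet k)).
Qed.

Program Definition hom_borel (X : spsh k) : sdiag galcat :=
  @SDiag galcat (fun L => hom_sset (borel L) X)
    (fun L L' h => hom_sset_pre X (borel_map h)) _ _.
Next Obligation.
move=> X L n f; apply: sdmap_eq => U m [x a] /=; congr (f U m (_, _)).
apply: tsimp_eq => [i|i j ij] /=; last exact: gal_res_id.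
by rewrite Sp_map_id; apply: (@comp1m (fet k)).
Qed.
Next Obligation.
move=> X L L' L'' h' h n f; apply: sdmap_eq => U m [x a] /=.
congr (f U m (_, _)); apply: tsimp_eq => [i|i j ij] /=.
  by rewrite (Sp_map_comp h h'); apply/esym/(@compmA (fet k)).
exact: gal_res_comp.
Qed.

Program Definition hom_borel_map (X Y : spsh k) (f : sdmap X Y) :
    sdmap (hom_borel X) (hom_borel Y) :=
  @SDMap galcat (hom_borel X) (hom_borel Y) (fun L => hom_sset_post (borel L) f) _.
Next Obligation. by move=> *; apply: sdmap_eq. Qed.
End GaloisColimits.

(* Main.v *)
Require Import Defs.
From mathcomp Require Import all_boot all_order all_algebra all_fingroup all_field.
From HB Require Import structures.
From mathcomp Require Import boolp zify.
From Stdlib Require Import Relation_Operators.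
Import Defs.

Set Implicit Arguments.
Unset Strict Implicit.
Unset Printing Implicit Defensive.
#[local] Obligation Tactic := idtac.

(** Let P be the mapping path object of f: a simplex of P over U is a simplex x
    of X(U) together with a path in Y(U) that starts at f(x).  Then f is the
    composite of X -> P, which is a deformation retract naturally in U, and of
    p : P -> Y, the other end of the path, which is a Kan fibration in each
    section ([cocyl_fibration]).  It is therefore enough to show that p induces
    a map with the right lifting property against all boundary inclusions on
    the colimits of the function complexes: such a map has a section, unique up
    to homotopy ([sphere_lift_section], [sphere_lift_weak_equiv]).

    Two properties of p are used.  Horns are finite, so the colimit of the maps
    P(L) -> Y(L) is again a fibration; as f is a local weak equivalence it is
    also a homotopy equivalence of Kan complexes, hence it lifts spheres
    ([weak_equiv_sphere_lift]).  Boundaries are finite too, so a sphere lifting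
    problem for P(L) -> Y(L) is solved over some larger L'
    ([colim_sphere_lift_local]).  On the other hand, X(U) and Y(U) being
    n-types, P(U) -> Y(U) already lifts spheres of dimension at least n+1
    without any enlargement ([ntype_sphere_fill], [fibration_sphere_lift]).

    A sphere lifting problem for the function complexes is posed over a single
    L ([descend]); there it asks to extend a map from
    (EG x_G Sp(L)) x (boundary of Delta^m) to P over a given map from
    (EG x_G Sp(L)) x Delta^m to Y.  In each dimension the simplices of the
    latter presheaf are freely generated by finitely many simplices over Sp(L),
    those whose first vertex is the identity ([borel_free_gen]).  The extension
    is built on skeleta: in each low dimension it meets finitely many local
    problems, all of them solved over one larger field ([grow_skel]), and the
    partial extension is pulled back to that field, the r-skeleton being mapped
    to the r-skeleton.  From dimension n+2 on the field stays the same and the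
    induction runs through all dimensions ([lift_borel]).  The extensions of k
    form a directed system because the compositum of two finite Galois
    extensions is one ([galsub_directed]).

    Throughout, a partial map is given by its graph, a functional relation
    stable under the simplicial operators. *)

(** * Monotone maps *)

Definition misses q m (a : mono q m) (j : 'I_m.+1) : Prop := forall l, a l != j.

Definition nonsurj q m (a : mono q m) : Prop := exists j, misses a j.

Lemma misses_comp p q m (a : mono q m) (b : mono p q) j :
  misses a j -> misses (mono_comp a b) j.
Proof. by move=> aj l; apply: aj. Qed.

Lemma nonsurj_comp p q m (a : mono q m) (b : mono p q) :
  nonsurj a -> nonsurj (mono_comp a b).
Proof. by case=> j aj; exists j; apply: misses_comp. Qed.

Lemma mono_compA p q m r (c : mono m r) (b : mono q m) (a : mono p q) :
  mono_comp c (mono_comp b a) = mono_comp (mono_comp c b) a.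
Proof. exact: mono_eq. Qed.

Lemma mono_compI q m (a : mono q m) : mono_comp a (mono_id q) = a.
Proof. exact: mono_eq. Qed.

Lemma mono_Icomp q m (a : mono q m) : mono_comp (mono_id m) a = a.
Proof. exact: mono_eq. Qed.

Lemma mono_const_comp p q m (a : mono p q) (e : 'I_m.+1) :
  mono_comp (mono_const q e) a = mono_const p e.
Proof. exact: mono_eq. Qed.

Lemma surjP q m (a : mono q m) : ~ nonsurj a -> forall j, exists l, a l = j.
Proof.
move=> aS j; case: (pselect (exists l, a l = j)) => // nj; case: aS; exists j => l.
by apply/eqP => alj; apply: nj; exists l.
Qed.

(** The section can be made to pass through any given [t].  Thus a surjection is
    determined by its sections, which is the uniqueness part of the
    Eilenberg-Zilber lemma. *)
Lemma mono_section q m (a : mono q m) (t : 'I_q.+1) : ~ nonsurj a ->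
  exists d : mono m q, mono_comp a d = mono_id m /\ d (a t) = t.
Proof.
move=> /surjP /choice[d0 d0P].
pose d1 j := if j == a t then t else d0 j.
have d1P j : a (d1 j) = j by rewrite /d1; case: eqP => [->|_].
have d1M : {homo d1 : i j / (i <= j)%N}.
  move=> i j ij; case: (leqP (d1 i) (d1 j)) => // ji.
  have ji' : (j <= i)%N by have := monoP a (ltnW ji); rewrite !d1P.
  have e : i = j by apply/val_inj/eqP; rewrite eqn_leq ij ji'.
  by rewrite e ltnn in ji.
exists (Mono d1M); split; first by apply: mono_eq => j /=; rewrite d1P.
by rewrite /= /d1 eqxx.
Qed.

Lemma mono_lt_ge q m (d : mono q m) :
  {homo d : i j / (i < j)%N} -> forall i : 'I_q.+1, (i <= d i)%N.
Proof.
move=> dS [i iq]; elim: i iq => //= i IH iq.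
have iq' := ltnW iq; apply: leq_ltn_trans (IH iq') _.
by apply: dS => /=.
Qed.

(** A section [d] of [a] is strictly increasing, hence [i <= d i], and it permutes
    the ordinal; summing over [i] leaves only equalities. *)
Lemma mono_surj_id m (a : mono m m) : ~ nonsurj a -> a = mono_id m.
Proof.
move=> aS; have [d [ad _]] := mono_section ord0 aS.
have adE i : a (d i) = i by rewrite -[RHS](congr1 (fun g : mono m m => g i) ad).
have dS : {homo d : i j / (i < j)%N}.
  move=> i j ij; rewrite ltnNge; apply/negP => /(monoP a).
  by rewrite !adE leqNgt ij.
have dge := mono_lt_ge dS.
have dinj : injective d by move=> i j /(congr1 a); rewrite !adE.
suff dE i : d i = i by apply: mono_eq => i; rewrite -[in LHS](dE i) adE.
apply/eqP/negPn/negP => dni.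
have: (\sum_(j < m.+1) j < \sum_(j < m.+1) d j)%N.
  rewrite [ltnLHS](bigD1 i) // [ltnRHS](bigD1 i) //= -addSn leq_add //.
    by rewrite ltn_neqAle dge andbT eq_sym.
  by apply: leq_sum.
by rewrite [X in (X < _)%N](reindex_inj dinj) ltnn.
Qed.

Fact delta_mono m (j : 'I_m.+2) : {homo lift j : a b / (a <= b)%N}.
Proof. by move=> a b ab; rewrite /= leq_bump2. Qed.
Definition delta m (j : 'I_m.+2) : mono m m.+1 := Mono (@delta_mono m j).

Lemma delta_misses m (j : 'I_m.+2) : misses (delta j) j.
Proof. by move=> l; rewrite eq_sym neq_lift. Qed.

Lemma mono_mono p q m (d : mono q m) (a b : mono p q) :
  injective d -> mono_comp d a = mono_comp d b -> a = b.
Proof.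
move=> dI ab; apply: mono_eq => i; apply: dI.
exact: (congr1 (fun g : mono p m => g i) ab).
Qed.

Lemma delta_inj m (j : 'I_m.+2) : injective (delta j).
Proof. exact: lift_inj. Qed.

Lemma misses_delta q m (a : mono q m.+1) j :
  misses a j -> exists b, a = mono_comp (delta j) b.
Proof.
move=> aj; have /choice[b bP] : forall l, exists i, a l = lift j i.
  by move=> l; case: (unliftP j (a l)) (aj l) => [i ->|->]; [exists i|rewrite eqxx].
have bM : {homo b : i l / (i <= l)%N}.
  by move=> i l il; have := monoP a il; rewrite !bP /= leq_bump2.
by exists (Mono bM); apply: mono_eq => l; rewrite /= bP.
Qed.

Lemma not_nonsurj0 q (a : mono q 0) : ~ nonsurj a.
Proof. by case=> j /(_ ord0); rewrite (ord1 (a _)) (ord1 j) eqxx. Qed.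

Lemma nonsurj_factor q m (a : mono q m) : nonsurj a ->
  exists p (c : mono p m) (b : mono q p), (p < m)%N /\ a = mono_comp c b.
Proof.
case: m a => [a /not_nonsurj0//|m a [j /misses_delta[b ->]]].
by exists m, (delta j), b.
Qed.

(** * Partial maps and cell attachment *)

Section Attach.
Variables (C : cat) (B X : sdiag C).

(** The graph of a partial map from [B] to [X].  With graphs, attaching a cell is
    a union and restriction along a map is a precomposition. *)
Definition drel := forall (c : C) q, B c q -> X c q -> Prop.

Definition drel_dom (R : drel) (c : C) q (b : B c q) : Prop := exists x, R c q b x.

Definition drel_sub (R S : drel) : Prop :=
  forall (c : C) q (b : B c q) (x : X c q), R c q b x -> S c q b x.

Record drel_closed (R : drel) : Prop := DRelClosed {
  drel_act : forall (c : C) p q (a : mono p q) (b : B c q) (x : X c q),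
    R c q b x -> R c p (sact a b) (sact a x);
  drel_map : forall (c c' : C) (h : mor c c') q (b : B c q) (x : X c q),
    R c q b x -> R c' q (sd_map B h q b) (sd_map X h q x) }.

Definition skel (R : drel) n : Prop :=
  forall (c : C) q (b : B c q), (q < n)%N -> drel_dom R b.

Lemma skel_nonsurj (R : drel) n (c : C) p q (a : mono p q) (b : B c q) :
  drel_closed R -> skel R n -> (q <= n)%N -> nonsurj a -> drel_dom R (sact a b).
Proof.
move=> Rc Rs qn /nonsurj_factor[r [d [e [rq ->]]]]; rewrite sact_comp.
have [|x Rx] := Rs c r (sact d b); first exact: leq_trans rq qn.
by exists (sact e x); apply: (drel_act Rc).
Qed.

Variables (c0 : C) (gen : forall q, B c0 q -> Prop).

(** In each dimension [B] is a sum of copies of the representable at [c0], and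
    the generators are stable under degeneracies.  Borel constructions have this
    form; so does a simplicial set, as a diagram on the one-object category. *)
Record free_gen : Prop := FreeGen {
  fg_ex : forall (c : C) q (b : B c q),
    exists h : mor c0 c, exists2 b0 : B c0 q, gen b0 & b = sd_map B h q b0;
  fg_uniq : forall (c : C) q (b b' : B c0 q) (h h' : mor c0 c),
    gen b -> gen b' -> sd_map B h q b = sd_map B h' q b' -> h = h' /\ b = b';
  fg_degen : forall p q (a : mono p q) (b : B c0 q),
    gen b -> ~ nonsurj a -> gen (sact a b) }.

(** [K] is the constraint imposed on values, such as lying over given simplices of
    a base.  By [dp_gen] a generator that has no value has no restriction with a
    value either; otherwise a filler could contradict the latter. *)
Record dpartial (K R : drel) : Prop := DPartial {
  dp_closed : drel_closed R;
  dp_in : drel_sub R K;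
  dp_fun : forall (c : C) q (b : B c q) (x y : X c q),
    R c q b x -> R c q b y -> x = y;
  dp_gen : forall (c : C) (h : mor c0 c) q (b : B c0 q),
    gen b -> drel_dom R (sd_map B h q b) -> drel_dom R b }.

Hypothesis genP : free_gen.
Variable K : drel.
Hypothesis K_closed : drel_closed K.

Definition fills (R : drel) q (b : B c0 q) (x : X c0 q) : Prop :=
  K b x /\ forall p (a : mono p q) y, nonsurj a -> R c0 p (sact a b) y -> y = sact a x.

(** Fillers are chosen for all missing generators of dimension [q] at once.  The
    union of the graphs is functional by the Eilenberg-Zilber argument: if two
    operators applied to new cells give the same simplex outside the domain of
    [R], both are surjective, since the others factor through a lower dimension,
    and composing with sections identifies the operators and then the cells. *)
Lemma attach_cells (R : drel) q :
  dpartial K R -> skel R q ->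
  (forall b : B c0 q, gen b -> ~ drel_dom R b -> exists x, fills R b x) ->
  exists R', [/\ dpartial K R', drel_sub R R' & skel R' q.+1].
Proof.
move=> RP Rq fl; have Rc := dp_closed RP.
pose new (b : B c0 q) x := [/\ gen b, ~ drel_dom R b & fills R b x].
have /choice[xi xiP] : forall b : B c0 q, exists s : option (X c0 q),
    gen b /\ ~ drel_dom R b -> exists2 x, s = Some x & fills R b x.
  move=> b; case: (pselect (gen b /\ ~ drel_dom R b)) => [[g n]|n].
    by have [x xP] := fl b g n; exists (Some x) => _; exists x.
  by exists None.
pose cell c p (b : B c p) (x : X c p) := exists (b0 : B c0 q) (x0 : X c0 q)
  (h : mor c0 c) (a : mono p q),
  [/\ new b0 x0, xi b0 = Some x0, b = sact a (sd_map B h q b0) &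
      x = sact a (sd_map X h q x0)].
pose R' : drel := fun c p b x => R c p b x \/ cell c p b x.
(* A surjective operator has a section, so it would put [b0] in the domain. *)
have notR c (h : mor c0 c) p (a : mono p q) b0 : gen b0 -> ~ drel_dom R b0 ->
    drel_dom R (sact a (sd_map B h q b0)) -> nonsurj a.
  move=> g nR [y Ry]; apply: contrapT => aS.
  have [d [ad _]] := mono_section ord0 aS.
  apply: nR; apply: (dp_gen RP (h := h)) => //; exists (sact d y).
  by have := drel_act Rc d Ry; rewrite -sact_comp ad sact_id.
have cellR c p (b : B c p) x y : cell c p b x -> R c p b y -> y = x.
  case=> b0 [x0 [h [a [[g nR [_ m]] _ -> ->]]]] Ry.
  have aS : nonsurj a by apply: (notR _ h p a b0) => //; exists y.
  have [y0 Ry0] := skel_nonsurj b0 Rc Rq (leqnn q) aS.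
  have /= Rh := drel_map Rc h Ry0; rewrite smap_nat in Rh.
  by rewrite (dp_fun RP Ry Rh) (m _ _ _ aS Ry0) smap_nat.
have cell_fun c p (b : B c p) x y : cell c p b x -> cell c p b y -> x = y.
  move=> cx cy; case: (pselect (drel_dom R b)) => [[z Rz]|nRb].
    by rewrite -(cellR _ _ _ _ _ cx Rz) -(cellR _ _ _ _ _ cy Rz).
  case: cx => b1 [x1 [h [a [[g1 nR1 _] xi1 bE ->]]]].
  case: cy => b2 [x2 [k [a' [[g2 nR2 _] xi2 bE' ->]]]].
  have nonS (h' : mor c0 c) (e : mono p q) b0 :
      b = sact e (sd_map B h' q b0) -> ~ nonsurj e.
    by move=> E eS; apply: nRb; rewrite E; exact: skel_nonsurj Rc Rq _ eS.
  have aS := nonS _ _ _ bE; have aS' := nonS _ _ _ bE'.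
  have E d : mono_comp a d = mono_id q ->
      sd_map B h q b1 = sact (mono_comp a' d) (sd_map B k q b2).
    by move=> ad; rewrite sact_comp -bE' bE -sact_comp ad sact_id.
  have id d : mono_comp a d = mono_id q -> mono_comp a' d = mono_id q.
    move=> ad; apply: mono_surj_id => S.
    apply: nR1; apply: (dp_gen RP (h := h)) => //.
    by rewrite (E _ ad); exact: skel_nonsurj Rc Rq _ S.
  have aa' : a = a'.
    apply: mono_eq => t; have [d [ad dt]] := mono_section t aS.
    by have := congr1 (fun g : mono q q => g (a t)) (id _ ad); rewrite /= dt.
  have [d [ad _]] := mono_section ord0 aS.
  have := E d ad; rewrite (id _ ad) sact_id => /(fg_uniq genP g1 g2)[hk b12].
  by move: xi1; rewrite aa' hk b12 xi2 => -[->].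
exists R'; split; first split.
- split=> [c p r a b x|c c' h p b x] [Rbx|]; try by left; apply: (drel_act Rc).
  + case=> b0 [x0 [h [a' [n0 x0E -> ->]]]]; right.
    by exists b0, x0, h, (mono_comp a' a); split; rewrite ?sact_comp.
  + by left; apply: (drel_map Rc).
  + case=> b0 [x0 [h' [a' [n0 x0E -> ->]]]]; right.
    by exists b0, x0, (compm h h'), a'; split; rewrite // smap_nat sd_comp.
- move=> c p b x [/(dp_in RP)//|[b0 [x0 [h [a [[_ _ [Kx _]] _ -> ->]]]]]].
  exact/(drel_act K_closed)/(drel_map K_closed).
- move=> c p b x y [Rx|cx] [Ry|cy].
  + exact: dp_fun RP _ _ _ _ _ Rx Ry.
  + by rewrite (cellR _ _ _ _ _ cy Rx).
  + by rewrite (cellR _ _ _ _ _ cx Ry).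
  + exact: cell_fun cx cy.
- move=> c h p b gb [x [Rx|]].
    by have [|y Ry] := dp_gen RP (h := h) gb; [exists x|exists y; left].
  case=> b0 [x0 [h' [a [n0 x0E bE xE]]]].
  case: (pselect (nonsurj a)) => aS.
    have [|y Ry] := dp_gen RP (h := h) gb; last by exists y; left.
    by rewrite bE; exact: skel_nonsurj Rc Rq _ aS.
  have [g0 _ _] := n0.
  have [_ ->] : h = h' /\ b = sact a b0.
    apply: (fg_uniq genP) => //; first exact: (fg_degen genP).
    by rewrite smap_nat -bE.
  exists (sact a x0); right; exists b0, x0, (idm c0), a.
  by split; rewrite ?sd_id.
- by move=> c p b x Rx; left.
- move=> c p b; rewrite ltnS leq_eqVlt => /orP[/eqP pq|pq]; last first.
    by have [x Rx] := Rq c p b pq; exists x; left.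
  rewrite {p}pq in b *; have [h [b0 g0 ->]] := fg_ex genP b.
  case: (pselect (drel_dom R b0)) => [[x Rx]|nR].
    by exists (sd_map X h q x); left; apply: (drel_map Rc).
  have [x xE xf] := xiP b0 (conj g0 nR).
  exists (sd_map X h q x); right; exists b0, x, h, (mono_id q).
  by split; rewrite ?sact_id.
Qed.

Lemma drel_total_map (R : drel) : dpartial K R ->
  (forall (c : C) q (b : B c q), drel_dom R b) ->
  exists h : sdmap B X, forall (c : C) q (b : B c q), R c q b (h c q b).
Proof.
move=> RP Rt.
pose h c q (b : B c q) := sval (cid (Rt c q b)).
have hP c q (b : B c q) : R c q b (h c q b) by rewrite /h; case: cid.
have hN c m n (a : mono m n) (b : B c n) : h c m (sact a b) = sact a (h c n b).
  by apply: (dp_fun RP) (hP _ _ _) _; exact/(drel_act (dp_closed RP))/hP.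
pose hc c := SMap (hN c).
have hN' (x y : C) (f : mor x y) n (s : B x n) :
    hc y n (sd_map B f n s) = sd_map X f n (hc x n s).
  by apply: (dp_fun RP) (hP _ _ _) _; exact/(drel_map (dp_closed RP))/hP.
by exists (SDMap hN').
Qed.

(** Skeletal induction: the chosen extensions over the successive skeleta
    increase, and their union is defined everywhere. *)
Lemma extend_all (R : drel) q0 : dpartial K R -> skel R q0 ->
  (forall q (R' : drel), (q0 <= q)%N -> dpartial K R' -> drel_sub R R' ->
    skel R' q -> forall b : B c0 q, gen b -> ~ drel_dom R' b ->
    exists x, fills R' b x) ->
  exists h : sdmap B X, (forall (c : C) q (b : B c q), K b (h c q b)) /\
    (forall (c : C) q (b : B c q) x, R c q b x -> h c q b = x).
Proof.
move=> RP Rq fl.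
pose good n (S : drel) := [/\ dpartial K S, drel_sub R S & skel S (q0 + n)].
have nx : forall s : {n & {S | good n S}},
    exists S : {S | good (tag s).+1 S}, drel_sub (sval (tagged s)) (sval S).
  case=> n [S [SP RS Sn]] /=.
  have [b gb nb|S' [S'P SS' S'n]] := attach_cells SP Sn.
    by apply: fl gb nb => //; apply: leq_addr.
  suff S'g : good n.+1 S' by exists (exist _ S' S'g).
  by split=> //; [move=> c q b x /RS/SS'|rewrite addnS].
have g0 : good 0 R by split=> //; rewrite addn0.
pose next s := sval (cid (nx s)).
have nextP s : drel_sub (sval (tagged s)) (sval (next s)) by rewrite /next; case: cid.
pose seq := fix seq n : {S | good n S} :=
  if n is n'.+1 then next (Tagged (fun n => {S | good n S}) (seq n')) else exist _ R g0.
have seqS n : drel_sub (sval (seq n)) (sval (seq n.+1)).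
  by exact: nextP (Tagged (fun n => {S | good n S}) (seq n)).
have seq_le m n : (m <= n)%N -> drel_sub (sval (seq m)) (sval (seq n)).
  elim: n => [|n IH]; first by rewrite leqn0 => /eqP ->.
  rewrite leq_eqVlt => /orP[/eqP -> //|/IH mn] c q b x /mn; exact: seqS.
pose U : drel := fun c q b x => exists n, sval (seq n) c q b x.
have seqP n : good n (sval (seq n)) by case: (seq n).
have UP : dpartial K U.
  split; first split.
  - move=> c p q a b x [n Sx]; exists n.
    by have [SP _ _] := seqP n; apply: (drel_act (dp_closed SP)).
  - move=> c c' h q b x [n Sx]; exists n.
    by have [SP _ _] := seqP n; apply: (drel_map (dp_closed SP)).
  - by move=> c q b x [n]; have [SP _ _] := seqP n; apply: dp_in SP _ _ _ _.
  - move=> c q b x y [m Sx] [n Sy]; have [SP _ _] := seqP (maxn m n).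
    apply: (dp_fun SP (b := b)); first exact: seq_le (leq_maxl m n) _ _ _ _ Sx.
    exact: seq_le (leq_maxr m n) _ _ _ _ Sy.
  - move=> c h q b gb [x [n Sx]]; have [SP _ _] := seqP n.
    have [|y Sy] := dp_gen SP (h := h) gb; first by exists x.
    by exists y, n.
have Ut c q (b : B c q) : drel_dom U b.
  have [_ _ Sq] := seqP q.+1; have [|x Sx] := Sq c q b; last by exists x, q.+1.
  by rewrite addnS ltnS leq_addl.
have [h hP] := drel_total_map UP Ut.
exists h; split=> [c q b|c q b x Rx]; first exact: dp_in UP _ _ _ _ (hP c q b).
by apply: (dp_fun UP) (hP c q b) _; exists 0.
Qed.
End Attach.

Program Definition one_cat : cat :=
  @Cat unit (fun _ _ => unit) (fun _ => tt) (fun _ _ _ _ _ => tt) _ _ _.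
Next Obligation. by move=> x y []. Qed.
Next Obligation. by move=> x y []. Qed.
Next Obligation. by []. Qed.

Program Definition const_diag (X : sset) : sdiag one_cat :=
  @SDiag one_cat (fun _ => X) (fun _ _ _ => smap_id X) _ _.
Next Obligation. by []. Qed.
Next Obligation. by []. Qed.

Section SimplicialExtension.
Variables (D X : sset).

Definition srel := forall q, D q -> X q -> Prop.

Definition srel_closed (R : srel) : Prop :=
  forall p q (a : mono p q) d x, R q d x -> R p (sact a d) (sact a x).

Definition srel_fun (R : srel) : Prop :=
  forall q d x y, R q d x -> R q d y -> x = y.

End SimplicialExtension.

(** Lifting of boundaries along the projection to [D] of the part of [D x X] cut
    out by [K].  Pulling back a map X -> Y to [D] gives a lifting problem for this
    map; the full relation gives an extension problem for [X]. *)
Definition boundary_fill (D X : sset) (K : srel D X) : Prop :=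
  forall q (d : D q) (G : srel (simplex q) X), srel_closed G -> srel_fun G ->
    (forall p (a : mono p q) x, G p a x -> K p (sact a d) x) ->
    (forall p (a : mono p q), nonsurj a -> exists x, G p a x) ->
  exists2 x, K q d x & forall p (a : mono p q) y, nonsurj a -> G p a y -> y = sact a x.

Lemma extend_smap (D X : sset) (K R : srel D X) : srel_closed K ->
  srel_closed R -> srel_fun R -> (forall q d x, R q d x -> K q d x) ->
  boundary_fill K ->
  exists h : smap D X, (forall q d, K q d (h q d)) /\
    (forall q d x, R q d x -> h q d = x).
Proof.
move=> Kc Rc Rf RK fl.
pose gen q (b : const_diag D tt q) := True.
pose lift (S : srel D X) : drel (const_diag D) (const_diag X) := fun _ => S.
have lc (S : srel D X) : srel_closed S -> drel_closed (lift S).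
  by move=> Sc; split=> // c p q a b x; apply: Sc.
have genP : free_gen gen.
  split=> //= [c q b|c q b b' [] []//]; by exists tt, b.
have RP : dpartial gen (lift K) (lift R).
  split; [exact: lc|by move=> c q b x /RK| |].
    by move=> c q b x y; apply: Rf.
  by move=> [] [] q b _.
have [||h [hK hR]] := extend_all genP (lc K Kc) RP (q0 := 0).
- by [].
- move=> q R' _ R'P _ R'q b _ _.
  have [||||x Kx m] := fl q b (fun p a => R' tt p (sact a b)).
  + move=> p r a d x /=; rewrite sact_comp; exact: (drel_act (dp_closed R'P)).
  + by move=> p a x y; apply: (dp_fun R'P).
  + by move=> p a x; apply: (dp_in R'P).
  + by move=> p a; apply: skel_nonsurj (dp_closed R'P) R'q _.
  by exists x; split.
by exists (h tt); split=> [q d|q d x]; [apply: hK|apply: hR].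
Qed.

(** * Prisms and homotopy extension *)

Definition in_horn q n (k : 'I_n.+2) (a : mono q n.+1) : Prop :=
  exists2 j, j != k & misses a j.

Definition horn_fill (D X : sset) (K : srel D X) : Prop :=
  forall n (k : 'I_n.+2) (d : D n.+1) (G : srel (simplex n.+1) X),
    srel_closed G -> srel_fun G ->
    (forall p (a : mono p n.+1) x, G p a x -> K p (sact a d) x) ->
    (forall p (a : mono p n.+1), in_horn k a -> exists x, G p a x) ->
  exists2 x, K n.+1 d x &
    forall p (a : mono p n.+1) y, in_horn k a -> G p a y -> y = sact a x.

Lemma attach_simplex (D X : sset) (K R : srel D X) r (b0 : D r) (x0 : X r) :
  srel_closed K -> srel_closed R -> srel_fun R ->
  (forall q d x, R q d x -> K q d x) ->
  (forall p (a a' : mono p r), sact a b0 = sact a' b0 -> a = a') ->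
  K r b0 x0 -> (forall p (a : mono p r) y, R p (sact a b0) y -> y = sact a x0) ->
  exists R' : srel D X, [/\ srel_closed R', srel_fun R',
    forall q d x, R' q d x -> K q d x &
    forall q d x, R' q d x <-> R q d x \/
      exists a : mono q r, d = sact a b0 /\ x = sact a x0].
Proof.
move=> Kc Rc Rf RK b0I Kx m.
exists (fun q d x => R q d x \/ exists a : mono q r, d = sact a b0 /\ x = sact a x0).
split=> //.
- move=> p q a d x [Rx|[c [-> ->]]]; [by left; apply: Rc|right].
  by exists (mono_comp c a); rewrite !sact_comp.
- move=> q d x y [Rx|[a [da ->]]] [Ry|[a' [da' ->]]].
  + exact: Rf Rx Ry.
  + by apply: m; rewrite -da'.
  + by apply/esym/m; rewrite -da.
  + by congr sact; apply: b0I; rewrite -da.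
- by move=> q d x [/RK//|[a [-> ->]]]; apply: Kc.
Qed.

Definition iend (e : bool) : 'I_2 := if e then ord_max else ord0.

Fact degen_subproof m (i : 'I_m.+1) (t : 'I_m.+2) : (t - (i < t) < m.+1)%N.
Proof. by have := ltn_ord i; have := ltn_ord t; lia. Qed.
Fact degen_mono m (i : 'I_m.+1) :
  {homo (fun t : 'I_m.+2 => Ordinal (degen_subproof i t)) : s t / (s <= t)%N}.
Proof. by move=> s t /=; lia. Qed.
Definition degen m (i : 'I_m.+1) : mono m.+1 m := Mono (@degen_mono m i).

Fact step_mono m (i : nat) :
  {homo (fun t : 'I_m.+2 => iend (i < t)) : s t / (s <= t)%N}.
Proof.
by move=> s t /=; case: (ltnP i s); case: (ltnP i t) => //=; lia.
Qed.
Definition step m (i : nat) : mono m.+1 1 := Mono (@step_mono m i).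

Local Notation I1 := (simplex 1).

(** The m+1 nondegenerate simplices of dimension m+1 of the prism; cell [i] crosses
    from the bottom to the top over the vertex [i]. *)
Definition prism_cell m (i : 'I_m.+1) : sprod (simplex m) I1 m.+1 :=
  (degen i, step m i).

Lemma iend_inj : injective iend. Proof. by case; case. Qed.

Lemma prism_cell_inj m (i : 'I_m.+1) p (a a' : mono p m.+1) :
  sact a (prism_cell i) = sact a' (prism_cell i) -> a = a'.
Proof.
case=> ea eb; apply: mono_eq => t; apply: val_inj.
have := congr1 (fun g => val (g t)) ea.
have /iend_inj := congr1 (fun g => g t) eb.
by rewrite /=; case: (ltnP i (a t)); case: (ltnP i (a' t)) => //; lia.
Qed.

Lemma iend_cases (x : 'I_2) : exists e, x = iend e.
Proof. by case: x => [[|[|//]] ix]; [exists false|exists true]; apply: val_inj. Qed.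

(** The crossing vertex is the last value of [al] at which [be] is still at the
    bottom, or 0 if there is none. *)
Lemma prism_cover m p (al : mono p m) (be : mono p 1) :
  exists (i : 'I_m.+1) (a : mono p m.+1),
    (al, be) = sact a (prism_cell i) :> sprod (simplex m) I1 p.
Proof.
pose z (t : 'I_p.+1) : bool := be t == ord0.
pose i0 := \max_(t | z t) al t.
have i0m : (i0 < m.+1)%N by rewrite ltnS; apply/bigmax_leqP => t _; rewrite -ltnS.
pose i := Ordinal i0m.
have zM (s t : 'I_p.+1) : (s <= t)%N -> z t -> z s.
  by move=> /(monoP be) st /eqP zt; rewrite zt leqn0 in st; apply/eqP/val_inj/eqP.
have zi t : z t -> (al t <= i)%N by move=> zt; apply: (leq_bigmax_cond t).
have nzi t : ~~ z t -> (i <= al t)%N.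
  move=> nzt; apply/bigmax_leqP => s zs; apply: (monoP al).
  by rewrite leqNgt; apply/negP => /ltnW ts; move/negP: nzt; apply; apply: zM zs.
have at_lt t : (al t + ~~ z t < m.+2)%N by case: (z t); rewrite ?addn0 ?addn1 ltnS // ltnW.
have aM : {homo (fun t => Ordinal (at_lt t)) : s t / (s <= t)%N}.
  move=> s t st /=; apply: leq_add; first exact: monoP.
  by case zt: (z t); [rewrite (zM s t)|case: (z s)].
exists i, (Mono aM); congr pair; apply: mono_eq => t /=.
  apply: val_inj => /=; case zt: (z t) (zi t) (nzi t) => /= h h'.
    by have {}h := h isT; case: ltnP; lia.
  by have {}h' := h' isT; case: ltnP; lia.
have [e be_e] := iend_cases (be t).
case zt: (z t) (zi t) (nzi t) => /= h h'.
  have {}h := h isT; rewrite addn0 ltnNge h /=; exact/eqP.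
have {}h' := h' isT; rewrite addn1 ltnS h' /=; rewrite be_e; case: e be_e => // e.
by rewrite /z e eqxx in zt.
Qed.

Section Prism.
Variables (X : sset) (m : nat) (e : bool).
Variable K : srel (sprod (simplex m) I1) X.
Hypotheses (K_closed : srel_closed K) (K_fill : horn_fill K).
Variable G : srel (sprod (simplex m) I1) X.
Hypotheses (G_closed : srel_closed G) (G_fun : srel_fun G).
Arguments K : clear implicits.
Arguments G : clear implicits.
Hypothesis GK : forall q d x, G q d x -> K q d x.

Definition box p (d : sprod (simplex m) I1 p) : Prop :=
  nonsurj d.1 \/ d.2 = mono_const p (iend e).

Hypothesis G_box : forall p (d : sprod (simplex m) I1 p), box d -> exists x, G p d x.

Lemma box_act p q (a : mono p q) d : box d -> box (sact a d).
Proof.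
case=> [ns|c]; [left; exact: nonsurj_comp|right].
by rewrite /= c; apply: mono_const_comp.
Qed.

Let done n (j : 'I_m.+1) := if e then (j < n)%N else (m - j < n)%N.

(** The cells of the prism are attached in the order of their distance to the end
    [e].  Each of them meets the part already filled in a horn, whose missing face
    is the one shared with the next cell. *)
Lemma prism_induction n : (n <= m.+1)%N ->
  exists R : srel (sprod (simplex m) I1) X,
  [/\ srel_closed R, srel_fun R, forall q d x, R q d x -> K q d x &
   [/\ forall p d x, box d -> G p d x -> R p d x,
      forall p d x, R p d x -> box d \/ exists j a, done n j /\ d = sact a (prism_cell j) &
      forall j, done n j -> exists x, R m.+1 (prism_cell j) x]].
Proof.
elim: n => [_|n IH nm].
  exists (fun p d x => box d /\ G p d x); split.
  - by move=> p q a d x [bd Gx]; split; [apply: box_act|apply: G_closed].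
  - by move=> q d x y [_ Gx] [_]; apply: G_fun Gx.
  - by move=> q d x [_]; apply: GK.
  - split=> // [p d x []|j]; first by left.
    by rewrite /done ltn0 ltn0 if_same.
have [R [Rc Rf RK [GR Rd Rx]]] := IH (ltnW nm).
(* From the end [true] the cells come in the order 0, 1, ..., m and cell [i] lacks
   its face [i.+1]; from the end [false] the order is reversed and cell [i] lacks
   its face [i]. *)
have im : ((if e then n else m - n) < m.+1)%N by case: (e); lia.
pose i := Ordinal im.
have km : ((if e then i.+1 else i) < m.+2)%N by case: (e); have := ltn_ord i; lia.
pose k := Ordinal km.
have misshorn p (a : mono p m.+1) (l : nat) : (l < m.+2)%N -> l <> k ->
    (forall t, a t <> l :> nat) -> in_horn k a.
  move=> lm lk al; exists (Ordinal lm); first by apply/eqP => /(congr1 val).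
  by move=> t; apply/eqP => /(congr1 val) /= /al.
have dom_horn p (a : mono p m.+1) x : R p (sact a (prism_cell i)) x -> in_horn k a.
  move=> /Rd[[[j mj]|eb]|[j [a' [dj [ea eb]]]]].
  - pose l := if (j < k)%N then j : nat else j.+1.
    apply: (misshorn p a l).
    + by rewrite /l; case: ifP; have := ltn_ord j; lia.
    + by rewrite /l; case: ltnP; lia.
    move=> t atl; have /eqP := mj t; apply; apply: val_inj => /=.
    rewrite atl /l /=; case: (e) => /=; case: ltnP; case: ltnP => //; lia.
  - apply: (misshorn p a (if e then val i else i.+1)); rewrite /=.
    + by case: (e); lia.
    + by case: (e); lia.
    move=> t ati; have := congr1 (fun g : mono p 1 => g t) eb.
    by rewrite /= ati => /iend_inj; case: (e) => /=; rewrite ?ltnn ?ltnSn.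
  - apply: (misshorn p a (if e then val i else i.+1)); rewrite /=.
    + by case: (e); lia.
    + by case: (e); lia.
    move=> t ati.
    have := congr1 (fun g => val (g t)) ea.
    have /iend_inj := congr1 (fun g => g t) eb.
    move: dj; rewrite /done /= ati; have := ltn_ord j.
    by case: (e) => /=; case: ltnP; case: ltnP => //; lia.
have horn_dom p (a : mono p m.+1) : in_horn k a ->
    exists x, R p (sact a (prism_cell i)) x.
  case=> l lk al.
  have bx : box (sact a (prism_cell i)) -> exists x, R p (sact a (prism_cell i)) x.
    by move=> b; have [x Gx] := G_box b; exists x; apply: GR.
  have alt t : a t <> l :> nat by move=> /val_inj atl; have := al t; rewrite atl eqxx.
  have lk' : l <> k :> nat by move=> /val_inj lk'; rewrite lk' eqxx in lk.
  case: (pselect (l = (if e then i : nat else i.+1) :> nat)) => [lo|lo]; last first.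
    apply: bx; left; exists (degen i l) => t; apply/eqP => /(congr1 val) /= E.
    by move: lk' lo (alt t) E; rewrite /=; case: (e); case: ltnP; case: ltnP; lia.
  case: (pselect (done n (inord (if e then i.-1 else i.+1)) /\ (0 < n)%N)) => [[dj n0]|nd].
    have [x Rjx] := Rx _ dj; exists (sact a x).
    have := Rc _ _ a _ _ Rjx; congr (R _ _ _).
    congr pair; apply: mono_eq => t; [apply: val_inj; rewrite /=|rewrite /=; congr iend];
      rewrite inordK; move: lo (alt t); rewrite ?/i /=; case: (e); 
      rewrite ?ltnS; try (case: ltnP; case: ltnP); lia.
  apply: bx; right; apply: mono_eq => t; rewrite /=; congr iend.
  have n0 : n = 0.
    case: (posnP n) => // n0; case: nd; split=> //.
    by have := im; rewrite /done /=; case: (e) => /= im'; rewrite inordK; lia.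
  move: lo (alt t) (ltn_ord (a t)); rewrite /i /=.
  by case: (e) => /=; lia.
have [||||x0 Kx0 mx0] := K_fill (k := k) (d := prism_cell i)
   (G := fun p a x => R p (sact a (prism_cell i)) x).
- by move=> p q a d x /(Rc _ _ a); rewrite -sact_comp.
- by move=> q d x y; apply: Rf.
- by move=> p a x; apply: RK.
- exact: horn_dom.
have [p a y Ry|R' [R'c R'f R'K R'E]] :=
    attach_simplex K_closed Rc Rf RK (prism_cell_inj (i:=i)) Kx0.
  by apply: mx0 (Ry); apply: dom_horn Ry.
exists R'; split=> //; split.
- by move=> p d x bd Gx; apply/R'E; left; apply: GR.
- move=> p d x /R'E[/Rd[|[j [a [dj dE]]]]|[a [-> _]]]; first by left.
    by right; exists j, a; split=> //; move: dj; rewrite /done; case: (e); lia.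
  by right; exists i, a; split=> //; rewrite /done /=; case: (e); lia.
- move=> j dj; case: (pselect (j = i)) => [->|ji].
    exists x0; apply/R'E; right; exists (mono_id _).
    by rewrite !sact_id.
  have [|x Rjx] := Rx j; last by exists x; apply/R'E; left.
  have {}ji : j <> i :> nat by move=> /val_inj.
  by move: dj ji (ltn_ord j); rewrite /done /=; case: (e); lia.
Qed.
End Prism.

Lemma srel_total_map (D X : sset) (R : srel D X) : srel_closed R -> srel_fun R ->
  (forall q d, exists x, R q d x) -> exists h : smap D X, forall q d, R q d (h q d).
Proof.
move=> Rc Rf Rt; pose h q d := sval (cid (Rt q d)).
have hP q d : R q d (h q d) by rewrite /h; case: cid.
have hN m n (a : mono m n) d : h m (sact a d) = sact a (h n d).
  by apply: Rf (hP _ _) _; apply: Rc.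
by exists (SMap hN).
Qed.

Lemma prism_fill (X : sset) m (e : bool) (K G : srel (sprod (simplex m) I1) X) :
  srel_closed K -> horn_fill K -> srel_closed G -> srel_fun G ->
  (forall q d x, G q d x -> K q d x) ->
  (forall p (d : sprod (simplex m) I1 p), box e d -> exists x, G p d x) ->
  exists g : smap (sprod (simplex m) I1) X, (forall q d, K q d (g q d)) /\
    (forall q d x, box e d -> G q d x -> x = g q d).
Proof.
move=> Kc Kf Gc Gf GK Gb.
have [R [Rc Rf RK [GR Rd Rx]]] := prism_induction Kc Kf Gc Gf GK Gb (leqnn _).
have [|g gP] := srel_total_map Rc Rf.
  move=> p [al be]; have [i [a ->]] := prism_cover al be.
  have [|x Rix] := Rx i; first by have := ltn_ord i; case: (e); lia.
  by exists (sact a x); apply: Rc.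
exists g; split=> [q d|q d x bd Gx]; first exact/RK/gP.
by apply: Rf (gP q d); apply: GR.
Qed.

Program Definition path_space (X : sset) : sset :=
  @SSet (fun q => smap (sprod (simplex q) I1) X)
    (fun p q a g => smap_comp g (sprod_map (simplex_map a) (smap_id I1))) _ _.
Next Obligation.
by move=> X n g; apply: smap_eq => m [a t] /=; rewrite mono_Icomp.
Qed.
Next Obligation.
by move=> X l m n b a g; apply: smap_eq => p [c t] /=; rewrite mono_compA.
Qed.

Lemma path_eval (X : sset) p q (g : path_space X q) (a : mono p q) (t : I1 p) :
  sact a g p (mono_id p, t) = g p (a, t).
Proof. by rewrite /= mono_compI. Qed.

Lemma path_nat (X : sset) p q r (g : path_space X q) (a : mono p q) (t : I1 p) (b : mono r p) :
  sact b (g p (a, t)) = g r (mono_comp a b, mono_comp t b).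
Proof. by rewrite -smap_nat. Qed.

(** A homotopy on [D] is a map from [D] to the path space of [X], which is built
    simplex by simplex; over one simplex of [D] this amounts to filling a prism.
    The last clause says that [h] extends [R] on the end [e] and over each simplex
    of [D] above which [R] is defined all along the interval. *)
Lemma hep (D X : sset) (e : bool) (K R : srel (sprod D I1) X) :
  srel_closed K -> horn_fill K -> srel_closed R -> srel_fun R ->
  (forall q d x, R q d x -> K q d x) ->
  (forall q (d : D q), exists x, R q (d, mono_const q (iend e)) x) ->
  exists h : smap (sprod D I1) X, (forall q d, K q d (h q d)) /\
    (forall q (d : D q) t x, R q (d, t) x ->
       t = mono_const q (iend e) \/
       (forall p (a : mono p q) s, exists y, R p (sact a d, s) y) -> h q (d, t) = x).
Proof.
move=> Kc Kf Rc Rf RK Re.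
(* [K'] fixes the value at the end [e]; [R'] is made of the paths that [R] determines. *)
pose K' : srel D (path_space X) := fun q d g => forall p (a : mono p q) t,
  K p (sact a d, t) (g p (a, t)) /\
  forall x, R p (sact a d, t) x -> t = mono_const p (iend e) -> g p (a, t) = x.
pose R' : srel D (path_space X) := fun q d g => forall p (a : mono p q) t,
  R p (sact a d, t) (g p (a, t)).
have K'c : srel_closed K'.
  by move=> p q a d g Kg r b t /=; rewrite -sact_comp; apply: Kg.
have R'c : srel_closed R'.
  by move=> p q a d g Rg r b t /=; rewrite -sact_comp; apply: Rg.
have R'f : srel_fun R'.
  by move=> q d g g' Rg Rg'; apply: smap_eq => p [a t]; apply: Rf (Rg _ _ _) (Rg' _ _ _).
have R'K q d g : R' q d g -> K' q d g.
  move=> Rg p a t; split; first exact: RK.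
  by move=> x Rx _; apply: Rf (Rg _ _ _) Rx.
have fill : boundary_fill K'.
  move=> q d G Gc Gf GK Gd.
  pose pull p (b : sprod (simplex q) I1 p) : sprod D I1 p := (sact b.1 d, b.2).
  have pullE r p (a : mono r p) b : pull r (sact a b) = sact a (pull p b).
    by rewrite /pull /= -sact_comp.
  pose G1 : srel (sprod (simplex q) I1) X := fun p b x =>
    (nonsurj b.1 /\ exists2 g, G p b.1 g & x = g p (mono_id p, b.2)) \/
    (b.2 = mono_const p (iend e) /\ R p (pull p b) x).
  have G1K p b x : G1 p b x -> K p (pull p b) x.
    case=> [[ns [g Gg ->]]|[_ /RK//]].
    by have [] := GK _ _ _ Gg p (mono_id p) b.2; rewrite sact_id.
  have [||||||g [gK gG]] := prism_fill (e := e) (K := fun p b x => K p (pull p b) x) (G := G1).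
  - by move=> r p a b x /(Kc _ _ a); rewrite pullE.
  - move=> n k b H Hc Hf HK Hd; apply: (Kf n k (pull _ b)) => // p a x /HK.
    by rewrite pullE.
  - move=> r p a b x [[ns [g Gg ->]]|[be Rx]]; [left|right].
    + split; first exact: nonsurj_comp.
      exists (sact a g); first exact: Gc.
      by rewrite path_eval path_nat mono_Icomp.
    + split; last by rewrite pullE; apply: Rc.
      by rewrite /= be; apply: mono_const_comp.
  - have aux p b x y : nonsurj b.1 -> (exists2 g, G p b.1 g & x = g p (mono_id p, b.2)) ->
       (b.2 = mono_const p (iend e) /\ R p (pull p b) y) -> x = y.
      move=> ns [g Gg ->] [be Ry].
      have [_] := GK _ _ _ Gg p (mono_id p) b.2; apply; last by [].
      by rewrite sact_id.
    move=> p b x y [[ns [g Gg xE]]|Rx] [[ns' [g' Gg' yE]]|Ry].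
    + by rewrite xE yE (Gf _ _ _ _ Gg Gg').
    + by apply: (aux p b) => //; exists g.
    + by apply/esym/(aux p b) => //; exists g'.
    + exact: Rf Rx.2 Ry.2.
  - exact: G1K.
  - move=> p b [ns|be].
      have [g Gg] := Gd _ _ ns; exists (g p (mono_id p, b.2)); left; split=> //.
      by exists g.
    have [x Rx] := Re p (sact b.1 d); exists x; right; split=> //.
    by rewrite /pull be.
  exists g.
    move=> p a t; split; first exact: (gK p (a, t)).
    by move=> x Rx te; apply/esym/gG; [right|right].
  move=> p a y ns Gy; apply: smap_eq => r [b t].
  have ns' : nonsurj (mono_comp a b) by apply: nonsurj_comp.
  rewrite /=; apply: gG; first by left.
  left; split=> //; exists (sact b y); first exact: Gc.
  by rewrite path_eval.
have [h [hK hR]] := extend_smap K'c R'c R'f R'K fill.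
pose H q (d : sprod D I1 q) := h q d.1 q (mono_id q, d.2).
have HN m n (a : mono m n) d : H m (sact a d) = sact a (H n d).
  by rewrite /H /= smap_nat path_eval path_nat mono_Icomp.
exists (SMap HN); split=> [q [d t]|q d t x Rx].
  by rewrite /= /H /=; have [] := hK q d q (mono_id q) t; rewrite sact_id.
case=> [te|tot].
  have [_] := hK q d q (mono_id q) t; rewrite sact_id; exact.
have [g0 g0P] : exists g : path_space X q, R' q d g.
  have [|||g gP] := srel_total_map
    (R := fun p (b : sprod (simplex q) I1 p) x => R p (sact b.1 d, b.2) x).
  - by move=> r p a b y /(Rc _ _ a); rewrite /= -sact_comp.
  - by move=> p b y z; apply: Rf.
  - by move=> p [a s]; apply: tot.
  by exists g => p a s; apply: (gP p (a, s)).
rewrite /= /H /= (hR _ _ _ g0P).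
by apply: Rf Rx; have := g0P q (mono_id q) t; rewrite sact_id.
Qed.

(** * Fibrations and filtered colimits *)

Definition fibration (X Y : sset) (p : smap X Y) : Prop :=
  forall n (k : 'I_n.+2) (y : Y n.+1) (G : srel (simplex n.+1) X),
    srel_closed G -> srel_fun G ->
    (forall q (a : mono q n.+1) x, G q a x -> p q x = sact a y) ->
    (forall q (a : mono q n.+1), in_horn k a -> exists x, G q a x) ->
  exists2 x, p n.+1 x = y &
    forall q (a : mono q n.+1) z, in_horn k a -> G q a z -> z = sact a x.

(** Lifting against the boundary inclusion of the n-simplex.  The graph [G] may be
    defined beyond the boundary, and is ignored there. *)
Definition sphere_lift (X Y : sset) (p : smap X Y) n : Prop :=
  forall (y : Y n) (G : srel (simplex n) X), srel_closed G -> srel_fun G ->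
    (forall q (a : mono q n) x, G q a x -> p q x = sact a y) ->
    (forall q (a : mono q n), nonsurj a -> exists x, G q a x) ->
  exists2 x, p n x = y &
    forall q (a : mono q n) z, nonsurj a -> G q a z -> z = sact a x.

Lemma fibration_horn_fill (D X Y : sset) (p : smap X Y) (v : smap D Y) :
  fibration p -> horn_fill (fun q (d : D q) x => p q x = v q d).
Proof.
move=> pf n k d G Gc Gf GK Gd.
have [|x px xP] := pf n k (v n.+1 d) G Gc Gf _ Gd.
  by move=> q a x /GK ->; rewrite smap_nat.
by exists x.
Qed.

Lemma sphere_lift_fill (D X Y : sset) (p : smap X Y) (v : smap D Y) :
  (forall n, sphere_lift p n) -> boundary_fill (fun q (d : D q) x => p q x = v q d).
Proof.
move=> pf n d G Gc Gf GK Gd.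
have [|x px xP] := pf n (v n d) G Gc Gf _ Gd.
  by move=> q a x /GK ->; rewrite smap_nat.
by exists x.
Qed.

Lemma lift_closed (D X Y : sset) (p : smap X Y) (v : smap D Y) :
  srel_closed (fun q (d : D q) x => p q x = v q d).
Proof. by move=> m q a d x px; rewrite !smap_nat px. Qed.

Definition yoneda (X : sset) n (x : X n) : smap (simplex n) X :=
  @SMap (simplex n) X (fun q a => sact a x)
    (fun r q a b => sact_comp b a x).

Lemma kan_horn_fill (D X : sset) : kan X -> horn_fill (fun q (d : D q) (x : X q) => True).
Proof.
move=> Xk n k d G Gc Gf _ Gd.
have [|||h hP] := srel_total_map (D := horn k) (R := fun q d x => G q (sval d) x).
- by move=> p q a [b bP] x Gx; apply: Gc Gx.
- by move=> q [b bP] x y; apply: Gf.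
- by move=> q [b bP]; apply: Gd.
have [s sE] := Xk n k h; exists (s n.+1 (mono_id _)) => // p a y aP Gy.
have -> : y = h p (exist _ a aP) by apply: Gf Gy _; apply: hP (exist _ a aP).
by rewrite -sE /= -smap_nat /= mono_Icomp.
Qed.

Lemma kan_of_fibration (X Y : sset) (p : smap X Y) : fibration p -> kan Y -> kan X.
Proof.
move=> pf Yk n k h; have [s sE] := Yk n k (smap_comp p h).
pose G : srel (simplex n.+1) X := fun q a x => exists aP : in_horn k a, h q (exist _ a aP) = x.
have [||||x px xP] := pf n k (s n.+1 (mono_id _)) G.
- move=> q r a d x [dP <-]; have aP : in_horn k (mono_comp d a).
    by case: dP => j jk dj; exists j => //; apply: misses_comp.
  by exists aP; rewrite -smap_nat; congr (h _ _); apply: eq_exist.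
- by move=> q d x y [dP <-] [dP' <-]; congr (h _ _); apply: eq_exist.
- move=> q a x [aP <-]; rewrite -smap_nat /= mono_Icomp.
  by have := congr1 (fun g : smap (horn k) Y => g q (exist _ a aP)) sE.
- by move=> q a aP; exists (h q (exist _ a aP)), aP.
exists (yoneda x); apply: smap_eq => q [a aP] /=.
by apply/esym/(xP q a) => //; exists aP.
Qed.

Section Filtered.
Variable C : cat.
Hypothesis thin : forall (x y : C) (f g : mor x y), f = g.
Hypothesis dir : forall x y : C, exists z, inhabited (mor x z) /\ inhabited (mor y z).

Definition cin (D : sdiag C) (c : C) q (x : D c q) : colim D q :=
  quot_pi (@colim_step C D q) (Tagged (fun c : C => D c q) x).

Lemma cin_surj (D : sdiag C) q (z : colim D q) : exists (c : C) (x : D c q), z = cin x.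
Proof. by rewrite -[z]quot_reprK; case: (quot_repr z) => c x; exists c, x. Qed.

Lemma cin_map (D : sdiag C) (c c' : C) (h : mor c c') q (x : D c q) :
  cin (sd_map D h q x) = cin x.
Proof. by apply/quot_piP/rst_sym/rst_step; exists h. Qed.

Lemma cin_act (D : sdiag C) (c : C) p q (a : mono p q) (x : D c q) :
  sact a (cin x) = cin (sact a x).
Proof. by rewrite /= (quot_mapE (@colim_actP _ _ _ _ _)). Qed.

Lemma colim_map_cin (D E : sdiag C) (f : sdmap D E) (c : C) q (x : D c q) :
  colim_map f q (cin x) = cin (f c q x).
Proof. by rewrite /= (quot_mapE (@colim_funP _ _ _ _ _)). Qed.

(** Becoming equal at some stage is already an equivalence relation: transitivity
    holds because any two stages have a common successor, reached in one way. *)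
Lemma cin_eq (D : sdiag C) q (c c' : C) (x : D c q) (x' : D c' q) :
  cin x = cin x' -> exists (d : C) (f : mor c d) (f' : mor c' d),
    sd_map D f q x = sd_map D f' q x'.
Proof.
move=> /quot_piP.
pose rel (s t : {c : C & D c q}) := exists (d : C) (f : mor (tag s) d) (g : mor (tag t) d),
  sd_map D f q (tagged s) = sd_map D g q (tagged t).
suff H s t : clos_refl_sym_trans _ (@colim_step C D q) s t -> rel s t by move/H.
elim=> {s t} [s t [f ft]|s|s t _ [d [f [g e]]]|s t u _ [d [f [g e]]] _ [d' [f' [g' e']]]].
- by exists (tag t), f, (idm _); rewrite sd_id.
- by exists (tag s), (idm _), (idm _).
- by exists d, g, f.
- have [z [[h] [h']]] := dir d d'; exists z, (compm h f), (compm h' g').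
  by rewrite !sd_comp e -e' -!sd_comp (thin (compm h g) (compm h' f')).
Qed.

Lemma finite_dir (I : finType) (c : C) (P : I -> forall c', mor c c' -> Prop) :
  (forall i c' (f : mor c c') c'' (g : mor c' c''), P i c' f -> P i c'' (compm g f)) ->
  (forall i, exists c' (f : mor c c'), P i c' f) ->
  exists c' (f : mor c c'), forall i, P i c' f.
Proof.
move=> Pup Pex.
suff [c' [f fP]] : exists c' (f : mor c c'), forall i, i \in enum I -> P i c' f.
  by exists c', f => i; apply: fP; rewrite mem_enum.
elim: (enum I) => [|i s [d [f fP]]]; first by exists c, (idm c).
have [d' [f' f'P]] := Pex i; have [z [[g] [g']]] := dir d d'.
exists z, (compm g f) => j; rewrite inE => /orP[/eqP ->|/fP]; last exact: Pup.
by rewrite (thin (compm g f) (compm g' f')); apply: Pup.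
Qed.

(** Two distinct faces of a simplex meet in the face that omits both vertices, or
    not at all for the faces of an interval.  Compatibility of a family of faces is
    thus one equation for each pair of them. *)
Lemma common_face m (j j' : 'I_m.+2) : j != j' ->
  (forall q (b b' : mono q m), mono_comp (delta j) b <> mono_comp (delta j') b') \/
  exists p (c c' : mono p m), mono_comp (delta j) c = mono_comp (delta j') c' /\
    forall q (b b' : mono q m), mono_comp (delta j) b = mono_comp (delta j') b' ->
    exists e : mono q p, b = mono_comp c e /\ b' = mono_comp c' e.
Proof.
move=> jj'; have missE q (b b' : mono q m) (i i' : 'I_m.+2) t :
    mono_comp (delta i) b = mono_comp (delta i') b' -> i' = lift i t -> misses b t.
  move=> E i'E l; apply/eqP => bl.
  have := congr1 (fun g : mono q m.+1 => g l) E; rewrite /= bl -i'E => E'.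
  by have := neq_lift i' (b' l); rewrite -E' eqxx.
have [t tE] : exists t, j' = lift j t.
  by case: (unliftP j j') jj' => [t ->|->]; [exists t|rewrite eqxx].
have [t' t'E] : exists t', j = lift j' t'.
  by case: (unliftP j' j) jj' => [t0 ->|->]; [exists t0|rewrite eqxx].
case: m j j' jj' t t' tE t'E missE => [|m] j j' jj' t t' tE t'E missE.
  left=> q b b' E; have := missE _ _ _ _ _ t E tE.
  by move=> bt; apply: (@not_nonsurj0 q b); exists t.
right; have [c' cE] : exists c', mono_comp (delta j) (delta t) = mono_comp (delta j') c'.
  apply: misses_delta => l; rewrite tE; apply/eqP => /= /lift_inj E.
  by have := neq_lift t l; rewrite E eqxx.
have [c2 c2E] : exists c2, c' = mono_comp (delta t') c2.
  by apply: misses_delta; apply: missE _ _ _ _ _ _ (esym cE) t'E.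
exists m, (delta t), c'; split=> // q b b' E.
have [e eE] : exists e, b = mono_comp (delta t) e.
  by apply: misses_delta; apply: missE _ _ _ _ _ _ E tE.
exists e; split=> //; apply: (mono_mono (@delta_inj _ j')).
by rewrite -E eE !mono_compA cE.
Qed.

(** A horn or a boundary is given by finitely many faces, those indexed by [J],
    subject to finitely many equations.  So a lifting problem in the colimit is
    already posed at some stage. *)
Lemma descend (D E : sdiag C) (p : sdmap D E) m (J : pred 'I_m.+2) (j0 : 'I_m.+2)
    (y : colim E m.+1) (G : srel (simplex m.+1) (colim D)) :
  J j0 -> srel_closed G -> srel_fun G ->
  (forall q (a : mono q m.+1) x, G q a x -> colim_map p q x = sact a y) ->
  (forall q (a : mono q m.+1) j, J j -> misses a j -> exists x, G q a x) ->
  exists (c : C) (yc : E c m.+1) (Gc : srel (simplex m.+1) (D c)),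
    [/\ srel_closed Gc, srel_fun Gc,
     forall q (a : mono q m.+1) x, Gc q a x -> p c q x = sact a yc &
     [/\ cin yc = y, forall q (a : mono q m.+1) x, Gc q a x -> G q a (cin x) &
      forall q (a : mono q m.+1) j, J j -> misses a j -> exists x, Gc q a x]].
Proof.
move=> Jj0 Gcl Gf Gp Gd.
have Gdelta j : J j -> exists x, G m (delta j) x.
  by move=> Jj; apply: Gd Jj _; apply: delta_misses.
have [c0 [y0 yE]] := cin_surj y.
have [|j|c1 [f1 f1P]] := finite_dir (I := 'I_m.+2) (c := c0)
    (P := fun j c' _ => J j -> exists x : D c' m, G m (delta j) (cin x)).
- move=> j c' _ c'' g H Jj; have [x Gx] := H Jj.
  by exists (sd_map D g m x); rewrite cin_map.
- case: (pselect (J j)) => [Jj|nJ]; last by exists c0, (idm c0).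
  have [x Gx] := Gdelta j Jj; have [c' [x' x'E]] := cin_surj x.
  have [z [[g] [g']]] := dir c0 c'.
  by exists z, g => _; exists (sd_map D g' m x'); rewrite cin_map -x'E.
have [xd _] := f1P j0 Jj0.
(* Faces outside [J] receive the junk value [xd]. *)
have /choice[x1 x1P] : forall j, exists x : D c1 m, J j -> G m (delta j) (cin x).
  move=> j; case: (pselect (J j)) => [/f1P[x Gx]|nJ]; first by exists x.
  by exists xd.
have [|jj|c2 [f2 f2P]] := finite_dir (I := ('I_m.+2 * 'I_m.+2)%type) (c := c1)
  (P := fun jj c' f => J jj.1 -> J jj.2 ->
     forall q (b b' : mono q m), mono_comp (delta jj.1) b = mono_comp (delta jj.2) b' ->
     sact b (sd_map D f m (x1 jj.1)) = sact b' (sd_map D f m (x1 jj.2))).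
- move=> jj c' f c'' g H J1 J2 q b b' e.
  by rewrite !sd_comp -[LHS]smap_nat (H J1 J2 q b b' e) smap_nat.
- case: (pselect (J jj.1 /\ J jj.2)) => [[J1 J2]|nJ]; last first.
    by exists c1, (idm c1) => J1 J2; case: nJ.
  case: (eqVneq jj.1 jj.2) => [e|ne].
    exists c1, (idm c1) => _ _ q b b'; rewrite e => /(mono_mono (@delta_inj _ _)) -> //.
  case: (common_face ne) => [nb|[r [c [c' [ce cU]]]]].
    by exists c1, (idm c1) => _ _ q b b' /nb.
  have : cin (sact c (x1 jj.1)) = cin (sact c' (x1 jj.2)).
    rewrite -!cin_act; apply: Gf (Gcl _ _ c _ _ (x1P _ J1)) _.
    by have := Gcl _ _ c' _ _ (x1P _ J2); rewrite /= ce.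
  move=> /cin_eq[d [f [f' e]]]; exists d, f => _ _ q b b' /cU[u [-> ->]].
  by rewrite !sact_comp -[sact c _]smap_nat e (thin f' f) smap_nat.
have [|j|c3 [f3 f3P]] := finite_dir (I := 'I_m.+2) (c := c2)
  (P := fun j c' f => J j -> p c' m (sd_map D (compm f f2) m (x1 j)) =
      sact (delta j) (sd_map E (compm f (compm f2 f1)) m.+1 y0)).
- move=> j c' f c'' g H Jj; rewrite -!compmA.
  by rewrite sd_comp sdm_nat (H Jj) smap_nat -sd_comp.
- case: (pselect (J j)) => [Jj|nJ]; last by exists c2, (idm c2).
  have : cin (p c1 m (x1 j)) = cin (sact (delta j) y0).
    by rewrite -colim_map_cin (Gp _ _ _ (x1P j Jj)) yE cin_act.
  move=> /cin_eq[d [f [f' e]]]; have [z [[g] [g']]] := dir c2 d.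
  exists z, g => _; rewrite sdm_nat (thin (compm g f2) (compm g' f)) sd_comp e.
  by rewrite -sd_comp smap_nat; congr (sact _ (sd_map _ _ _ _)); apply: thin.
pose x3 j := sd_map D (compm f3 f2) m (x1 j).
have x3P j : J j -> G m (delta j) (cin (x3 j)) by move=> Jj; rewrite cin_map; apply: x1P.
have x3E j j' q (b b' : mono q m) : J j -> J j' ->
    mono_comp (delta j) b = mono_comp (delta j') b' -> sact b (x3 j) = sact b' (x3 j').
  move=> Jj Jj' e; rewrite /x3 !sd_comp -[LHS]smap_nat.
  by rewrite (f2P (j, j') Jj Jj' q b b' e) smap_nat.
exists c3, (sd_map E (compm f3 (compm f2 f1)) m.+1 y0).
exists (fun q a x => exists j (b : mono q m),
  [/\ J j, a = mono_comp (delta j) b & x = sact b (x3 j)]).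
split.
- move=> q r a d x [j [b [Jj -> ->]]]; exists j, (mono_comp b a).
  by rewrite sact_comp /= mono_compA; split.
- move=> q a x x' [j [b [Jj -> ->]]] [j' [b' [Jj' e ->]]]; exact: x3E.
- move=> q a x [j [b [Jj -> ->]]]; rewrite smap_nat.
  by rewrite (f3P j Jj) sact_comp.
- split; first by rewrite cin_map.
  + move=> q a x [j [b [Jj -> ->]]]; rewrite -cin_act; exact: Gcl (x3P j Jj).
  + move=> q a j Jj /misses_delta[b ->]; exists (sact b (x3 j)), j, b; by split.
Qed.

Lemma colim_fibration (D E : sdiag C) (p : sdmap D E) :
  (forall c : C, fibration (p c)) -> fibration (colim_map p).
Proof.
move=> pf n k y G Gc Gf Gp Gd.
have [j0 j0k] : exists j0 : 'I_n.+2, j0 != k.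
  by case: (eqVneq ord0 k) => [<-|]; [exists ord_max|exists ord0].
have [|c [yc [H [Hc Hf Hp [ycE HG Hd]]]]] := descend (J := predC1 k) (j0 := j0) j0k Gc Gf Gp.
  by move=> q a j jk aj; apply: Gd; exists j.
have [|x px xP] := pf c n k yc H Hc Hf Hp.
  by move=> q a [j jk aj]; apply: Hd jk aj.
exists (cin x); first by rewrite colim_map_cin px.
move=> q a z aP Gz; have [j jk aj] := aP; have [u Hu] := Hd q a j jk aj.
by rewrite (Gf _ _ _ _ Gz (HG _ _ _ Hu)) (xP _ _ _ aP Hu) cin_act.
Qed.

(** A simplex of the colimit that solves the problem appears at some stage, and it
    is a solution there as soon as finitely many equations hold. *)
Lemma colim_sphere_lift_local (D E : sdiag C) (p : sdmap D E) m :
  sphere_lift (colim_map p) m ->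
  forall (c : C) (y : E c m) (G : srel (simplex m) (D c)),
    srel_closed G -> srel_fun G ->
    (forall q (a : mono q m) x, G q a x -> p c q x = sact a y) ->
    (forall q (a : mono q m), nonsurj a -> exists x, G q a x) ->
  exists (c' : C) (f : mor c c') (x : D c' m), p c' m x = sd_map E f m y /\
    forall q (a : mono q m) z, nonsurj a -> G q a z -> sd_map D f q z = sact a x.
Proof.
move=> pl c y G Gc Gf Gp Gd.
have [||||z pz zP] := pl (cin y) (fun q a z => exists2 x, G q a x & z = cin x).
- move=> q r a d z [x Gx ->]; exists (sact a x); [exact: Gc|exact: cin_act].
- by move=> q a z z' [x Gx ->] [x' Gx' ->]; rewrite (Gf _ _ _ _ Gx Gx').
- by move=> q a z [x Gx ->]; rewrite colim_map_cin (Gp _ _ _ Gx) cin_act.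
- by move=> q a /Gd[x Gx]; exists (cin x), x.
have [c1 [x1 zE]] := cin_surj z; rewrite {z}zE in pz zP.
have [c2 [f1 [f e]]] : exists (d : C) (f' : mor c1 d) (f : mor c d),
  sd_map E f' m (p c1 m x1) = sd_map E f m y by apply: cin_eq; rewrite -colim_map_cin.
case: m => [|m] in y G Gc Gf Gp Gd pl x1 pz zP e *.
  exists c2, f, (sd_map D f1 0 x1); split; first by rewrite sdm_nat.
  by move=> q a z /not_nonsurj0.
have [|j|c3 [f3 f3P]] := finite_dir (I := 'I_m.+2) (c := c2)
  (P := fun j c' g => forall z, G m (delta j) z ->
     sd_map D (compm g f) m z = sact (delta j) (sd_map D (compm g f1) m.+1 x1)).
- move=> j c' g c'' h H z Gz; rewrite -!compmA [LHS]sd_comp (H z Gz).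
  by rewrite smap_nat -sd_comp.
- have [|z0 Gz0] := Gd m (delta j); first by exists j; apply: delta_misses.
  have : cin z0 = cin (sact (delta j) x1).
    by rewrite -cin_act; apply: zP; [exists j; apply: delta_misses|exists z0].
  move=> /cin_eq[d [g [g' e']]]; have [u [[h] [h']]] := dir c2 d.
  exists u, h => z Gz; rewrite (Gf _ _ _ _ Gz Gz0).
  rewrite (thin (compm h f) (compm h' g)) (thin (compm h f1) (compm h' g')).
  by rewrite !sd_comp e' !smap_nat.
exists c3, (compm f3 f), (sd_map D (compm f3 f1) m.+1 x1); split.
  by rewrite sdm_nat !sd_comp e.
move=> q a z [j /misses_delta[b ->]] Gz.
have [|z0 Gz0] := Gd m (delta j); first by exists j; apply: delta_misses.
rewrite sact_comp -(f3P j z0 Gz0) -smap_nat; congr (sd_map _ _ _ _).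
by apply: Gf Gz _; apply: Gc Gz0.
Qed.

Program Definition point : sset := @SSet (fun _ => unit) (fun _ _ _ => id) _ _.
Next Obligation. by []. Qed.
Next Obligation. by []. Qed.

Program Definition to_point (X : sset) : smap X point :=
  @SMap X point (fun _ _ => tt) _.
Next Obligation. by []. Qed.

Program Definition point_diag : sdiag C :=
  @SDiag C (fun _ => point) (fun _ _ _ => smap_id point) _ _.
Next Obligation. by []. Qed.
Next Obligation. by []. Qed.

Program Definition to_point_diag (D : sdiag C) : sdmap D point_diag :=
  @SDMap C D point_diag (fun c => to_point (D c)) _.
Next Obligation. by []. Qed.

Lemma kan_to_point (X : sset) : kan X -> fibration (to_point X).
Proof.
move=> Xk n k [] G Gc Gf _ Gd.
have [|x _ xP] := kan_horn_fill (D := point) Xk (d := tt : point n.+1) Gc Gf _ Gd.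
  by [].
by exists x.
Qed.

(** A Kan complex is a fibration over the point, and in the colimit of copies of
    the point any two simplices of the same dimension are equal. *)
Lemma colim_kan (D : sdiag C) : (forall c : C, kan (D c)) -> kan (colim D).
Proof.
move=> Dk; apply: (@kan_of_fibration _ _ (colim_map (to_point_diag D))).
  by apply: colim_fibration => c; apply: kan_to_point.
have ptE q (x y : colim point_diag q) : x = y.
  have [c [[] ->]] := cin_surj x; have [c' [[] ->]] := cin_surj y.
  have [z [[f] [f']]] := dir c c'.
  by rewrite -(cin_map f) -[RHS](cin_map f').
move=> n k h.
have [l lk] : exists l : 'I_n.+2, l != k.
  by case: (eqVneq ord0 k) => [<-|]; [exists ord_max|exists ord0].
have lP : exists2 j, j != k & forall i, @mono_const 0 n.+1 k i != j.
  by exists l => // i; rewrite eq_sym.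
have [c [x _]] := cin_surj (h 0 (exist _ _ lP)).
exists (yoneda (cin (D := point_diag) (c := c) (q := n.+1) tt)).
by apply: smap_eq => q b; apply: ptE.
Qed.
End Filtered.

(** * The mapping path object *)

Local Notation cst e q := (mono_const q (iend e)).

Lemma cst_inj q e e' : cst e q = cst e' q -> e = e'.
Proof. by move=> /(congr1 (fun g : mono q 1 => g ord0)) /= /iend_inj. Qed.

Lemma kan_hep (D X : sset) (e : bool) (R : srel (sprod D I1) X) :
  kan X -> srel_closed R -> srel_fun R ->
  (forall q (d : D q), exists x, R q (d, cst e q) x) ->
  exists h : smap (sprod D I1) X, forall q (d : D q) t x, R q (d, t) x ->
       t = cst e q \/
       (forall p (a : mono p q) s, exists y, R p (sact a d, s) y) -> h q (d, t) = x.
Proof.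
move=> Xk Rc Rf Re.
have Kc : srel_closed (fun q (d : sprod D I1 q) (x : X q) => True) by [].
have [|h [_ hP]] := hep Kc (kan_horn_fill Xk) Rc Rf _ Re; first by [].
by exists h.
Qed.

Lemma fibration_hep (D X Y : sset) (p : smap X Y) (v : smap (sprod D I1) Y) (e : bool)
    (R : srel (sprod D I1) X) :
  fibration p -> srel_closed R -> srel_fun R ->
  (forall q d x, R q d x -> p q x = v q d) ->
  (forall q (d : D q), exists x, R q (d, cst e q) x) ->
  exists h : smap (sprod D I1) X, (forall q d, p q (h q d) = v q d) /\
    (forall q (d : D q) t x, R q (d, t) x ->
       t = cst e q \/
       (forall p (a : mono p q) s, exists y, R p (sact a d, s) y) -> h q (d, t) = x).
Proof.
move=> pf Rc Rf Rp Re.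
have [h hP] := hep (lift_closed (p := p) (v := v)) (fibration_horn_fill (v := v) pf) Rc Rf Rp Re.
by exists h.
Qed.

Section Cocylinder.
Variables (X Y : sset) (f : smap X Y).

(** The fibre product of [X] and of the path space of [Y] over evaluation at the
    start of paths. *)
Definition cocyl_simp q := {xg : X q * path_space Y q |
  forall p (a : mono p q), xg.2 p (a, cst false p) = f p (sact a xg.1)}.

Lemma cocyl_eq q (x y : cocyl_simp q) : (sval x).1 = (sval y).1 ->
  (forall p a t, (sval x).2 p (a, t) = (sval y).2 p (a, t)) -> x = y.
Proof.
case: x y => [[x g] xP] [[y h] yP] /= xy gh; apply: eq_exist.
by congr pair => //; apply: smap_eq => p [a t]; apply: gh.
Qed.

Program Definition cocyl : sset :=
  @SSet cocyl_simp (fun p q a x => exist _ (sact a (sval x).1, sact a (sval x).2) _) _ _.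
Next Obligation.
move=> p q a [[x g] xP] r b /=; have /= -> := xP r (mono_comp a b).
by rewrite sact_comp.
Qed.
Next Obligation.
move=> q x; apply: cocyl_eq => [|p a t] /=; first by rewrite sact_id.
by rewrite mono_Icomp.
Qed.
Next Obligation.
move=> l m n b a x; apply: cocyl_eq => [|p c t] /=; first by rewrite sact_comp.
by rewrite mono_compA.
Qed.

Program Definition cocyl_end : smap cocyl Y :=
  @SMap cocyl Y (fun q x => (sval x).2 q (mono_id q, cst true q)) _.
Next Obligation.
by move=> p q a x; rewrite path_nat /= mono_compI mono_Icomp mono_const_comp.
Qed.

Program Definition cocyl_start : smap cocyl X :=
  @SMap cocyl X (fun q x => (sval x).1) _.
Next Obligation. by []. Qed.

Program Definition const_path q (y : Y q) : path_space Y q :=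
  @SMap (sprod (simplex q) I1) Y (fun p at_ => sact at_.1 y) _.
Next Obligation. by move=> q y m n a [b t] /=; rewrite sact_comp. Qed.

Program Definition cocyl_const : smap X cocyl :=
  @SMap X cocyl (fun q x => exist _ (x, const_path (f q x)) _) _.
Next Obligation. by move=> q x p a /=; rewrite smap_nat. Qed.
Next Obligation.
move=> p q a x; apply: cocyl_eq => //= r b t.
by rewrite smap_nat sact_comp.
Qed.

Fact meet_mono q (s t : mono q 1) :
  {homo (fun i => if (s i <= t i)%N then s i else t i) : i j / (i <= j)%N}.
Proof.
move=> i j ij; have := monoP s ij; have := monoP t ij.
by do 2!case: ifP; lia.
Qed.
Definition meet q (s t : mono q 1) : mono q 1 := Mono (@meet_mono q s t).

Lemma meet_comp p q (s t : mono q 1) (a : mono p q) :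
  mono_comp (meet s t) a = meet (mono_comp s a) (mono_comp t a).
Proof. exact: mono_eq. Qed.

Lemma meet0 q (t : mono q 1) : meet t (cst false q) = cst false q.
Proof.
apply: mono_eq => i /=; case: ifP => //; rewrite leqn0 => /eqP ti.
by apply: val_inj.
Qed.

Lemma meet0l q (t : mono q 1) : meet (cst false q) t = cst false q.
Proof. exact: mono_eq. Qed.

Lemma meet1 q (t : mono q 1) : meet t (cst true q) = t.
Proof. by apply: mono_eq => i /=; rewrite -ltnS ltn_ord. Qed.

(** Stops the path at the parameter [s], by taking the minimum of [s] with the
    parameter of the path. *)
Program Definition shrink_path q (g : path_space Y q) (s : mono q 1) : path_space Y q :=
  @SMap (sprod (simplex q) I1) Y
    (fun p at_ => g p (at_.1, meet at_.2 (mono_comp s at_.1))) _.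
Next Obligation.
move=> q g s m n a [b t] /=; rewrite path_nat meet_comp mono_compA //.
Qed.

Program Definition cocyl_shrink : smap (sprod cocyl I1) cocyl :=
  @SMap (sprod cocyl I1) cocyl
    (fun q xs => exist _ ((sval xs.1).1, shrink_path (sval xs.1).2 xs.2) _) _.
Next Obligation.
move=> q [[[x g] xP] s] p a /=; rewrite meet0l; exact: xP.
Qed.
Next Obligation.
by move=> p q a [[[x g] xP] s]; apply: cocyl_eq.
Qed.

Lemma cocyl_shrink0 q (x : cocyl q) :
  cocyl_shrink q (x, cst false q) = cocyl_const q (cocyl_start q x).
Proof.
case: x => [[x g] xP]; apply: cocyl_eq => //= p a t.
by rewrite mono_const_comp meet0 [LHS]xP /= smap_nat.
Qed.

Lemma cocyl_shrink1 q (x : cocyl q) : cocyl_shrink q (x, cst true q) = x.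
Proof.
case: x => [[x g] xP]; apply: cocyl_eq => //= p a t.
by rewrite mono_const_comp meet1.
Qed.

Lemma cocyl_end_const q (x : X q) : cocyl_end q (cocyl_const q x) = f q x.
Proof. by rewrite /= sact_id. Qed.
End Cocylinder.

(** The retraction of Gabriel and Zisman from Delta^(n+1) x I onto its end [~~ e]:
    it maps both the end [e] and the prism over the k-th horn into this horn.  The
    map at the end [e] is the minimum with [k], and for the last vertex [k] it is
    constant with value [k]. *)
Section HornRetract.
Variables (n : nat) (k : 'I_n.+2) (e : bool).
Hypothesis ek : if e then k = ord_max else k != ord_max.

Fact retr_mono q (al : mono q n.+1) (s : mono q 1) :
  {homo (fun i => if s i == iend e then (if e then ord_max else
      if (al i <= k)%N then al i else k) else al i) : i j / (i <= j)%N}.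
Proof.
move=> i j ij; have al_ij := monoP al ij; have := monoP s ij.
have [u ->] := iend_cases (s i); have [v ->] := iend_cases (s j).
rewrite !(inj_eq iend_inj); have := ltn_ord (al i).
by case: e; case: u; case: v => //=; repeat case: ifP; lia.
Qed.
Definition retr q (al : mono q n.+1) (s : mono q 1) : mono q n.+1 := Mono (retr_mono al s).

Lemma retr_comp p q (al : mono q n.+1) (s : mono q 1) (a : mono p q) :
  mono_comp (retr al s) a = retr (mono_comp al a) (mono_comp s a).
Proof. exact: mono_eq. Qed.

Lemma retr_far q (al : mono q n.+1) : retr al (cst (~~ e) q) = al.
Proof. by apply: mono_eq => i /=; rewrite (inj_eq iend_inj); case: e. Qed.

Lemma retr_near q (al : mono q n.+1) : in_horn k (retr al (cst e q)).
Proof.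
move: ek; case eE: e => ek'.
  exists ord0; first by rewrite ek'.
  by move=> l /=; rewrite eE eqxx.
exists ord_max; first by rewrite eq_sym.
move=> l /=; rewrite eE eqxx; case: ifP => // alk.
apply: contra ek' => /eqP ale; rewrite ale in alk.
by apply/eqP/val_inj/eqP; rewrite eqn_leq alk -ltnS ltn_ord.
Qed.

Lemma retr_horn q (al : mono q n.+1) (s : mono q 1) :
  in_horn k al -> in_horn k (retr al s).
Proof.
case=> j jk alj; exists j => // l /=; case: ifP => // _.
move: ek; case: (e) => [<-|ek']; first by rewrite eq_sym.
by case: ifP => // _; rewrite eq_sym.
Qed.
End HornRetract.

(** Fill the horn in [X] first.  It remains to extend a map to [Y] from the union of
    (horn x I) and of the two ends to all of (simplex x I).  Precomposition with
    the retraction above turns this into a homotopy extension problem, whose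
    solution restricts to the required path at the end [~~ e]. *)
Lemma cocyl_fibration (X Y : sset) (f : smap X Y) :
  kan X -> kan Y -> fibration (cocyl_end f).
Proof.
move=> Xk Yk n k y G Gc Gf Gp Gd.
have [||||x0 _ x0P] := kan_horn_fill (D := point) Xk (k := k) (d := tt : point n.+1)
   (G := fun q a x => exists2 g, G q a g & x = (sval g).1).
- by move=> p q a d x [g Gg ->]; exists (sact a g) => //; apply: Gc.
- by move=> q d x x' [g Gg ->] [g' Gg' ->]; rewrite (Gf _ _ _ _ Gg Gg').
- by [].
- by move=> p a /Gd[g Gg]; exists (sval g).1, g.
pose N := n.+1; pose D := sprod (simplex N) I1.
(* The map to extend: given paths over the horn, [f x0] at the start, [y] at the
   end. *)
pose kap : srel D Y := fun q d w => [\/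
  in_horn k d.1 /\ exists2 g, G q d.1 g & w = (sval g).2 q (mono_id q, d.2),
  d.2 = cst false q /\ w = f q (sact (d.1 : mono q N) x0) |
  d.2 = cst true q /\ w = sact (d.1 : mono q N) y].
have kap_horn q d (g : cocyl f q) w : in_horn k d.1 -> G q d.1 g -> kap q d w ->
    w = (sval g).2 q (mono_id q, d.2).
  move=> dk Gg [[_ [g' Gg' ->]]|[te ->]|[te ->]].
  - by rewrite (Gf _ _ _ _ Gg Gg').
  - rewrite te (svalP g) sact_id; congr (f q _); apply/esym/(x0P _ _ _ dk).
    by exists g.
  - by rewrite te -(Gp _ _ _ Gg).
have kap_fun : srel_fun kap.
  move=> q d w w' kw kw'; case: (pselect (in_horn k d.1)) => [dk|ndk].
    have [g Gg] := Gd _ _ dk; by rewrite (kap_horn _ _ _ _ dk Gg kw) (kap_horn _ _ _ _ dk Gg kw').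
  case: kw kw' => [[//]|[te ->]|[te ->]] [[//]|[te' ->]|[te' ->]] //.
  - by move: te'; rewrite te => /cst_inj.
  - by move: te'; rewrite te => /cst_inj.
have horn_comp p q (a : mono p q) (b : mono q n.+1) : in_horn k b -> in_horn k (mono_comp b a).
  by case=> j jk bj; exists j => //; apply: misses_comp.
have kap_closed : srel_closed kap.
  move=> p q a [b t] w [[dk [g Gg ->]]|[te ->]|[te ->]].
  - constructor 1; split; first exact: horn_comp.
    exists (sact a g); first exact: Gc.
    by rewrite path_nat /= mono_compI mono_Icomp.
  - by constructor 2; rewrite /= in te *; rewrite te mono_const_comp -smap_nat sact_comp.
  - by constructor 3; rewrite /= in te *; rewrite te mono_const_comp sact_comp.
have kap_dom q (d : D q) : in_horn k d.1 \/ (exists e, d.2 = cst e q) -> exists w, kap q d w.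
  case=> [dk|[[] te]].
  - by have [g Gg] := Gd _ _ dk; eexists; constructor 1; split=> //; exists g.
  - by eexists; constructor 3.
  - by eexists; constructor 2.
pose e := k == ord_max.
have ek : if e then k = ord_max else k != ord_max by rewrite /e; case: eqP => // /eqP.
pose R : srel (sprod D I1) Y := fun q d w => kap q (retr k e d.1.1 d.2, d.1.2) w.
have [|||h hP] := kan_hep (e := e) (R := R) Yk.
- by move=> p q a [[al t] s] w /(kap_closed _ _ a); rewrite /R /= retr_comp.
- by move=> q d w w'; apply: kap_fun.
- by move=> q [al t]; apply: kap_dom; left; apply: retr_near.
have gN m m' (a : mono m m') (d : D m') :
    h m (sact a d, cst (~~ e) m) = sact a (h m' (d, cst (~~ e) m')).
  by rewrite -smap_nat /= mono_const_comp.
pose g0 : path_space Y N := SMap gN.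
have g0P q (d : D q) w : kap q d w -> in_horn k d.1 \/ (exists e, d.2 = cst e q) ->
    g0 q d = w.
  case: d => al t kw dd; apply: hP; first by rewrite /R /= retr_far.
  right=> p a s; apply: kap_dom => /=; case: dd => [dk|[e' te]].
    by left; apply/retr_horn/horn_comp.
  by right; exists e'; rewrite /= in te *; rewrite te mono_const_comp.
have g0start p (a : mono p N) : g0 p (a, cst false p) = f p (sact a x0).
  by apply: g0P; [constructor 2|right; exists false].
exists (exist _ (x0, g0) g0start : cocyl f N).
  by apply: g0P; [constructor 3; rewrite /= sact_id|right; exists true].
move=> q a g ak Gg; apply: cocyl_eq => [|p b t] /=.
  by apply: x0P => //; exists g.
apply/esym/g0P; last by left; apply: horn_comp.
constructor 1; split; first exact: horn_comp.
exists (sact b g); first exact: Gc.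
by rewrite /= mono_compI.
Qed.

(** * Spheres in truncated Kan complexes *)

Definition sphere_fill (X : sset) m : Prop :=
  forall G : srel (simplex m) X, srel_closed G -> srel_fun G ->
    (forall q (a : mono q m), nonsurj a -> exists x, G q a x) ->
  exists x : X m, forall q (a : mono q m) z, nonsurj a -> G q a z -> z = sact a x.

Section Extends.
Variables (A B : sset) (m : nat) (G : srel (simplex m) A).
Arguments G : clear implicits.
Hypotheses (G_closed : srel_closed G) (G_fun : srel_fun G).
Hypothesis G_dom : forall q (a : mono q m), nonsurj a -> exists x, G q a x.

Definition extends (u : smap A B) : Prop :=
  exists x : B m, forall q (a : mono q m) z, nonsurj a -> G q a z -> u q z = sact a x.

Lemma sphere_hep (H : smap (sprod A I1) B) (e : bool) (x : B m) : kan B ->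
  (forall q (a : mono q m) z, nonsurj a -> G q a z -> H q (z, cst e q) = sact a x) ->
  exists h : smap (sprod (simplex m) I1) B,
    (forall q (a : mono q m), h q (a, cst e q) = sact a x) /\
    (forall q (a : mono q m) z t, nonsurj a -> G q a z -> h q (a, t) = H q (z, t)).
Proof.
move=> Bk xP.
pose R : srel (sprod (simplex m) I1) B := fun q d w =>
  (nonsurj d.1 /\ exists2 z, G q d.1 z & w = H q (z, d.2)) \/
  (d.2 = cst e q /\ w = sact (d.1 : mono q m) x).
have R_overlap q d w w' : nonsurj d.1 /\ (exists2 z, G q d.1 z & w = H q (z, d.2)) ->
    d.2 = cst e q /\ w' = sact (d.1 : mono q m) x -> w = w'.
  by case=> ns [z Gz ->] [te ->]; rewrite te (xP _ _ _ ns Gz).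
have [|||h hP] := kan_hep (e := e) (R := R) Bk.
- move=> p q a [b t] w [[ns [z Gz ->]]|[te ->]]; [left|right].
    split; first exact: nonsurj_comp.
    exists (sact a z); first exact: G_closed.
    by rewrite -smap_nat.
  by rewrite /= in te *; rewrite te mono_const_comp sact_comp.
- move=> q d w w' Rw Rw'.
  case: Rw Rw' => [Rw|Rw] [Rw'|Rw'].
  + case: Rw Rw' => _ [z Gz ->] [_ [z' Gz' ->]].
    by rewrite (G_fun Gz Gz').
  + exact: R_overlap Rw Rw'.
  + by apply/esym; apply: R_overlap Rw' Rw.
  + by rewrite Rw.2 Rw'.2.
- by move=> q a; exists (sact (a : mono q m) x); right.
exists h; split=> [q a|q a z t ns Gz].
  by apply: hP; [right|left].
apply: hP; first by left; split=> //; exists z.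
right=> p b s; have [|w Gw] := G_dom (a := mono_comp a b); first exact: nonsurj_comp.
exists (H p (w, s)); left; split; first exact: nonsurj_comp.
by exists w.
Qed.

Lemma extends_end (H : smap (sprod A I1) B) (u v : smap A B) (e : bool) : kan B ->
  (forall q x, H q (x, cst e q) = u q x) ->
  (forall q x, H q (x, cst (~~ e) q) = v q x) -> extends u -> extends v.
Proof.
move=> Bk Hu Hv [x xP]; have [|h [_ hP]] := sphere_hep (H := H) (e := e) (x := x) Bk.
  by move=> q a z ns Gz; rewrite Hu (xP _ _ _ ns Gz).
exists (h m (mono_id m, cst (~~ e) m)) => q a z ns Gz.
by rewrite -smap_nat /= mono_Icomp mono_const_comp -Hv (hP _ _ _ _ ns Gz).
Qed.

(** Whether the image of a sphere bounds is invariant under homotopy, so that weak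
    equivalences, defined by homotopy classes of maps, control actual spheres. *)
Lemma extends_homotopic (u v : smap A B) : kan B -> homotopic u v ->
  extends u <-> extends v.
Proof.
move=> Bk; elim=> {u v} [u v [H [Hu Hv]]|u|u v _ IH|u v w _ IH1 _ IH2]; try by [].
- by split; [apply: (extends_end (e := false) Bk Hu Hv)|apply: (extends_end (e := true) Bk Hv Hu)].
- by split=> /IH.
- by rewrite IH1.
Qed.
End Extends.

Lemma misses_other q m (a : mono q m) (k : 'I_m.+1) : (q.+1 < m)%N ->
  exists2 j, j != k & misses a j.
Proof.
move=> qm; apply: contrapT => no.
have cov : forall j : 'I_m.+1, j \in k :: codom a.
  move=> j; rewrite inE; case: eqVneq => //= jk.
  apply: contrapT => jn; apply: no; exists j => // l; apply/eqP => alj.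
  by apply: jn; rewrite -alj codom_f.
have : (#|'I_m.+1| <= size (k :: codom a))%N.
  rewrite cardE; apply: uniq_leq_size; first exact: enum_uniq.
  by move=> j _; apply: cov.
by rewrite /= size_codom !card_ord; lia.
Qed.

(** The image of a sphere in P_n X bounds if the sphere is the boundary of a simplex
    of dimension at least n+2: a face of dimension at most n misses two vertices,
    so it belongs to each horn, and the filler in [X] of one horn of the sphere has
    the same n-skeleton on its boundary as the sphere.  A left homotopy inverse of
    X -> P_n X maps this filler back to [X], up to a homotopy of the sphere. *)
Lemma ntype_sphere_fill (X : sset) n m : kan X -> weak_equiv (postnikov_map n X) ->
  (n.+1 < m)%N -> sphere_fill X m.
Proof.
move=> Xk Xn; case: m => // m nm G Gc Gf Gd.
have [/(_ (smap_id X))[v vE] _] := Xn X Xk.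
suff : extends G (smap_comp v (postnikov_map n X)).
  by move=> /(extends_homotopic Gc Gf Gd Xk vE)[x xP]; exists x.
have [||x _ xP] := kan_horn_fill (D := point) Xk (k := ord0) (d := tt : point m.+1) Gc Gf.
- by [].
- by move=> q a [j _ aj]; apply: Gd; exists j.
exists (v _ (postnikov_map n X _ x)) => q a z ns Gz.
rewrite -!smap_nat /=; congr (v _ _); apply/quot_piP/rst_step => p c pn.
have ach : in_horn ord0 (mono_comp a c).
  by apply: misses_other; lia.
rewrite -sact_comp; apply: xP => //; exact: Gc Gz.
Qed.

Lemma retract_sphere_fill (X P : sset) (r : smap P X) (j : smap X P) m :
  kan P -> elem_homotopic (smap_comp j r) (smap_id P) ->
  sphere_fill X m -> sphere_fill P m.
Proof.
move=> Pk jr Xm G Gc Gf Gd.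
have : extends G (smap_id P); last by case=> x xP; exists x.
apply/(extends_homotopic Gc Gf Gd Pk (rst_step _ _ _ _ jr)).
have [|||x xP] := Xm (fun q a x => exists2 z, G q a z & x = r q z).
- by move=> p q a d x [z Gz ->]; exists (sact a z); [apply: Gc|rewrite smap_nat].
- by move=> q d x x' [z Gz ->] [z' Gz' ->]; rewrite (Gf _ _ _ _ Gz Gz').
- by move=> q a /Gd[z Gz]; exists (r q z), z.
exists (j m x) => q a z ns Gz; rewrite /= -smap_nat; congr (j q _).
by apply: xP => //; exists z.
Qed.

(** Let [x] fill the sphere in [P].  As [p x] and [y] have the same boundary, they
    are two faces of a sphere in [Y] whose other faces are degenerate; let [z] fill
    it.  Lift [z] along the horn that prescribes [x] and degenerate simplices; the
    remaining face of the lift lies over [y]. *)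
Lemma fibration_sphere_lift (P Y : sset) (p : smap P Y) m : fibration p ->
  sphere_fill P m -> sphere_fill Y m.+1 -> sphere_lift p m.
Proof.
move=> pf Pm Ym y G Gc Gf Gp Gd.
have [x xP] := Pm G Gc Gf Gd.
(* [s] collapses the last two vertices, and is a left inverse of both faces [mm], [mx]. *)
pose s := degen (@ord_max m).
pose mx : 'I_m.+2 := ord_max; pose mm : 'I_m.+2 := inord m.
have mmE : val mm = m by rewrite /mm /= inordK.
have nsE q (a : mono q m) : nonsurj a -> sact a y = sact a (p m x).
  by move=> ns; have [u Gu] := Gd _ _ ns; rewrite -(Gp _ _ _ Gu) (xP _ _ _ ns Gu) smap_nat.
have miss2 q (a : mono q m.+1) : misses a mm -> misses a mx -> nonsurj (mono_comp s a).
  move=> am ax; exists ord_max => l; apply/eqP => /(congr1 val) /=.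
  have := ltn_ord (a l); have /eqP := am l; have /eqP := ax l.
  by move=> + + lt E; case: (eqVneq (a l : nat) m) => h ax' am';
     [apply: am'; apply: val_inj; rewrite mmE|apply: ax'; apply: val_inj => /=; lia].
have missl q (a : mono q m.+1) j : misses a j -> [\/ j = mm, j = mx | nonsurj (mono_comp s a)].
  move=> aj; case: (eqVneq j mm) => [->|jmm]; first by constructor 1.
  case: (eqVneq j mx) => [->|jmx]; first by constructor 2.
  constructor 3; have jm : (j < m)%N.
    have := ltn_ord j; move/eqP: jmm => jmm; move/eqP: jmx => jmx lt.
    have h1 : (j : nat) <> m by move=> h; apply: jmm; apply: val_inj; rewrite mmE.
    have h2 : (j : nat) <> m.+1 by move=> h; apply: jmx; apply: val_inj.
    by move: h1 h2; rewrite /=; lia.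
  exists (inord j) => l; apply/eqP => /(congr1 val) /=; rewrite inordK; last lia.
  have /eqP := aj l => + E; apply; apply: val_inj => /=.
  by move: E; have := ltn_ord (a l); lia.
pose Q : srel (simplex m.+1) Y := fun q a w => [\/
  misses a mm /\ w = sact (mono_comp s a) (p m x),
  misses a mx /\ w = sact (mono_comp s a) y |
  nonsurj (mono_comp s a) /\ w = sact (mono_comp s a) y].
have [|||z zP] := Ym Q.
- move=> q r a d w [[am ->]|[ax ->]|[ns ->]].
  + by constructor 1; split; [apply: misses_comp|rewrite -sact_comp mono_compA].
  + by constructor 2; split; [apply: misses_comp|rewrite -sact_comp mono_compA].
  + constructor 3; rewrite -sact_comp mono_compA; split=> //.
    exact: nonsurj_comp.
- move=> q a w w' [[am ->]|[am ->]|[am ->]] [[am' ->]|[am' ->]|[am' ->]] //;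
  try (by rewrite nsE //; exact: miss2); by rewrite nsE.
- move=> q a [j /[dup] aj /missl[E|E|ns]]; rewrite ?E in aj.
  + by eexists; constructor 1.
  + by eexists; constructor 2.
  + by eexists; constructor 3.
pose S : srel (simplex m.+1) P := fun q a w =>
  w = sact (mono_comp s a) x /\ (misses a mm \/ nonsurj (mono_comp s a)).
have Shorn q (a : mono q m.+1) : in_horn mx a -> misses a mm \/ nonsurj (mono_comp s a).
  case=> j jmx /[dup] aj /missl[E|E|]; [by left; rewrite -E|by rewrite E eqxx in jmx|by right].
have [||||w pw wP] := pf m mx z S.
- move=> q r a d w [-> dP]; rewrite /S -sact_comp mono_compA; split=> //.
  by case: dP => [dm|ns]; [left; apply: misses_comp|right; apply: nonsurj_comp].
- by move=> q a w w' [-> _] [->].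
- move=> q a w [-> [am|ns]]; rewrite smap_nat; apply: zP.
  + by exists mm.
  + by constructor 1.
  + case: ns => j /[dup] saj; move=> _.
    have [l [h1 h2]] : exists l : 'I_m.+2, s l = j /\ True.
      exists (inord j); split=> //; apply: val_inj => /=.
      by rewrite inordK; have := ltn_ord j; lia.
    by exists l => i; apply/eqP => ai; have := saj i; rewrite /= -h1 -ai eqxx.
  + by constructor 3; rewrite nsE.
- by move=> q a /Shorn aP; exists (sact (mono_comp s a) x).
have sd : mono_comp s (delta mx) = mono_id m.
  apply: mono_eq => i; apply: val_inj => /=; rewrite /bump /=.
  by have := ltn_ord i; lia.
exists (sact (delta mx) w).
  rewrite smap_nat pw; apply/esym.
  rewrite -[LHS]sact_id -sd; apply: zP; first by exists mx; apply: delta_misses.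
  by constructor 2; split=> //; apply: delta_misses.
move=> q a u ns Gu; rewrite -sact_comp.
have sda : mono_comp s (mono_comp (delta mx) a) = a by rewrite mono_compA sd mono_Icomp.
rewrite (xP _ _ _ ns Gu) -{1}sda; apply: wP.
- case: ns => j aj; exists (lift mx j); first by rewrite lift_eqF.
  by move=> l; rewrite /= (inj_eq lift_inj).
- by split=> //; right; rewrite sda.
Qed.

(** * Fibrations that are weak equivalences *)

Lemma homotopic_post (X Y Z : sset) (g : smap Y Z) (u v : smap X Y) :
  homotopic u v -> homotopic (smap_comp g u) (smap_comp g v).
Proof.
elim=> {u v} [u v [H [H0 H1]]|u|u v _ IH|u v w _ IH1 _ IH2].
- apply: rst_step; exists (smap_comp g H).
  by split=> n x /=; rewrite ?H0 ?H1.
- exact: rst_refl.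
- exact: rst_sym.
- exact: rst_trans IH1 IH2.
Qed.

Lemma homotopic_pre (X Y Z : sset) (g : smap X Y) (u v : smap Y Z) :
  homotopic u v -> homotopic (smap_comp u g) (smap_comp v g).
Proof.
elim=> {u v} [u v [H [H0 H1]]|u|u v _ IH|u v w _ IH1 _ IH2].
- apply: rst_step; exists (smap_comp H (sprod_map g (smap_id I1))).
  by split=> n x /=; rewrite ?H0 ?H1.
- exact: rst_refl.
- exact: rst_sym.
- exact: rst_trans IH1 IH2.
Qed.

Lemma smap_compA (X Y Z T : sset) (h : smap Z T) (g : smap Y Z) (f : smap X Y) :
  smap_comp h (smap_comp g f) = smap_comp (smap_comp h g) f.
Proof. exact: smap_eq. Qed.

Lemma smap_compI (X Y : sset) (f : smap X Y) : smap_comp f (smap_id X) = f.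
Proof. exact: smap_eq. Qed.

Lemma smap_Icomp (X Y : sset) (f : smap X Y) : smap_comp (smap_id Y) f = f.
Proof. exact: smap_eq. Qed.

Section LiftHomotopy.
Variables (B P : sset) (p : smap P B).
Hypothesis p_fib : fibration p.

(** The covering homotopy property: a lift at one end moves to the other end. *)
Lemma section_end (D : sset) (H : smap (sprod D I1) B) (u v : smap D B) (e : bool) :
  (forall q x, H q (x, cst e q) = u q x) ->
  (forall q x, H q (x, cst (~~ e) q) = v q x) ->
  (exists s, smap_comp p s = u) -> exists s, smap_comp p s = v.
Proof.
move=> Hu Hv [s su].
have [||||h [ph _]] := fibration_hep (v := H) (e := e) p_fib
  (R := fun q d x => d.2 = cst e q /\ x = s q d.1).
- move=> q r a [d t] x [/= -> ->]; split; first exact: mono_const_comp.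
  by rewrite smap_nat.
- by move=> q d x y [_ ->] [_ ->].
- by move=> q [d t] x [/= -> ->]; rewrite Hu -su.
- by move=> q d; exists (s q d).
have gN m n (a : mono m n) (d : D n) :
    h m (sact a d, cst (~~ e) m) = sact a (h n (d, cst (~~ e) n)).
  by rewrite -smap_nat /= mono_const_comp.
by exists (SMap gN); apply: smap_eq => n x /=; rewrite ph Hv.
Qed.

Lemma section_homotopic (D : sset) (u v : smap D B) : homotopic u v ->
  (exists s, smap_comp p s = u) <-> (exists s, smap_comp p s = v).
Proof.
elim=> {u v} [u v [H [Hu Hv]]|u|u v _ IH|u v w _ IH1 _ IH2]; try by [].
- by split; [apply: (section_end (e := false) Hu Hv)|apply: (section_end (e := true) Hv Hu)].
- by split=> /IH.
- by rewrite IH1.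
Qed.
End LiftHomotopy.

Section RelativeLift.
Variables (P : sset) (m : nat).
Hypothesis P_kan : kan P.

Definition rel_homotopy (x y : P m) (h : smap (sprod (simplex m) I1) P) : Prop :=
  [/\ forall q (a : mono q m), h q (a, cst false q) = sact a x,
      forall q (a : mono q m), h q (a, cst true q) = sact a y &
      forall q (a : mono q m) t, nonsurj a -> h q (a, t) = sact a y].

(** The self-map [u] lifts spheres up to homotopy relative to the boundary.  This is
    clear for the identity, and it depends only on the homotopy class of [u]. *)
Definition rel_lift (u : smap P P) : Prop :=
  forall (c : P m) (G : srel (simplex m) P), srel_closed G -> srel_fun G ->
    (forall q (a : mono q m), nonsurj a -> exists x, G q a x) ->
    (forall q (a : mono q m) x, nonsurj a -> G q a x -> u q x = sact a c) ->
  exists2 x : P m, forall q (a : mono q m) z, nonsurj a -> G q a z -> z = sact a x &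
    exists h, rel_homotopy (u m x) c h.

Lemma rel_lift_id : rel_lift (smap_id P).
Proof.
move=> c G Gc Gf Gd Gu; exists c => //.
have hN p q (a : mono p q) (d : sprod (simplex m) I1 q) :
    sact (sact a d).1 c = sact a (sact (d.1 : mono q m) c) by rewrite -sact_comp.
by exists (SMap hN).
Qed.

(** The relative homotopy for [v] is the lid of a box.  Its bottom is the relative
    homotopy for [u]; its walls are given by [H] on the boundary, by [H] at [x], and
    by an extension [k] of [H] from the sphere to the simplex it bounds. *)
Lemma rel_lift_end (H : smap (sprod P I1) P) (u v : smap P P) (e : bool) :
  (forall q x, H q (x, cst e q) = u q x) ->
  (forall q x, H q (x, cst (~~ e) q) = v q x) -> rel_lift u -> rel_lift v.
Proof.
move=> Hu Hv ul c' G Gc Gf Gd Gv.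
have [|k [k1 kG]] := sphere_hep Gc Gf Gd (H := H) (e := ~~ e) (x := c') P_kan.
  by move=> q a z ns Gz; rewrite Hv (Gv _ _ _ ns Gz).
pose c := k m (mono_id m, cst e m).
have cE q (a : mono q m) : sact a c = k q (a, cst e q).
  by rewrite /c -smap_nat /= mono_Icomp mono_const_comp.
have [|x xP [h [h0 h1 hr]]] := ul c G Gc Gf Gd.
  by move=> q a z ns Gz; rewrite cE (kG _ _ _ _ ns Gz) Hu.
exists x => //.
(* [d.1.2] is the parameter of relative homotopies, [d.2] that of [H]. *)
pose D := sprod (simplex m) I1.
pose R : srel (sprod D I1) P := fun q d w => [\/
  nonsurj d.1.1 /\ (exists2 z, G q d.1.1 z & w = H q (z, d.2)),
  d.1.2 = cst false q /\ w = H q (sact (d.1.1 : mono q m) x, d.2),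
  d.1.2 = cst true q /\ w = k q (d.1.1, d.2) |
  d.2 = cst e q /\ w = h q d.1].
have Rns q d w z : nonsurj d.1.1 -> G q d.1.1 z -> R q d w -> w = H q (z, d.2).
  case: d => [[al t] s] /= ns Gz [[_ [z' Gz' ->]]|[_ ->]|[_ ->]|[/= -> ->]].
  - by rewrite (Gf _ _ _ _ Gz Gz').
  - by rewrite /= (xP _ _ _ ns Gz).
  - by rewrite /= (kG _ _ _ _ ns Gz).
  - by rewrite (hr _ _ _ ns) cE (kG _ _ _ _ ns Gz).
have Re q d w : d.2 = cst e q -> R q d w -> w = h q d.1.
  case: d => [[al t] s] /= -> [[ns [z Gz ->]]|[/= -> ->]|[/= -> ->]|[_ //]] /=.
  - by rewrite (hr _ _ _ ns) cE (kG _ _ _ _ ns Gz).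
  - by rewrite h0 Hu smap_nat.
  - by rewrite h1 cE.
have [|||g gP] := kan_hep (e := e) (R := R) P_kan.
- move=> p q a [[al t] s] w [[/= ns [z Gz ->]]|[/= -> ->]|[/= -> ->]|[/= -> ->]].
  + constructor 1; split; first exact: nonsurj_comp.
    by exists (sact a z); [apply: Gc|rewrite -smap_nat].
  + by constructor 2; rewrite /= mono_const_comp -smap_nat /= sact_comp.
  + by constructor 3; rewrite /= mono_const_comp -smap_nat.
  + by constructor 4; rewrite /= mono_const_comp -smap_nat.
- move=> q d w w' Rw Rw'.
  case: (pselect (nonsurj d.1.1)) => [ns|nns].
    by have [z Gz] := Gd _ _ ns; rewrite (Rns _ _ _ _ ns Gz Rw) (Rns _ _ _ _ ns Gz Rw').
  case: (pselect (d.2 = cst e q)) => [de|nde].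
    by rewrite (Re _ _ _ de Rw) (Re _ _ _ de Rw').
  case: Rw Rw' => [[//]|[t0 ->]|[t0 ->]|[//]] [[//]|[t0' ->]|[t0' ->]|[//]] //.
  + by move: t0'; rewrite t0 => /cst_inj.
  + by move: t0'; rewrite t0 => /cst_inj.
- by move=> q d; exists (h q d); constructor 4.
have gN n n' (a : mono n n') (d : D n') :
    g n (sact a d, cst (~~ e) n) = sact a (g n' (d, cst (~~ e) n')).
  by rewrite -smap_nat /= mono_const_comp.
exists (SMap gN); split=> [q a|q a|q a t ns] /=.
- rewrite -(smap_nat v) -Hv; apply: gP; first by constructor 2.
  right=> r b s; eexists; constructor 2; split; last by [].
  exact: mono_const_comp.
- rewrite -k1; apply: gP; first by constructor 3.
  right=> r b s; eexists; constructor 3; split; last by [].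
  exact: mono_const_comp.
- have [z Gz] := Gd _ _ ns; rewrite -(Gv _ _ _ ns Gz) -Hv; apply: gP.
    by constructor 1; split=> //; exists z.
  right=> r b s; eexists; constructor 1; split; first exact: nonsurj_comp.
  by exists (sact b z); [exact: Gc|].
Qed.

Lemma rel_lift_homotopic (u v : smap P P) : homotopic u v -> rel_lift u <-> rel_lift v.
Proof.
elim=> {u v} [u v [H [Hu Hv]]|u|u v _ IH|u v w _ IH1 _ IH2]; try by [].
- by split; [apply: (rel_lift_end (e := false) Hu Hv)|apply: (rel_lift_end (e := true) Hv Hu)].
- by split=> /IH.
- by rewrite IH1.
Qed.
End RelativeLift.

Lemma fibration_rel_lift (P B : sset) (p : smap P B) (m : nat) (y : B m) (x : P m)
    (G : srel (simplex m) P) (h : smap (sprod (simplex m) I1) B) : fibration p ->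
  srel_closed G -> srel_fun G ->
  (forall q (a : mono q m), nonsurj a -> exists x, G q a x) ->
  (forall q (a : mono q m) z, nonsurj a -> G q a z -> z = sact a x) ->
  rel_homotopy (p m x) y h ->
  exists2 x', p m x' = y & forall q (a : mono q m) z, nonsurj a -> G q a z -> z = sact a x'.
Proof.
move=> pf Gc Gf Gd Gx [h0 h1 hr].
have nsE q (a : mono q m) : nonsurj a -> sact a (p m x) = sact a y.
  by move=> ns; rewrite -(hr _ _ (cst false q) ns) h0.
have [||||g [pg gP]] := fibration_hep (D := simplex m) (v := h) (e := false) pf
  (R := fun q d w => w = sact (d.1 : mono q m) x /\ (nonsurj d.1 \/ d.2 = cst false q)).
- move=> q r a [al t] w [/= -> dP]; rewrite sact_comp; split=> //.
  by case: dP => [ns|->]; [left; apply: nonsurj_comp|right; apply: mono_const_comp].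
- by move=> q d w w' [-> _] [->].
- move=> q [al t] w [/= -> [ns|->]]; rewrite smap_nat.
    by rewrite (hr _ _ _ ns) nsE.
  by rewrite h0.
- by move=> q d; eexists; split; [|right].
exists (g m (mono_id m, cst true m)); first by rewrite pg h1 sact_id.
move=> q a z ns Gz; rewrite -smap_nat /= mono_Icomp mono_const_comp (Gx _ _ _ ns Gz).
apply/esym/gP; first by split=> //; left.
right=> r b s; eexists; split; first by [].
by left; apply: nonsurj_comp.
Qed.

(** A homotopy inverse [v] of [p] is obtained by mapping to [P] and to [B]; a
    covering homotopy replaces it by a strict section [s].  The self-map [s p] is
    homotopic to the identity, so it lifts spheres up to relative homotopy; for the
    target [s y] the image under [p] of this homotopy is relative to the boundary
    and ends at [p (s y) = y], so it can be lifted.  Working with [s p] dispenses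
    with any coherence between the two homotopies of a homotopy equivalence. *)
Lemma weak_equiv_sphere_lift (A P B : sset) (f : smap A B) (j : smap A P)
    (r : smap P A) (p : smap P B) : kan P -> kan B -> fibration p ->
  smap_comp p j = f -> homotopic (smap_comp j r) (smap_id P) -> weak_equiv f ->
  forall m, sphere_lift p m.
Proof.
move=> Pk Bk pf pj jr fw.
have [/(_ j)[v vf] _] := fw P Pk; have [_ Binj] := fw B Bk.
have vp : homotopic (smap_comp v p) (smap_id P).
  apply: rst_trans (jr); apply: rst_trans (homotopic_pre r vf).
  rewrite -smap_compA -pj -smap_compA smap_compA -{1}[smap_comp v p]smap_compI.
  exact/homotopic_post/rst_sym.
have pv : homotopic (smap_comp p v) (smap_id B).
  apply: Binj; rewrite smap_Icomp -{2}pj -smap_compA.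
  exact: homotopic_post.
have [s ps] : exists s, smap_comp p s = smap_id B.
  by apply/(section_homotopic pf pv); exists v.
have sp : homotopic (smap_id P) (smap_comp s p).
  apply: rst_trans (rst_sym _ _ _ _ vp) _; apply: homotopic_pre.
  rewrite -[v]smap_compI -{1}ps smap_compA -{2}[s]smap_Icomp.
  exact: homotopic_pre.
move=> m y G Gc Gf Gp Gd.
have [|x Gx [h [h0 h1 hr]]] := (rel_lift_homotopic m Pk sp).1 (@rel_lift_id P m) (s m y) G Gc Gf Gd.
  by move=> q a z ns Gz; rewrite /= (Gp _ _ _ Gz) smap_nat.
have psE q b : p q (s q b) = b by have := congr1 (fun g : smap B B => g q b) ps.
apply: (fibration_rel_lift (h := smap_comp p h) pf Gc Gf Gd Gx).
split=> [q a|q a|q a t ns] /=.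
- by rewrite h0 smap_nat /= psE.
- by rewrite h1 smap_nat psE.
- by rewrite (hr _ _ _ ns) smap_nat psE.
Qed.

(** Lift the identity of [B] for the section [s]; then lift the constant homotopy of
    [p], with [s p] and the identity prescribed at the two ends. *)
Lemma sphere_lift_section (P B : sset) (p : smap P B) : (forall m, sphere_lift p m) ->
  exists s, smap_comp p s = smap_id B /\ elem_homotopic (smap_comp s p) (smap_id P).
Proof.
move=> pl.
have [|||s [ps _]] := extend_smap (D := B) (R := fun _ _ _ => False)
   (lift_closed (v := smap_id B)) _ _ _ (sphere_lift_fill (v := smap_id B) pl); try by [].
exists s; split; first exact: smap_eq.
pose v : smap (sprod P I1) B := SMap (fun m n a d => smap_nat p a d.1 :
  p m (sact a d : sprod P I1 m).1 = sact a (p n d.1)).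
have [|||h [ph hP]] := extend_smap (D := sprod P I1)
   (R := fun q d x => (d.2 = cst false q /\ x = s q (p q d.1)) \/ (d.2 = cst true q /\ x = d.1))
   (lift_closed (v := v)) _ _ _ (sphere_lift_fill (v := v) pl).
- move=> q r a [d t] x [[/= -> ->]|[/= -> ->]]; [left|right]; split=> //.
  by rewrite !smap_nat.
- move=> q [d t] x y [[/= -> ->]|[/= -> ->]] [[/= te ->]|[/= te ->]] //.
  + by have := @cst_inj q false true te.
  + by have := @cst_inj q true false te.
- by move=> q [d t] x [[_ ->]|[_ ->]] //; rewrite ps.
by exists h; split=> n x; apply: hP; [left|right].
Qed.

(** A homotopy inverse of [f] is [r s], for [s] a section of [p]. *)
Lemma sphere_lift_weak_equiv (A P B : sset) (f : smap A B) (j : smap A P)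
    (r : smap P A) (p : smap P B) :
  smap_comp p j = f -> smap_comp r j = smap_id A ->
  homotopic (smap_comp j r) (smap_id P) ->
  (forall m, sphere_lift p m) -> weak_equiv f.
Proof.
move=> pj rj jr /sphere_lift_section[s [ps sp]] K _.
have {}sp : homotopic (smap_comp s p) (smap_id P) by apply: rst_step.
split=> [u|v w fvw].
  exists (smap_comp (smap_comp u r) s).
  have urj : smap_comp (smap_comp u r) j = u by rewrite -smap_compA rj smap_compI.
  rewrite -pj -smap_compA (smap_compA s) -[X in homotopic _ X]urj.
  by apply: homotopic_post; rewrite -[X in homotopic _ X]smap_Icomp; apply: homotopic_pre.
have vp (g : smap B K) : homotopic (smap_comp (smap_comp g f) r) (smap_comp g p).
  rewrite -pj smap_compA -smap_compA -{2}[smap_comp g p]smap_compI.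
  exact: homotopic_post.
have pvw : homotopic (smap_comp v p) (smap_comp w p).
  apply: rst_trans (rst_sym _ _ _ _ (vp v)) _; apply: rst_trans (vp w).
  exact: homotopic_pre.
by rewrite -[v]smap_compI -[w]smap_compI -ps !smap_compA; apply: homotopic_pre.
Qed.

(** * Lifting over Borel constructions *)

Section CocylinderDiag.
Variables (C : cat) (X Y : sdiag C) (f : sdmap X Y).

Program Definition cocyl_mor (x y : C) (h : mor x y) : smap (cocyl (f x)) (cocyl (f y)) :=
  @SMap (cocyl (f x)) (cocyl (f y))
    (fun q s => exist _ (sd_map X h q (sval s).1, smap_comp (sd_map Y h) (sval s).2) _) _.
Next Obligation.
move=> x y h q [[s g] sP] p a /=; have /= -> := sP p a.
by rewrite -sdm_nat smap_nat.
Qed.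
Next Obligation.
by move=> x y h p q a [[s g] sP]; apply: cocyl_eq => //=; rewrite smap_nat.
Qed.

Program Definition cocyl_diag : sdiag C :=
  @SDiag C (fun c => cocyl (f c)) cocyl_mor _ _.
Next Obligation.
by move=> x n s; apply: cocyl_eq => [|p a t] /=; rewrite sd_id.
Qed.
Next Obligation.
by move=> x y z g h n s; apply: cocyl_eq => [|p a t] /=; rewrite sd_comp.
Qed.

Program Definition cocyl_diag_end : sdmap cocyl_diag Y :=
  @SDMap C cocyl_diag Y (fun c => cocyl_end (f c)) _.
Next Obligation. by []. Qed.

Program Definition cocyl_diag_start : sdmap cocyl_diag X :=
  @SDMap C cocyl_diag X (fun c => cocyl_start (f c)) _.
Next Obligation. by []. Qed.

Program Definition cocyl_diag_const : sdmap X cocyl_diag :=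
  @SDMap C X cocyl_diag (fun c => cocyl_const (f c)) _.
Next Obligation.
move=> x y h n s; apply: cocyl_eq => //= p a t.
by rewrite sdm_nat smap_nat.
Qed.

Program Definition cocyl_diag_shrink : sdmap (sd_prod cocyl_diag I1) cocyl_diag :=
  @SDMap C (sd_prod cocyl_diag I1) cocyl_diag (fun c => cocyl_shrink (f c)) _.
Next Obligation. by move=> x y h n s; apply: cocyl_eq. Qed.
End CocylinderDiag.

Section ColimHomotopy.
Variables (C : cat).

Lemma colim_map_comp (D E F : sdiag C) (g : sdmap E F) (f : sdmap D E) :
  smap_comp (colim_map g) (colim_map f) = colim_map (sdmap_comp g f).
Proof.
apply: smap_eq => n z; have [c [x ->]] := cin_surj z.
by rewrite -[LHS]/(colim_map g n (colim_map f n (cin x))) !colim_map_cin.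
Qed.

Lemma colim_map_id (D : sdiag C) : colim_map (sdmap_id D) = smap_id (colim D).
Proof.
by apply: smap_eq => n z; have [c [x ->]] := cin_surj z; rewrite colim_map_cin.
Qed.

Lemma colim_homotopic (D E : sdiag C) (u v : sdmap D E) (H : sdmap (sd_prod D I1) E) :
  (forall (c : C) q (x : D c q), H c q (x, cst false q) = u c q x) ->
  (forall (c : C) q (x : D c q), H c q (x, cst true q) = v c q x) ->
  elem_homotopic (colim_map u) (colim_map v).
Proof.
move=> Hu Hv.
pose h q (t : I1 q) (s : {c : C & D c q}) : {c : C & E c q} :=
  Tagged (fun c : C => E c q) (H (tag s) q (tagged s, t)).
have hP q t s s' : colim_step s s' -> colim_step (h q t s) (h q t s').
  case=> g gs; exists g.
  apply: etrans (esym (@sdm_nat _ _ _ H _ _ g q (tagged s, t))) _.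
  by rewrite /= gs.
pose K q (d : sprod (colim D) I1 q) : colim E q := quot_map (@colim_step C E q) (h q d.2) d.1.
have KE q (c : C) (x : D c q) t : K q (cin x, t) = cin (H c q (x, t)).
  by rewrite /K /= (quot_mapE (hP q t)).
have KN m n (a : mono m n) d : K m (sact a d) = sact a (K n d).
  case: d => z t; have [c [x ->]] := cin_surj z.
  have -> : @sact (sprod (colim D) I1) m n a (cin x, t) = (cin (sact a x), sact a t).
    by rewrite -cin_act.
  by rewrite !KE cin_act -smap_nat.
exists (SMap KN); split=> n z; have [c [x ->]] := cin_surj z; rewrite colim_map_cin.
  exact: etrans (KE _ _ _ _) (congr1 (@cin _ _ _ _) (Hu _ _ _)).
exact: etrans (KE _ _ _ _) (congr1 (@cin _ _ _ _) (Hv _ _ _)).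
Qed.
End ColimHomotopy.

Section Galois.
Variables (k K : fieldType) (iota : {rmorphism k -> K}).

Lemma gs_refl (L : galsub iota) : gs_sub L L. Proof. by []. Qed.

Lemma galcat_thin (L L' : galcat iota) (f g : mor L L') : f = g.
Proof. exact: (@Prop_irrelevance (gs_sub L L')). Qed.

(** The presheaf whose maps to [X] are the m-simplices of the function complex. *)
Definition borel_prism (L : galsub iota) m : spsh k := sd_prod (borel L) (simplex m).

Definition based (L : galsub iota) m q (b : borel_prism L m (Sp L) q) : Prop :=
  ts_ob b.1 ord0 = idm (Sp L).

Lemma ts_ob0 (G : groupType) (S : Type) (act : G -> S -> S) n (x : tsimp act n) i :
  ts_ob x i = act (@ts_mor _ _ _ _ x ord0 i (leq0n i)) (ts_ob x ord0).
Proof. by rewrite ts_morP. Qed.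

(** Every simplex over U is the restriction, along its first vertex U -> Sp(L), of
    the simplex with the same group elements that starts at the identity.  A
    surjective operator preserves the first vertex. *)
Lemma borel_free_gen (L : galsub iota) m : free_gen (@based L m).
Proof.
split.
- move=> U q [x al]; exists (ts_ob x ord0).
  pose g (i : 'I_q.+1) := @ts_mor _ _ _ _ x ord0 i (leq0n i).
  have obP (i j : 'I_q.+1) (ij : (i <= j)%N) :
      borel_act (ts_mor x ij) (Sp_gal (g i)) = Sp_gal (g j).
    rewrite /borel_act -Sp_galM; congr Sp_gal; apply/esym.
    exact: ts_comp.
  exists (TSimp obP (@ts_id _ _ _ _ x) (@ts_comp _ _ _ _ x), al).
    by rewrite /based /= /g ts_id Sp_gal1.
  by congr pair; apply: tsimp_eq => //= i; rewrite ts_ob0.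
- move=> U q [x al] [x' al'] h h' /= bx bx' E.
  have eal : al = al' by have /= := congr1 snd E.
  have eob i : compm (ts_ob x i) h = compm (ts_ob x' i) h'.
    by have := congr1 (fun z => ts_ob z.1 i) E.
  have emor (i j : 'I_q.+1) (ij : (i <= j)%N) : ts_mor x ij = ts_mor x' ij.
    by have := congr1 (fun z => ts_mor z.1 ij) E.
  split.
    by have := eob ord0; rewrite bx bx' !(@comp1m (fet k)).
  congr pair => //; apply: tsimp_eq => // i.
  by rewrite ts_ob0 [RHS]ts_ob0 emor bx bx'.
- move=> p q a [x al] /= bx aS; rewrite /based /=.
  suff -> : a ord0 = ord0 by [].
  have [l al0] := surjP aS ord0; apply/val_inj/eqP; rewrite -leqn0.
  by rewrite -[X in (_ <= X)%N]/(val (@ord0 q)) -al0; apply: monoP.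
Qed.

Definition prism_map (L L' : galsub iota) m (h : gs_sub L L') :
    sdmap (borel_prism L' m) (borel_prism L m) :=
  sd_prod_map (borel_map h) (smap_id (simplex m)).

Lemma prism_map_comp (L L' L'' : galsub iota) m (h : gs_sub L L') (h' : gs_sub L' L'')
    (h'' : gs_sub L L'') : sdmap_comp (prism_map m h) (prism_map m h') = prism_map m h''.
Proof.
apply: sdmap_eq => U q [x al] /=; congr pair; apply: tsimp_eq => [i|i j ij] /=.
  by rewrite (Sp_map_comp h h' h''); apply: (@compmA (fet k)).
by rewrite (gal_res_comp h h' h'').
Qed.

Lemma prism_map_id (L : galsub iota) m (h : gs_sub L L) :
  prism_map m h = sdmap_id (borel_prism L m).
Proof.
apply: sdmap_eq => U q [x al] /=; congr pair; apply: tsimp_eq => [i|i j ij] /=.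
  by rewrite Sp_map_id; apply: (@comp1m (fet k)).
by rewrite gal_res_id.
Qed.

(** This is how fillers for the based simplices over [L], which are finite in
    number, provide fillers for those over [L']. *)
Lemma prism_map_based (L L' : galsub iota) m (h : gs_sub L L') q
    (b : borel_prism L' m (Sp L') q) : based b ->
  exists2 b0 : borel_prism L m (Sp L) q, based b0 &
    prism_map m h (Sp L') q b = sd_map (borel_prism L m) (Sp_map h) q b0.
Proof.
move=> bb; have [g [b0 b0b E]] := fg_ex (borel_free_gen L m) (prism_map m h (Sp L') q b).
exists b0 => //; rewrite E; suff -> : g = Sp_map h by [].
have E0 : compm (Sp_map h) (ts_ob b.1 ord0) = compm (ts_ob b0.1 ord0) g.
  by have := congr1 (fun z => ts_ob z.1 ord0) E.
by move: E0; rewrite bb b0b (@comp1m (fet k)) (@compm1 (fet k)).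
Qed.

Section Pull.
Variables (P : spsh k) (L L' : galsub iota) (m : nat) (h : gs_sub L L').

Definition pull (R : drel (borel_prism L m) P) : drel (borel_prism L' m) P :=
  fun U q b x => R U q (prism_map m h U q b) x.

Lemma pull_closed R : drel_closed R -> drel_closed (pull R).
Proof.
move=> Rc; split.
- by move=> U p q a b x Rx; have := drel_act Rc a Rx; rewrite /pull smap_nat.
- by move=> U V g q b x Rx; have := drel_map Rc g Rx; rewrite /pull sdm_nat.
Qed.

Lemma pull_partial A R : dpartial (@based L m) A R ->
  dpartial (@based L' m) (pull A) (pull R).
Proof.
move=> RP; split.
- exact: pull_closed (dp_closed RP).
- by move=> U q b x; apply: (dp_in RP).
- by move=> U q b x y; apply: (dp_fun RP).
- move=> U g q b bb [x]; rewrite /pull sdm_nat.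
  have [b0 bb0 E] := prism_map_based h bb; rewrite E -sd_comp => Rx.
  have [y Ry] : drel_dom R b0 by apply: (dp_gen RP) bb0 _; eexists; exact: Rx.
  exists (sd_map P (Sp_map h) q y); rewrite /pull E.
  exact: (drel_map (dp_closed RP)).
Qed.
End Pull.

Section Grow.
Variables (P Y : spsh k) (p : sdmap P Y) (m : nat).

Definition over (L : galsub iota) (psi : sdmap (borel_prism L m) Y) :
    drel (borel_prism L m) P := fun U q b x => p U q x = psi U q b.

Lemma over_closed L psi : drel_closed (@over L psi).
Proof.
split=> [U q r a b x|U V g q b x]; rewrite /over => px.
  by rewrite !smap_nat px.
by rewrite !sdm_nat px.
Qed.

Hypothesis dir : forall L L' : galsub iota,
  exists L'', inhabited (gs_sub L L'') /\ inhabited (gs_sub L' L'').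

Hypothesis local_lift : forall (L : galsub iota) q (y : Y (Sp L) q)
    (G : srel (simplex q) (P (Sp L))), srel_closed G -> srel_fun G ->
    (forall r (a : mono r q) x, G r a x -> p (Sp L) r x = sact a y) ->
    (forall r (a : mono r q), nonsurj a -> exists x, G r a x) ->
  exists (L' : galsub iota) (h : gs_sub L L') (x : P (Sp L') q),
    p (Sp L') q x = sd_map Y (Sp_map h) q y /\
    forall r (a : mono r q) z, nonsurj a -> G r a z ->
      sd_map P (Sp_map h) r z = sact a x.

(** A based simplex is determined by its group elements and by its vertices in
    Delta^m, so there are finitely many of dimension [q], and one field solves all
    the lifting problems that they pose.  Those over the new field are restrictions
    of the old ones, up to the comparison map, so they are filled as well. *)
Lemma grow_skel (L : galsub iota) (psi : sdmap (borel_prism L m) Y)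
    (R : drel (borel_prism L m) P) q :
  dpartial (@based L m) (over psi) R -> skel R q ->
  exists (L' : galsub iota) (h : gs_sub L L') (R' : drel (borel_prism L' m) P),
    [/\ dpartial (@based L' m) (over (sdmap_comp psi (prism_map m h))) R',
        drel_sub (pull h R) R' & skel R' q.+1].
Proof.
move=> RP Rq; have Rc := dp_closed RP.
pose cell_fill (b : borel_prism L m (Sp L) q) (L' : galsub iota) (h : gs_sub L L')
  (x : P (Sp L') q) := p (Sp L') q x = sd_map Y (Sp_map h) q (psi (Sp L) q b) /\
    forall r (a : mono r q) z, nonsurj a -> R (Sp L) r (sact a b) z ->
      sd_map P (Sp_map h) r z = sact a x.
have fill_ex b : exists (L' : galsub iota) (h : gs_sub L L') x, cell_fill b L' h x.
  apply: (local_lift (y := psi (Sp L) q b) (G := fun r a z => R (Sp L) r (sact a b) z)).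
  - by move=> r s a d z Rz; have := drel_act Rc a Rz; rewrite -sact_comp.
  - by move=> r a z z'; apply: (dp_fun RP).
  - by move=> r a z /(dp_in RP); rewrite /over smap_nat.
  - by move=> r a; apply: skel_nonsurj Rc Rq _.
pose F : finType := ({ffun 'I_q.+1 -> gal_of {: gal_elt L}} * {ffun 'I_q.+1 -> 'I_m.+1})%type.
pose code (b : borel_prism L m (Sp L) q) : F :=
  ([ffun i => @ts_mor _ _ _ _ b.1 ord0 i (leq0n i)], [ffun i => (b.2 : mono q m) i]).
have code_inj b b' : based b -> based b' -> code b = code b' -> b = b'.
  case: b b' => [x al] [x' al']; rewrite /based /= => bx bx' E.
  have emor i : @ts_mor _ _ _ _ x ord0 i (leq0n i) = @ts_mor _ _ _ _ x' ord0 i (leq0n i).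
    by have := congr1 (fun z : F => z.1 i) E; rewrite !ffunE.
  have eal i : al i = al' i.
    by have := congr1 (fun z : F => z.2 i) E; rewrite !ffunE.
  congr pair; last exact: mono_eq.
  apply: tsimp_eq => [i|i j ij].
    by rewrite ts_ob0 [RHS]ts_ob0 emor bx bx'.
  have := emor j.
  rewrite (@ts_comp _ _ _ _ x ord0 _ _ (leq0n i) ij).
  rewrite (@ts_comp _ _ _ _ x' ord0 _ _ (leq0n i) ij) emor.
  exact: (@mulIg _ _).
have [|t|L' [h hP]] := finite_dir (C := galcat iota)
  galcat_thin dir (I := F) (c := L)
  (P := fun t L' h => forall b, based b -> code b = t -> exists x, cell_fill b L' h x).
- move=> t L1 h1 L2 h2 H b bb bt; have [x [px xP]] := H b bb bt.
  have E12 : Sp_map (compm h2 h1 : gs_sub L L2) = @compm (fet k) _ _ _ (Sp_map h1) (Sp_map h2).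
    exact: Sp_map_comp.
  exists (sd_map P (Sp_map h2) q x); split.
    by rewrite sdm_nat px E12; apply/esym/sd_comp.
  move=> r a z ns Rz; rewrite -smap_nat -(xP _ _ _ ns Rz) E12.
  exact: sd_comp.
- case: (pselect (exists2 b, based b & code b = t)) => [[b bb bt]|nb].
    have [L' [h [x xP]]] := fill_ex b; exists L', h => b' bb' bt'.
    by exists x; rewrite (code_inj b' b) // bt'.
  by exists L, (@gs_refl L) => b bb bt; case: nb; exists b.
exists L', h.
have RP' := pull_partial h RP.
have RP'' : dpartial (@based L' m) (over (sdmap_comp psi (prism_map m h))) (pull h R).
  by case: RP' => ? ? ? ?; split.
have Rq' : skel (pull h R) q by move=> U r b rq; apply: Rq.
apply: (attach_cells (borel_free_gen L' m) (over_closed _) RP'' Rq').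
move=> b bb _; have [b0 bb0 E] := prism_map_based h bb.
have [x [px xP]] := hP (code b0) b0 bb0 erefl.
exists x; split.
  by rewrite /over px -[RHS]/(psi (Sp L') q (prism_map m h (Sp L') q b)) E sdm_nat.
move=> r a y ns; rewrite /pull smap_nat E -smap_nat => Ry.
have [z Rz] := skel_nonsurj b0 Rc Rq (leqnn q) ns.
rewrite -(xP _ _ _ ns Rz).
exact: dp_fun RP _ _ _ _ _ Ry (drel_map Rc (Sp_map h) Rz).
Qed.

Variable N : nat.
Hypothesis high_lift : forall (L : galsub iota) q, (N <= q)%N -> sphere_lift (p (Sp L)) q.

(** Below dimension [N] each step enlarges the field; from [N] on, fillers exist over
    the field reached by then. *)
Lemma lift_borel (L : galsub iota) (psi : sdmap (borel_prism L m) Y)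
    (R : drel (borel_prism L m) P) : dpartial (@based L m) (over psi) R ->
  exists (L' : galsub iota) (h : gs_sub L L') (H : sdmap (borel_prism L' m) P),
    sdmap_comp p H = sdmap_comp psi (prism_map m h) /\
    forall U q (b : borel_prism L' m U q) x, R U q (prism_map m h U q b) x -> H U q b = x.
Proof.
move=> RP.
have [L' [h [R' [R'P RR' R'N]]]] : exists (L' : galsub iota) (h : gs_sub L L')
    (R' : drel (borel_prism L' m) P),
    [/\ dpartial (@based L' m) (over (sdmap_comp psi (prism_map m h))) R',
        drel_sub (pull h R) R' & skel R' N].
  elim: N => [|q [L1 [h1 [R1 [R1P RR1 R1q]]]]].
    exists L, (@gs_refl L), R; split=> //.
      have -> : sdmap_comp psi (prism_map m (@gs_refl L)) = psi.
        by apply: sdmap_eq => U q b; rewrite prism_map_id.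
      exact: RP.
    by move=> U q b x; rewrite /pull prism_map_id.
  have [L2 [h2 [R2 [R2P RR2 R2q]]]] := grow_skel R1P R1q.
  have h12 : gs_sub L L2 by move=> x /h1/h2.
  exists L2, h12, R2; split=> //.
    have -> : sdmap_comp psi (prism_map m h12) =
        sdmap_comp (sdmap_comp psi (prism_map m h1)) (prism_map m h2).
      by rewrite -(prism_map_comp m h1 h2 h12); apply: sdmap_eq.
    exact: R2P.
  move=> U r b x Rx; apply/RR2/RR1; move: Rx; rewrite /pull.
  by rewrite -(prism_map_comp m h1 h2 h12).
have [|H [HK HR]] := extend_all (borel_free_gen L' m) (over_closed _) R'P R'N.
  move=> q S Nq SP R'S Sq b bb nb.
  have [||||x px xP] := high_lift (L := L') Nq
     (y := sdmap_comp psi (prism_map m h) (Sp L') q b) (G := fun r a z => S (Sp L') r (sact a b) z).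
  - by move=> r s a d z Rz; have := drel_act (dp_closed SP) a Rz; rewrite -sact_comp.
  - by move=> r a z z'; apply: (dp_fun SP).
  - by move=> r a z /(dp_in SP); rewrite /over smap_nat.
  - by move=> r a; apply: skel_nonsurj (dp_closed SP) Sq _.
  by exists x; split.
exists L', h, H; split; first by apply: sdmap_eq => U q b; apply: HK.
by move=> U q b x Rx; apply/HR/RR'.
Qed.
End Grow.
End Galois.

(** * Colimits of function complexes *)

Section HomHomotopy.
Variables (C : cat) (U P E : sdiag C) (H : sdmap (sd_prod P I1) E).

Program Definition hom_homotopy_at q (d : sprod (hom_sset U P) I1 q) (c : C) :
    smap (sd_prod U (simplex q) c) (E c) :=
  @SMap (sd_prod U (simplex q) c) (E c)
    (fun s b => H c s (d.1 c s b, mono_comp (d.2 : mono q 1) b.2)) _.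
Next Obligation.
move=> q [phi t] c r s a b; rewrite smap_nat -(smap_nat (H c)) /=.
by congr (H c _ (_, _)); rewrite mono_compA.
Qed.

Program Definition hom_homotopy_simp q (d : sprod (hom_sset U P) I1 q) : hom_sset U E q :=
  @SDMap C (sd_prod U (simplex q)) E (hom_homotopy_at d) _.
Next Obligation.
move=> q [phi t] x y h s b.
apply: etrans _ (@sdm_nat _ _ _ H _ _ h s (phi x s b, mono_comp (t : mono q 1) b.2)).
by rewrite /= -[sd_map P h s _](sdm_nat phi).
Qed.

Program Definition hom_homotopy : smap (sprod (hom_sset U P) I1) (hom_sset U E) :=
  @SMap (sprod (hom_sset U P) I1) (hom_sset U E) hom_homotopy_simp _.
Next Obligation.
move=> p q a [phi t]; apply: sdmap_eq => c s b /=.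
by congr (H c _ (_, _)); rewrite mono_compA.
Qed.
End HomHomotopy.

Section Assembly.
Variables (k K : fieldType) (iota : {rmorphism k -> K}).
Hypothesis dir : forall L L' : galsub iota,
  exists L'', inhabited (gs_sub L L'') /\ inhabited (gs_sub L' L'').

Lemma hom_borel_sphere_lift (P Y : spsh k) (p : sdmap P Y) N m :
  (forall q, sphere_lift (colim_map (sections_map iota p)) q) ->
  (forall (L : galsub iota) q, (N <= q)%N -> sphere_lift (p (Sp L)) q) ->
  sphere_lift (colim_map (hom_borel_map iota p)) m.
Proof.
move=> sec_lift high y G Gc Gf Gp Gd.
have loc (L : galsub iota) q (y' : Y (Sp L) q) (H : srel (simplex q) (P (Sp L))) :
    srel_closed H -> srel_fun H ->
    (forall r (a : mono r q) x, H r a x -> p (Sp L) r x = sact a y') ->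
    (forall r (a : mono r q), nonsurj a -> exists x, H r a x) ->
  exists (L' : galsub iota) (h : gs_sub L L') (x : P (Sp L') q),
    p (Sp L') q x = sd_map Y (Sp_map h) q y' /\
    forall r (a : mono r q) z, nonsurj a -> H r a z ->
      sd_map P (Sp_map h) r z = sact a x.
  exact: (colim_sphere_lift_local (@galcat_thin _ _ _) dir (sec_lift q) (c := L)).
have [L [psi [Gc0 [Gcc Gcf Gcp [yE GcG Gcd]]]]] :
  exists (L : galcat iota) (psi : hom_borel iota Y L m)
    (H : srel (simplex m) (hom_borel iota P L)),
    [/\ srel_closed H, srel_fun H,
     forall q (a : mono q m) x, H q a x -> hom_borel_map iota p L q x = sact a psi &
     [/\ cin psi = y, forall q (a : mono q m) x, H q a x -> G q a (cin x) &
      forall q (a : mono q m), nonsurj a -> exists x, H q a x]].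
  case: m y G Gc Gf Gp Gd => [|m] y G Gc Gf Gp Gd.
    have [L [psi ->]] := cin_surj y; exists L, psi, (fun _ _ _ => False).
    by split=> //; split=> // q a /not_nonsurj0.
  have [|L [psi [H [Hc Hf Hp [yE HG Hd]]]]] :=
    descend (@galcat_thin _ _ _) dir (J := predT) (j0 := ord0) isT Gc Gf Gp.
    by move=> q a j _ aj; apply: Gd; exists j.
  exists L, psi, H; split=> //; split=> // q a [j aj]; exact: Hd aj.
(* The map on (EG x_G Sp(L)) x (boundary of Delta^m) adjoint to the given sphere. *)
pose R : drel (borel_prism L m) P := fun U q b w =>
  nonsurj (b.2 : mono q m) /\ exists2 phi : hom_borel iota P L q, Gc0 q b.2 phi &
    w = phi U q (b.1, mono_id q).
have RP : dpartial (@based _ _ iota L m) (over p psi) R.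
  split; first split.
  - move=> U q r a [x al] w [ns [phi Gphi ->]]; split; first exact: nonsurj_comp.
    exists (sact a phi); first exact: Gcc.
    by rewrite -smap_nat.
  - move=> U V g q [x al] w [ns [phi Gphi ->]]; split=> //.
    by exists phi => //; rewrite -sdm_nat.
  - move=> U q [x al] w [ns [phi Gphi ->]]; rewrite /over /=.
    have := congr1 (fun z : hom_borel iota Y L q => z U q (x, mono_id q)) (Gcp _ _ _ Gphi).
    by rewrite /= mono_compI.
  - move=> U q [x al] w w' [_ [phi Gphi ->]] [_ [phi' Gphi' ->]].
    by rewrite (Gcf _ _ _ _ Gphi Gphi').
  - move=> U h q [x al] _ [w [ns [phi Gphi _]]].
    by eexists; split; [exact: ns|exists phi].
have [L' [h [H [pH HR]]]] := lift_borel dir loc high RP.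
exists (cin (D := hom_borel iota P) (c := L') H).
  rewrite colim_map_cin -yE -[RHS](cin_map (h : @mor (galcat iota) L L')).
  congr cin; apply: etrans pH _; exact: sdmap_eq.
move=> q a z ns Gz; have [phi Gphi] := Gcd _ _ ns.
rewrite (Gf _ _ _ _ Gz (GcG _ _ _ Gphi)) cin_act -(cin_map (h : @mor (galcat iota) L L')).
congr cin; apply: sdmap_eq => U r [x b] /=; apply/esym/HR; split; first exact: nonsurj_comp.
exists (sact b phi); first exact: Gcc.
by rewrite /= mono_compI.
Qed.

Theorem weak_equiv_of_directed (X Y : spsh k) (f : sdmap X Y)
    (X_kan : sectionwise_kan X) (Y_kan : sectionwise_kan Y)
    (f_local : local_weak_equiv iota f)
    (n : nat) (X_type : sectionwise_type n X) (Y_type : sectionwise_type n Y) :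
  weak_equiv (colim_map (hom_borel_map iota f)).
Proof.
pose P := cocyl_diag f; pose p := cocyl_diag_end f : sdmap P Y.
pose j := cocyl_diag_const f : sdmap X P; pose r := cocyl_diag_start f : sdmap P X.
pose H := cocyl_diag_shrink f.
have p_fib U : fibration (p U) by apply: cocyl_fibration.
have P_kan U : kan (P U) by apply: kan_of_fibration (p_fib U) (Y_kan U).
have pj U q x : p U q (j U q x) = f U q x by apply: (cocyl_end_const (f U)).
have jr U : elem_homotopic (smap_comp (j U) (r U)) (smap_id (P U)).
  exists (cocyl_shrink (f U)); split=> q x; first exact: cocyl_shrink0.
  exact: cocyl_shrink1.
have high U q : (n.+2 <= q)%N -> sphere_lift (p U) q.
  move=> nq; apply: fibration_sphere_lift (p_fib U) _ _.
    apply: retract_sphere_fill (P_kan U) (jr U) _.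
    exact: ntype_sphere_fill (X_kan U) (X_type U) nq.
  exact: ntype_sphere_fill (Y_kan U) (Y_type U) (leqW nq).
have sec : forall q, sphere_lift (colim_map (sections_map iota p)) q.
  apply: (weak_equiv_sphere_lift (f := colim_map (sections_map iota f))
    (j := colim_map (sections_map iota j)) (r := colim_map (sections_map iota r))) => //.
  - by apply: (colim_kan (@galcat_thin _ _ _) dir) => L; apply: P_kan.
  - by apply: (colim_kan (@galcat_thin _ _ _) dir) => L; apply: Y_kan.
  - by apply: (colim_fibration (@galcat_thin _ _ _) dir) => L; apply: p_fib.
  - by rewrite colim_map_comp; congr colim_map; apply: sdmap_eq => L q x; apply: pj.
  - rewrite colim_map_comp -colim_map_id; apply: rst_step.
    pose HS : sdmap (sd_prod (sections iota P) I1) (sections iota P) :=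
      @SDMap (galcat iota) (sd_prod (sections iota P) I1) (sections iota P)
        (fun L => H (Sp L)) (fun L L' h q x => @sdm_nat _ _ _ H (Sp L) (Sp L') (Sp_map h) q x).
    apply: (colim_homotopic (H := HS)) => L q x; first exact: cocyl_shrink0.
    exact: cocyl_shrink1.
apply: (sphere_lift_weak_equiv (p := colim_map (hom_borel_map iota p))
    (j := colim_map (hom_borel_map iota j)) (r := colim_map (hom_borel_map iota r))).
- rewrite colim_map_comp; congr colim_map.
  by apply: sdmap_eq => L q x; apply: sdmap_eq => U s b; apply: pj.
- rewrite colim_map_comp -colim_map_id; congr colim_map.
  by apply: sdmap_eq => L q x; apply: sdmap_eq => U s b.
- rewrite colim_map_comp -colim_map_id; apply: rst_step.
  have HN (L L' : galcat iota) (h : mor L L') q (d : sd_prod (hom_borel iota P) I1 L q) :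
      hom_homotopy (borel L') H q (sd_map (sd_prod (hom_borel iota P) I1) h q d) =
      sd_map (hom_borel iota P) h q (hom_homotopy (borel L) H q d) by exact: sdmap_eq.
  pose HB : sdmap (sd_prod (hom_borel iota P) I1) (hom_borel iota P) :=
    @SDMap (galcat iota) (sd_prod (hom_borel iota P) I1) (hom_borel iota P)
      (fun L => hom_homotopy (borel L) H) HN.
  apply: (colim_homotopic (H := HB)) => L q x; apply: sdmap_eq => U s b /=.
    exact: cocyl_shrink0.
  exact: cocyl_shrink1.
- by move=> q; apply: hom_borel_sphere_lift (fun L => high (Sp L)).
Qed.
End Assembly.

(** * The compositum of two Galois extensions *)

Import GRing.Theory.
Local Open Scope ring_scope.

Section Compositum.
Variables (k K : fieldType) (iota : {rmorphism k -> K}).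
Hypothesis K_algebraic : forall z : K, algebraicOver iota z.
Variables L1 L2 : finsub iota.

Definition compositum : {pred K} := fun x =>
  `[< exists s : seq (K * K), (forall uv, uv \in s -> uv.1 \in fs_mem L1 /\ uv.2 \in fs_mem L2) /\
      x = \sum_(uv <- s) uv.1 * uv.2 >].

Lemma compositumP x : reflect (exists s : seq (K * K),
    (forall uv, uv \in s -> uv.1 \in fs_mem L1 /\ uv.2 \in fs_mem L2) /\
    x = \sum_(uv <- s) uv.1 * uv.2) (x \in compositum).
Proof. exact: asboolP. Qed.

Lemma compositum_mul u v : u \in fs_mem L1 -> v \in fs_mem L2 -> u * v \in compositum.
Proof.
move=> uL vL; apply/compositumP; exists [:: (u, v)]; rewrite big_seq1; split=> //.
by move=> uv; rewrite inE => /eqP ->.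
Qed.

Lemma compositum0 : 0 \in compositum.
Proof. by apply/compositumP; exists [::]; rewrite big_nil. Qed.

Lemma compositumD x y : x \in compositum -> y \in compositum -> x + y \in compositum.
Proof.
move=> /compositumP[s [sL ->]] /compositumP[t [tL ->]]; apply/compositumP.
exists (s ++ t); rewrite big_cat; split=> // uv.
by rewrite mem_cat => /orP[/sL|/tL].
Qed.

Lemma compositum_sum (I : Type) (r : seq I) (P : pred I) (F : I -> K) :
  (forall i, P i -> F i \in compositum) -> \sum_(i <- r | P i) F i \in compositum.
Proof.
move=> FM; apply: (big_ind (fun x => x \in compositum)) => //; first exact: compositum0.
exact: compositumD.
Qed.

Lemma compositumM x y : x \in compositum -> y \in compositum -> x * y \in compositum.
Proof.
move=> /compositumP[s [sL ->]] /compositumP[t [tL ->]].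
rewrite mulr_suml big_seq; apply: compositum_sum => uv /sL[uL vL].
rewrite mulr_sumr big_seq; apply: compositum_sum => uv' /tL[uL' vL'].
by rewrite mulrACA; apply: compositum_mul; apply: rpredM.
Qed.

Lemma compositum_iota c : iota c \in compositum.
Proof. by rewrite -[iota c]mulr1; apply: compositum_mul (fs_base L1 c) (rpred1 _). Qed.

Lemma compositum1 : 1 \in compositum.
Proof. by rewrite -(rmorph1 iota) compositum_iota. Qed.

Lemma compositumN x : x \in compositum -> - x \in compositum.
Proof.
move=> xM; rewrite -mulN1r -(rmorphN1 iota); apply: compositumM xM.
exact: compositum_iota.
Qed.

Lemma compositum_horner (p : {poly k}) x : x \in compositum ->
  (map_poly iota p).[x] \in compositum.
Proof.
move=> xM; elim/poly_ind: p => [|p c IH]; first by rewrite map_poly0 horner0 compositum0.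
rewrite rmorphD rmorphM /= map_polyX map_polyC hornerMXaddC.
by apply: compositumD (compositum_iota c); apply: compositumM.
Qed.

(** An equation of [x] has the form p(x) x + c = 0.  If c is nonzero, the inverse of
    [x] is - p(x) / c; otherwise p(x) = 0 is an equation of smaller degree. *)
Lemma compositumV x : x \in compositum -> x^-1 \in compositum.
Proof.
move=> xM; have [->|x0] := eqVneq x 0; first by rewrite invr0 compositum0.
have [p] := K_algebraic x; elim/poly_ind: p => [|p c IH]; first by rewrite eqxx.
move=> pc0; rewrite /root rmorphD rmorphM /= map_polyX map_polyC hornerMXaddC.
rewrite -[X in _ + X]/(iota c).
have [c0|c0] := eqVneq c 0.
  rewrite c0 rmorph0 addr0 mulf_eq0 (negbTE x0) orbF => px; apply: IH => //.
  by apply: contraNneq pc0 => ->; rewrite c0 mul0r addr0.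
rewrite addr_eq0 => /eqP px.
have ic0 : iota c != 0 by rewrite fmorph_eq0.
have -> : x^-1 = iota (- c^-1) * (map_poly iota p).[x].
  apply: (mulIf x0); rewrite mulVf // -mulrA px rmorphN fmorphV mulrNN mulVf //.
by apply: compositumM; [apply: compositum_iota|apply: compositum_horner].
Qed.

Fact compositum_closed : divring_closed compositum.
Proof.
split=> [|x y xM yM|x y xM yM]; first exact: compositum1.
  exact/compositumD/compositumN.
exact/compositumM/compositumV.
Qed.

Fact compositum_fin : exists n (b : 'I_n -> K), (forall i, b i \in compositum) /\
  {in compositum, forall x, exists c : 'I_n -> k, x = \sum_i iota (c i) * b i}.
Proof.
have [n1 [b1 [b1L sp1]]] := fs_fin L1; have [n2 [b2 [b2L sp2]]] := fs_fin L2.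
pose I : finType := ('I_n1 * 'I_n2)%type.
exists #|I|, (fun i => let: (i1, i2) := enum_val i in b1 i1 * b2 i2); split.
  by move=> i; case: (enum_val i) => i1 i2; apply: compositum_mul.
suff H x : x \in compositum -> exists c : I -> k, x = \sum_i iota (c i) * (b1 i.1 * b2 i.2).
  move=> x /H[c ->]; exists (fun i => c (enum_val i)).
  rewrite [LHS](reindex (@enum_val I predT)) /=; last first.
    by exists enum_rank => i _; [apply: enum_valK|apply: enum_rankK].
  by apply: eq_bigr => i _; case: (enum_val i).
move=> /compositumP[s [sL ->]]; elim: s sL => [|[u v] s IH] sL.
  by exists (fun=> 0); rewrite big_nil big1 // => i _; rewrite rmorph0 mul0r.
have [|c cE] := IH; first by move=> uv uvs; apply: sL; rewrite inE uvs orbT.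
have [/= uL vL] := sL (u, v) (mem_head _ _).
have [c1 uE] := sp1 u uL; have [c2 vE] := sp2 v vL.
exists (fun i => c1 i.1 * c2 i.2 + c i); rewrite big_cons cE /= [in LHS]uE [in LHS]vE.
rewrite big_distrlr /= (pair_bigA _ (fun i j => iota (c1 i) * b1 i * (iota (c2 j) * b2 j))) /=.
rewrite -big_split /=; apply: eq_bigr => i _.
by rewrite rmorphD rmorphM mulrDl mulrACA.
Qed.

Definition compositum_fs : finsub iota :=
  FinSub compositum_closed compositum_iota compositum_fin.

Lemma compositum_subl : {subset fs_mem L1 <= compositum}.
Proof. by move=> x xL; rewrite -[x]mulr1; apply: compositum_mul (rpred1 _). Qed.

Lemma compositum_subr : {subset fs_mem L2 <= compositum}.
Proof. by move=> x xL; rewrite -[x]mul1r; apply: compositum_mul (rpred1 _) xL. Qed.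
End Compositum.

Section Incl.
Variables (k K : fieldType) (iota : {rmorphism k -> K}) (L M : finsub iota).
Hypothesis LM : {subset fs_mem L <= fs_mem M}.

Definition fs_incl_fun (x : fs_elt L) : fs_elt M := FsElt (LM (fs_valP x)).

Fact fs_incl_linear : linear fs_incl_fun.
Proof. by move=> c x y; apply: val_inj. Qed.
HB.instance Definition _ :=
  GRing.isLinear.Build k (fs_elt L) (fs_elt M) _ fs_incl_fun fs_incl_linear.
Fact fs_incl_monoid_morphism : monoid_morphism fs_incl_fun.
Proof. by split=> [|x y]; apply: val_inj. Qed.
HB.instance Definition _ :=
  GRing.isMonoidMorphism.Build (fs_elt L) (fs_elt M) fs_incl_fun fs_incl_monoid_morphism.

Definition fs_incl : 'AHom(fs_elt L, fs_elt M) := linfun_ahom fs_incl_fun.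

Lemma fs_inclE x : fs_val (fs_incl x) = fs_val x. Proof. by rewrite lfunE. Qed.

Lemma fs_incl_poly (q : {poly k}) :
  map_poly (in_alg (fs_elt M)) q = map_poly fs_incl (map_poly (in_alg (fs_elt L)) q).
Proof. by rewrite -map_poly_comp; apply: eq_map_poly => c /=; rewrite rmorph_alg. Qed.
End Incl.

Section CompositumGalois.
Variables (k K : fieldType) (iota : {rmorphism k -> K}).
Hypothesis K_algebraic : forall z : K, algebraicOver iota z.
Variables L1 L2 : galsub iota.

Let M := compositum_fs K_algebraic L1 L2.
Let i1 := fs_incl (@compositum_subl _ _ _ L1 L2 : {subset fs_mem L1 <= fs_mem M}).
Let i2 := fs_incl (@compositum_subr _ _ _ L1 L2 : {subset fs_mem L2 <= fs_mem M}).

Lemma compositum_gen (r1 : seq (fs_elt L1)) (r2 : seq (fs_elt L2)) :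
  <<1 & r1>>%VS = fullv -> <<1 & r2>>%VS = fullv ->
  <<1 & map i1 r1 ++ map i2 r2>>%VS = fullv.
Proof.
move=> g1 g2; apply/eqP; rewrite eqEsubv subvf /=; apply/subvP => x _.
pose V := <<1 & map i1 r1 ++ map i2 r2>>%AS; suff: x \in V by [].
have m1 u : i1 u \in V.
  have : i1 u \in (i1 @: fullv)%VS by apply/memv_img/memvf.
  rewrite -g1 aimg_adjoin_seq aimg1; apply: subvP.
  by apply: adjoin_seqSr => z zr; rewrite mem_cat zr.
have m2 u : i2 u \in V.
  have : i2 u \in (i2 @: fullv)%VS by apply/memv_img/memvf.
  rewrite -g2 aimg_adjoin_seq aimg1; apply: subvP.
  by apply: adjoin_seqSr => z zr; rewrite mem_cat zr orbT.
have /compositumP[s [sL xE]] := fs_valP x.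
suff H (y : fs_elt M) (t : seq (K * K)) :
    (forall uv, uv \in t -> uv.1 \in fs_mem L1 /\ uv.2 \in fs_mem L2) ->
    fs_val y = \sum_(uv <- t) uv.1 * uv.2 -> y \in V by apply: H sL xE.
elim: t y => [|[u v] t IH] y tL.
  by rewrite big_nil => y0; have -> : y = 0 by [apply: val_inj]; rewrite mem0v.
rewrite big_cons /= => yE.
have [/= uL vL] := tL (u, v) (mem_head _ _).
have -> : y = i1 (FsElt uL) * i2 (FsElt vL) + (y - i1 (FsElt uL) * i2 (FsElt vL)).
  by rewrite addrC subrK.
apply: memvD; first by apply: memvM.
apply: IH; first by move=> uv uvt; apply: tL; rewrite inE uvt orbT.
have -> : fs_val (y - i1 (FsElt uL) * i2 (FsElt vL)) =
   fs_val y - fs_val (i1 (FsElt uL)) * fs_val (i2 (FsElt vL)) by [].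
by rewrite !fs_inclE yE /= addrC addKr.
Qed.

Lemma incl_eqp (L : finsub iota) (LM : {subset fs_mem L <= fs_mem M}) (q : {poly k}) rs :
  map_poly (in_alg (fs_elt L)) q %= \prod_(z <- rs) ('X - z%:P) ->
  map_poly (in_alg (fs_elt M)) q %= \prod_(z <- map (fs_incl LM) rs) ('X - z%:P).
Proof.
move=> Dq; rewrite (fs_incl_poly LM) big_map.
rewrite -(eqp_map (fs_incl LM)) in Dq.
apply: (eqp_trans Dq); rewrite rmorph_prod /=.
by under eq_bigr do rewrite rmorphB /= map_polyX map_polyC /=; exact: eqpxx.
Qed.

Lemma compositum_splitting : SplittingField.axiom (fs_elt M).
Proof.
have [p1 /polyOver1P[q1 ->] [r1 D1 g1]] := fsp_split L1.
have [p2 /polyOver1P[q2 ->] [r2 D2 g2]] := fsp_split L2.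
exists (map_poly (in_alg (fs_elt M)) (q1 * q2)); first by apply/polyOver1P; exists (q1 * q2).
exists (map i1 r1 ++ map i2 r2); last exact: compositum_gen.
rewrite rmorphM big_cat /=; apply: eqp_trans (eqp_mulr _ _) (eqp_mull _ _); exact: incl_eqp.
Qed.

Definition compositum_split : finsplit iota := FinSplit compositum_splitting.

Lemma incl_separable (L : galsub iota) (LM : {subset fs_mem L <= fs_mem M}) (z : gal_elt L) :
  separable_element 1 (fs_incl LM z : gal_elt compositum_split).
Proof.
have /separableP/(_ z (memvf z))/separable_elementP[g [/polyOver1P[q ->] qz sq]] :=
  gs_separable L.
apply/separable_elementP; exists (map_poly (in_alg (fs_elt M)) q); split.
- by apply/polyOver1P; exists q.
- by rewrite (fs_incl_poly LM) fmorph_root.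
- by rewrite separable_map in sq; rewrite separable_map; exact: sq.
Qed.

(** The compositum is generated by roots of two polynomials, hence it splits their
    product, and these roots are separable. *)
Lemma compositum_galois : galois 1 {: gal_elt compositum_split}.
Proof.
have [p1 _ [r1 _ g1]] := fsp_split L1; have [p2 _ [r2 _ g2]] := fsp_split L2.
apply/and3P; split; first exact: sub1v.
  rewrite -(compositum_gen g1 g2); apply/separable_Fadjoin_seq/allP => z.
  by rewrite mem_cat => /orP[] /mapP[u _ ->]; apply: incl_separable.
by apply/splitting_normalField; [apply: sub1v|apply: compositum_splitting].
Qed.

Lemma galsub_directed : exists L : galsub iota,
  inhabited (gs_sub L1 L) /\ inhabited (gs_sub L2 L).
Proof.
exists (GalSub compositum_galois).
by split; apply: inhabits; [apply: compositum_subl|apply: compositum_subr].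
Qed.
End CompositumGalois.

(** * The comparison over all finite Galois extensions *)

Theorem corollary2 (k : fieldType) (kbar : closedFieldType)
    (iota : {rmorphism k -> kbar})
    (kbar_algebraic : forall z : kbar, algebraicOver iota z)
    (X Y : spsh k) (f : sdmap X Y)
    (X_kan : sectionwise_kan X) (Y_kan : sectionwise_kan Y)
    (f_local : local_weak_equiv iota f)
    (n : nat) (X_type : sectionwise_type n X) (Y_type : sectionwise_type n Y) :
  weak_equiv (colim_map (hom_borel_map iota f)).
Proof.
exact: weak_equiv_of_directed (galsub_directed kbar_algebraic) X Y f
  X_kan Y_kan f_local n X_type Y_type.
Qed.
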